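(* Let $\vec p=(p_1,\dots,p_n)$ with $1<p_i<\infty$ for all $i$, and let $t,r$ satisfy either $1<\frac{n}{\sum_{i=1}^n1/p_i}<t<r<\infty$ or $1<\frac{n}{\sum_{i=1}^n1/p_i}\le t<r=\infty$. Let $T$ be a singular integral operator. Then there is a constant $C>0$ such that for all $g\in\mathcal H_{\vec p\,'}^{t',r'}$, $$\|Tg\|_{\mathcal H_{\vec p\,'}^{t',r'}}\le C\|g\|_{\mathcal H_{\vec p\,'}^{t',r'}}.$$
   Context: A singular integral operator is an $L^2(\mathbb R^n)$-bounded linear operator $T$ with a kernel $K(x,y)$ such that: (i) there exist $\epsilon,c>0$ with $|K(x,y)|\le c|x-y|^{-n}$ for $x\ne y$ and $$|K(x,y)-K(z,y)|+|K(y,x)-K(y,z)|\le c\frac{|x-z|^\epsilon}{|x-y|^{n+\epsilon}}\quad\text{if }|x-y|\ge2|x-z|>0;$$ (ii) if $f$ is bounded with compact support, then $Tf(x)=\int_{\mathbb R^n}K(x,y)f(y)\,dy$ for $x\notin\operatorname{supp}f$. Such $T$ extends boundedly to $L^{\vec p\,'}$; on $\mathcal H_{\vec p\,'}^{t',r'}$ it is understood as the continuous extension from the dense subspace of compactly supported functions in $L^{\vec p\,'}$. For $j\in\mathbb Z$, $k\in\mathbb Z^n$, let $Q_{j,k}=\prod_{i=1}^n[2^{-j}k_i,2^{-j}(k_i+1))$. A prime on an exponent denotes the conjugate exponent, and $\vec p\,'=(p_1',\dots,p_n')$. Mixed Lebesgue norm: for measurable $f$ on $\mathbb R^n$, $$\|f\|_{L^{\vec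 p}}=\Big(\int_{\mathbb R}\cdots\Big(\int_{\mathbb R}|f(x_1,\dots,x_n)|^{p_1}dx_1\Big)^{p_2/p_1}\cdots dx_n\Big)^{1/p_n}$$ (innermost integration in $x_1$). Blocks: a measurable function $b$ is a $(\vec p\,',t')$-block supported on a cube $Q$ if $b$ is supported on $Q$ and $\|b\|_{L^{\vec p\,'}}\le|Q|^{\frac1t-\frac1n\sum_{i=1}^n\frac1{p_i}}$. Block space $\mathcal H_{\vec p\,'}^{t',r'}$: all measurable $g$ that can be written $g=\sum_{(j,k)\in\mathbb Z^{n+1}}\lambda_{j,k}b_{j,k}$ with convergence almost everywhere on $\mathbb R^n$, where $\lambda=\{\lambda_{j,k}\}\in\ell^{r'}(\mathbb Z^{n+1})$ and each $b_{j,k}$ is a $(\vec p\,',t')$-block supported on $Q_{j,k}$; $\|g\|_{\mathcal H_{\vec p\,'}^{t',r'}}=\inf_\lambda\|\lambda\|_{\ell^{r'}}$ over all such representations. *)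

(* Defs.v *)
From HB Require Import structures.
From mathcomp Require Import all_boot all_order all_algebra.
From mathcomp Require Import complex finmap.
From mathcomp Require Import all_classical all_reals all_analysis.
From mathcomp.analysis Require Import showcase.summability.
Import Order.TTheory GRing.Theory Num.Theory.
Import numFieldNormedType.Exports.
Import ComplexField.Normc.

Set Implicit Arguments.
Unset Strict Implicit.
Unset Printing Implicit Defensive.

Local Open Scope classical_set_scope.
Local Open Scope ring_scope.

Definition consR (R : realType) (n : nat) (x : R) (y : n.-tuple R) :
  n.+1.-tuple R := [tuple of x :: y].

(* R^n is n.-tuple R, with the product sigma-algebra of the library.
   Its Lebesgue measure is defined by slicing along the first coordinate. *)
Fixpoint leb_fun (R : realType) (n : nat) : set (n.-tuple R) -> \bar R :=
  match n with
  | 0 => fun A => \d_([tuple] : 0.-tuple R) A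
  | m.+1 => fun A => (\int[@lebesgue_measure R]_x
                        leb_fun [set y | A (consR x y)])%E
  end.

Section leb_is_measure.
Variable R : realType.

Let cons2 (n : nat) (z : R * n.-tuple R) : n.+1.-tuple R :=
  consR z.1 z.2.
Let uncons (n : nat) (x : n.+1.-tuple R) : R * n.-tuple R :=
  (thead x, [tuple of behead x]).

Let unconsK n : cancel (@cons2 n) (@uncons n).
Proof.
by move=> [a y]; rewrite /cons2 /uncons /consR /= theadE; congr pair; exact: val_inj.
Qed.

Let measurable_cons2 n : measurable_fun [set: R * n.-tuple R] (@cons2 n).
Proof. exact: measurable_cons. Qed.

Let measurable_uncons n : measurable_fun [set: n.+1.-tuple R] (@uncons n).
Proof.
apply: measurable_fun_pair; last exact: measurable_behead.
exact: (@measurable_tnth _ R n.+1 ord0).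
Qed.

Lemma leb_fun_measure n :
  exists mu : {sigma_finite_measure set (n.-tuple R) -> \bar R},
    @leb_fun R n = mu.
Proof.
elim: n => [|n [mu IH]].
  by exists [the {sigma_finite_measure set _ -> \bar R} of
    \d_([tuple] : 0.-tuple R)].
pose l1 : {sigma_finite_measure set (measurableTypeR R) -> \bar R} :=
  @lebesgue_measure R.
pose pm : {measure set (measurableTypeR R * n.-tuple R)%type -> \bar R} :=
  (l1 \x mu)%E.
have mc : measurable_fun setT (@cons2 n : (measurableTypeR R * n.-tuple R)%type -> _).
  exact: measurable_cons2.
have sf : sigma_finite setT (pushforward pm (@cons2 n)).
  have /sigma_finiteP[F [TF ndF Foo]] := sigma_finiteT l1.
  have /sigma_finiteP[G [TG ndG Goo]] := sigma_finiteT mu.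
  exists (fun k => @uncons n @^-1` (F k `*` G k)).
    apply/seteqP; split => // x _.
    have [i _ Fi] : (\bigcup_i F i) (uncons x).1 by rewrite -TF.
    have [j _ Gj] : (\bigcup_i G i) (uncons x).2 by rewrite -TG.
    exists (maxn i j) => //; split.
      by move: Fi; exact/subsetPset/ndF/leq_maxl.
    by move: Gj; exact/subsetPset/ndG/leq_maxr.
  move=> k; have [mF Fk] := Foo k; have [mG Gk] := Goo k.
  split; first by rewrite -[_ @^-1` _]setTI; apply: measurable_uncons => //;
    exact: measurableX.
  rewrite /pushforward /=.
  have -> : @cons2 n @^-1` (@uncons n @^-1` (F k `*` G k)) = F k `*` G k.
    by rewrite -comp_preimage (_ : _ \o _ = id) //; apply/funext/unconsK.
  by rewrite /pm /= product_measure1E// lte_mul_pinfty// ge0_fin_numE.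
pose nu : {measure set (n.+1.-tuple R) -> \bar R} :=
  measure_function_pushforward__canonical__measure_function_Measure pm mc.
pose h := @Measure_isSigmaFinite.Build _ _ _ nu sf.
pose nu' : {sigma_finite_measure set (n.+1.-tuple R) -> \bar R} :=
  HB.pack (pushforward pm (@cons2 n)) nu h.
exists (nu' mc); apply/funext => A; rewrite /= /pushforward /pm /= /product_measure1.
rewrite IH; apply: eq_integral => x _ /=; congr (mu _).
by apply/seteqP; split => y /=; rewrite /xsection /= ?inE.
Qed.

Definition leb n : {sigma_finite_measure set (n.-tuple R) -> \bar R} :=
  sval (cid (leb_fun_measure n)).

Lemma lebE n : leb n = leb_fun (n := n) :> (set _ -> _).
Proof. by rewrite /leb; case: cid => mu /= ->. Qed.

End leb_is_measure.
Arguments leb {R n}.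

Section definitions.
Variables (R : realType) (n : nat).
Local Notation E := (n.-tuple R).
Local Notation C := (R[i]).
Implicit Types (f g : E -> C) (x y z : E).

Definition eucl_dist x y : R := Num.sqrt (\sum_(i < n) (tnth x i - tnth y i) ^+ 2).

Definition cmeasurable f :=
  measurable_fun setT (fun x => complex.Re (f x)) /\
  measurable_fun setT (fun x => complex.Im (f x)).

Definition cintegral f : C :=
  Complex (\int[leb]_x complex.Re (f x)) (\int[leb]_x complex.Im (f x)).

Definition cmod f : E -> \bar R := fun x => (normc (f x))%:E.

(* The topology of R^n is that of 'rV[R]_n. *)
Definition to_row x : 'rV[R]_n := \row_i tnth x i.

Definition row_support f : set 'rV[R]_n :=
  closure (to_row @` [set x | f x != 0]).

Definition compact_support f := compact (row_support f).

Definition aeq f g := {ae leb, forall x, f x = g x}.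

Definition L2 : set (E -> C) :=
  [set f | cmeasurable f /\ ('N[leb]_2%:E[cmod f] < +oo)%E].

End definitions.

(* [q] lists the exponents of x_1, .., x_n in this order; each step takes the
   norm in the first remaining variable, so x_1 is the innermost one. *)
Fixpoint mixed_norm (R : realType) (n : nat) :
    n.-tuple R -> (n.-tuple R -> \bar R) -> \bar R :=
  match n with
  | 0 => fun _ F => F [tuple]
  | m.+1 => fun q F => mixed_norm [tuple of behead q]
      (fun y => Lnorm (@lebesgue_measure R) (thead q)%:E
                      (fun x => F (consR x y)))
  end.

Definition conj_exp (R : realType) (r : \bar R) : R :=
  fine (hoelder_conjugate r).

Definition conj_vec (R : realType) (n : nat) (p : n.-tuple R) : n.-tuple R :=
  [tuple of [seq conj_exp a%:E | a <- p]].

Definition harmonic_sum (R : realType) (n : nat) (p : n.-tuple R) : R :=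
  \sum_(i < n) (tnth p i)^-1.

Section operators.
Variables (R : realType) (n : nat).
Local Notation E := (n.-tuple R).
Local Notation C := (R[i]).
Implicit Types (f g : E -> C) (T : (E -> C) -> (E -> C)) (q : n.-tuple R).

Definition Lmixed q : set (E -> C) :=
  [set f | cmeasurable f /\ (mixed_norm q (cmod f) < +oo)%E].

(* Functions stand for their classes modulo almost everywhere equality, so
   linearity is an equality of classes. *)
Definition linear_on (D : set (E -> C)) T :=
  forall (a : C) f g, D f -> D g ->
    aeq (T (fun x => a * f x + g x)) (fun x => a * T f x + T g x).

Definition bounded_linear_on (D : set (E -> C)) (N : (E -> \bar R) -> \bar R)
    T :=
  [/\ forall f, D f -> D (T f), linear_on D T &
      exists2 c : R, 0 < c &
        forall f, D f -> (N (cmod (T f)) <= c%:E * N (cmod f))%E].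

Definition cz_kernel (K : E -> E -> C) :=
  exists eps c : R, [/\ 0 < eps, 0 < c,
    forall x y, x != y -> normc (K x y) <= c * eucl_dist x y ^- n &
    forall x y z, 0 < 2 * eucl_dist x z <= eucl_dist x y ->
      normc (K x y - K z y) + normc (K y x - K y z) <=
        c * (eucl_dist x z `^ eps / eucl_dist x y `^ (n%:R + eps))].

Definition singular_integral_operator T :=
  bounded_linear_on (@L2 R n) (Lnorm leb 2%:E) T /\
  exists2 K, cz_kernel K &
    forall f, cmeasurable f -> (exists M : R, forall x, normc (f x) <= M) ->
      compact_support f ->
      {ae leb, forall x, ~ row_support f (to_row x) ->
        T f x = cintegral (fun y => K x y * f y)}.

(* [Tq] is the bounded extension of [T] to the mixed space of exponent [q]. *)
Definition Lmixed_extension q T Tq :=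
  bounded_linear_on (Lmixed q) (mixed_norm q) Tq /\
  forall f, L2 f -> Lmixed q f -> aeq (Tq f) (T f).

Definition dyadic_cube (j : int) (k : n.-tuple int) : set E :=
  [set x | forall i : 'I_n,
    2 ^ (- j) * (tnth k i)%:~R <= tnth x i < 2 ^ (- j) * ((tnth k i)%:~R + 1)].

(* In what follows [p], [t], [r] are the unprimed exponents: [block p t Q] is
   the set of (p', t')-blocks and [block_space p t r] is H_{p'}^{t',r'}. *)
Definition block (p : n.-tuple R) (t : R) (Q : set E) (b : E -> C) :=
  [/\ cmeasurable b, forall x, ~ Q x -> b x = 0 &
      (mixed_norm (conj_vec p) (cmod b) <=
         leb Q `^ (t^-1 - n%:R^-1 * harmonic_sum p))%E].

Definition dyadic_index : choiceType := (int * n.-tuple int)%type.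

Definition lnorm (q : R) (lam : dyadic_index -> C) : \bar R :=
  ((\esum_(a in [set: dyadic_index]) (normc (lam a) `^ q)%:E) `^ q^-1)%E.

(* As absolute values are summable almost everywhere, unordered summation over
   the index set agrees with any other summation method. *)
Definition block_representation (p : n.-tuple R) (t : R) (g : E -> C)
    (lam : dyadic_index -> C) (b : dyadic_index -> E -> C) :=
  (forall a, block p t (dyadic_cube a.1 a.2) (b a)) /\
  {ae leb, forall x,
    (fun J : {fset dyadic_index} => normc (g x - \sum_(a <- J) lam a * b a x))
      @ totally --> (0 : R)}.

Section block_space.
Variables (p : n.-tuple R) (t : R) (r : \bar R).

Definition block_coefs g : set (dyadic_index -> C) :=
  [set lam | (lnorm (conj_exp r) lam < +oo)%E /\
             exists b, block_representation p t g lam b].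

Definition block_space : set (E -> C) :=
  [set g | cmeasurable g /\ block_coefs g !=set0].

Definition block_norm g : \bar R :=
  ereal_inf [set lnorm (conj_exp r) lam | lam in block_coefs g].

Definition dense_subspace : set (E -> C) :=
  [set f | Lmixed (conj_vec p) f /\ compact_support f].

Definition block_cvg (f : nat -> E -> C) g :=
  (fun k => block_norm (fun x => f k x - g x)) @ \oo --> 0%E.

Definition continuous_extension T S :=
  [/\ forall g, block_space g -> block_space (S g),
      forall f, dense_subspace f -> aeq (S f) (T f) &
      forall g, block_space g ->
        (exists2 f : nat -> E -> C, (forall k, dense_subspace (f k)) &
           block_cvg f g) /\
        (forall f : nat -> E -> C, (forall k, dense_subspace (f k)) ->
           block_cvg f g -> block_cvg (fun k => T (f k)) (S g))].

End block_space.
End operators.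

(* Main.v *)
(* The block norm of [g] is the infimum, over nonnegative [u_a] supported on the
   dyadic cubes [Q_a] with [|g| <= sum_a u_a] a.e., of the l^{r'} norm of the
   weighted numbers [||u_a||_{p'}]: a majorant of [|g|] can be cut down greedily
   to portions adding up to exactly [|g|], whose partial sums converge to [g] by
   dominated convergence.

   If [f] lives on a dyadic cube [Q] of side [d], then [T f] is controlled near
   [Q] by the boundedness on L^{p'}, and outside the neighbours of the [l]-th
   dyadic ancestor of [Q] by the size of the kernel, namely by
   [(2^l d)^{-n} ||f||_1]. So [T f] is dominated by one atom on each neighbour
   of each ancestor of [Q], whose coefficient decays like [2^{-l n/t}]. Regrouping
   the atoms by the cube they live on costs [2^{l n/r}] by Hoelder, as a cube has
   [2^{l n}] descendants [l] generations below, and [t < r] makes the sum over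
   [l] converge.

   The operator extends by completeness: functions of finite norm are finite
   almost everywhere, so the series of the increments of a fast Cauchy sequence
   converges absolutely almost everywhere. *)

Require Import Defs.
From mathcomp Require Import all_boot all_order all_algebra.
From mathcomp Require Import complex finmap.
From mathcomp Require Import all_classical all_reals all_analysis.
From mathcomp Require Import measurable_realfun lra ring zify.
From mathcomp.analysis Require Import showcase.summability.
Import ComplexField.Normc.
Import Order.TTheory GRing.Theory Num.Theory.
Import numFieldNormedType.Exports.
Set Implicit Arguments.
Unset Strict Implicit.
Unset Printing Implicit Defensive.
Local Open Scope classical_set_scope.
Local Open Scope ring_scope.

(** * Countable sums and Lebesgue norms *)

(** The exponents are traded for [q = p'], [rho = r'] and [s = sum_i 1/p_i - n/t], so that
    [n - harmonic_sum q - s = n/t] and [n (1 - 1/rho) = n/r]. The conditions on [t] and [r] enter as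
    [1 <= rho], [0 <= s], the implication from [s = 0] to [rho = 1], and
    [n (1 - 1/rho) < n - harmonic_sum q - s]. The last one makes both the sum over ancestors in the
    operator bound and the contribution of small cubes to a finite norm converge; the two before it
    control large cubes.

    The block norm is an infimum over complex representations, in which cancellation can occur.
    Majorants remove this obstacle: the new norm sees only [|g|], is monotone and is countably
    subadditive.

    [T] has a pointwise formula only on bounded functions of compact support, and [Tp] is known only
    through a norm inequality, so a series of atoms cannot simply be moved through [Tp]. A function
    of L^{p'} is instead cut into portions whose partial sums converge to it in L^{p'}, and
    pointwise bounds are carried over by norm limits. *)

Section countable_sums.
Local Open Scope ereal_scope.
Variables (R : realType) (I : countType).

(** Coding the index set into [nat] turns an unordered sum into a series, to which monotone
    convergence applies. Numbers that code nothing contribute 0. *)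
Lemma esum_countType (a : I -> \bar R) : (forall i, 0 <= a i) ->
  \esum_(i in setT) a i = \sum_(k <oo) oapp a 0 (pickle_inv k).
Proof.
move=> a0; rewrite nneseries_esumT; last by move=> k; case: pickle_inv.
have inj : set_inj setT (@choice.pickle I).
  by move=> x y _ _; exact: (pcan_inj (@pickleK_inv I)).
transitivity (\esum_(k in (@choice.pickle I) @` setT) oapp a 0 (pickle_inv k)).
  rewrite (esum_image _ _ _ inj).
  by apply: eq_esum => i _; rewrite pickleK_inv.
rewrite esum_mkcond; apply: eq_esum => k _.
case: ifPn => // /negP kI; case E : (pickle_inv k) => [i|] //=.
exfalso; apply: kI; rewrite inE; exists i => //.
by have := @pickle_invK I k; rewrite E.
Qed.

Lemma esum_sup_term (a : I -> \bar R) i : (forall i, 0 <= a i) ->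
  a i <= \esum_(j in setT) a j.
Proof.
by move=> a0; rewrite (esumID [set i])// setTI esum_set1// leeDl// esum_ge0.
Qed.

Lemma esumZl (c : R) (a : I -> \bar R) : (0 <= c)%R -> (forall i, 0 <= a i) ->
  \esum_(i in setT) (c%:E * a i) = c%:E * \esum_(i in setT) a i.
Proof.
move=> c0 a0; rewrite !esum_countType//; last by move=> i; rewrite mule_ge0.
rewrite -nneseriesZl//; last by move=> k _; case: pickle_inv.
by apply: eq_eseriesr => k _; case: pickle_inv => //=; rewrite mule0.
Qed.

Lemma measurable_esum d (T : measurableType d) (F : I -> T -> \bar R) :
  (forall i, measurable_fun [set: T] (F i)) -> (forall i x, 0 <= F i x) ->
  measurable_fun [set: T] (fun x => \esum_(i in setT) F i x).
Proof.
move=> mF F0; under eq_fun do rewrite esum_countType//.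
by apply: ge0_emeasurable_sum => [k x _ _|k _]; case: pickle_inv => //=.
Qed.

Lemma integral_esum d (T : measurableType d) (mu : {measure set T -> \bar R})
    (F : I -> T -> \bar R) :
  (forall i, measurable_fun [set: T] (F i)) -> (forall i x, 0 <= F i x) ->
  \int[mu]_x (\esum_(i in setT) F i x) =
  \esum_(i in setT) \int[mu]_x F i x.
Proof.
move=> mF F0; under eq_integral do rewrite esum_countType//.
rewrite integral_nneseries//; last 2 first.
- by move=> k; case: pickle_inv => //= i; exact: mF.
- by move=> k x _; case: (pickle_inv k) => [i|] /=.
rewrite esum_countType; last by move=> i; apply: integral_ge0.
apply: eq_eseriesr => k _; case: pickle_inv => //=.
by rewrite integral0.
Qed.

End countable_sums.

Section nonnegative_Lnorm.
Local Open Scope ereal_scope.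
Context d (T : measurableType d) (R : realType).
Variable mu : {measure set T -> \bar R}.
Variables (p : R).
Hypothesis p_ge1 : (1 <= p)%R.
Implicit Types (f g : T -> \bar R).

Let p_gt0 : (0 < p)%R. Proof. exact: lt_le_trans p_ge1. Qed.
Let p_neq0 : p != 0%R. Proof. by rewrite gt_eqF. Qed.

Lemma le_poweR (r : R) (x y : \bar R) : (0 <= r)%R -> 0 <= x -> x <= y ->
  x `^ r <= y `^ r.
Proof.
move=> r0 x0 xy; apply: gt0_ler_poweR => //; rewrite in_itv/= leey andbT//.
exact: le_trans xy.
Qed.

Lemma measurable_Lnorm_integrand f : measurable_fun [set: T] f ->
  measurable_fun [set: T] (fun x => `|f x| `^ p).
Proof.
move=> mf; apply: (@measurableT_comp _ _ _ _ _ _ (fun x => x `^ p)) => //=.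
  exact: measurable_poweR.
exact: measurableT_comp.
Qed.

Lemma le_Lnorm_ae f g : measurable_fun [set: T] f -> measurable_fun [set: T] g ->
  (forall x, 0 <= f x) -> (forall x, 0 <= g x) ->
  {ae mu, forall x, f x <= g x} -> 'N[mu]_p%:E[f] <= 'N[mu]_p%:E[g].
Proof.
move=> mf mg f0 g0 fg; rewrite unlock le_poweR ?invr_ge0 ?(ltW p_gt0)//.
  by apply: integral_ge0 => x _; exact: poweR_ge0.
apply: ae_ge0_le_integral => //; [by move=> x _; exact: poweR_ge0|
  exact: measurable_Lnorm_integrand|by move=> x _; exact: poweR_ge0|
  exact: measurable_Lnorm_integrand|].
by apply: filterS fg => x fg _; rewrite le_poweR ?(ltW p_gt0)// !gee0_abs.
Qed.

Lemma Lnorm_scale (c : R) f : (0 <= c)%R -> measurable_fun [set: T] f ->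
  'N[mu]_p%:E[(fun x => c%:E * f x)] = c%:E * 'N[mu]_p%:E[f].
Proof.
move=> c0 mf; rewrite unlock.
under eq_integral => x _ do rewrite abseM poweRM// abse_EFin ger0_norm//.
rewrite ge0_integralZl ?poweR_ge0//; last 2 first.
- exact: measurable_Lnorm_integrand.
- by move=> x _; exact: poweR_ge0.
rewrite poweRM ?poweR_ge0//; last by apply: integral_ge0 => x _; exact: poweR_ge0.
by rewrite -poweRrM mulfV// poweRe1 ?lee_fin.
Qed.

Lemma Lnorm_lty_ae f : measurable_fun [set: T] f -> 'N[mu]_p%:E[f] < +oo ->
  {ae mu, forall x, f x \is a fin_num}.
Proof.
move=> mf; rewrite unlock => /lty_poweRy; rewrite invr_eq0 => /(_ p_neq0) fin.
have /integrable_ae : mu.-integrable setT (fun x => `|f x| `^ p).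
  apply/integrableP; split; first exact: measurable_Lnorm_integrand.
  by under eq_integral => x _ do rewrite gee0_abs ?poweR_ge0//.
move=> /(_ measurableT); apply: filterS => x /(_ I).
rewrite ge0_fin_numE ?poweR_ge0// => /(lty_poweRy p_neq0).
by rewrite fin_num_abs.
Qed.

(** A function of finite norm is finite almost everywhere, so its real-valued version has the same
    norm. This extends Minkowski and Hoelder to values in [\bar R]. *)
Lemma Lnorm_fine f : measurable_fun [set: T] f -> 'N[mu]_p%:E[f] < +oo ->
  'N[mu]_p%:E[EFin \o (fine \o f)] = 'N[mu]_p%:E[f].
Proof.
move=> mf Nf; rewrite unlock; congr (_ `^ _).
apply: ae_eq_integral => //.
- apply: measurable_Lnorm_integrand; apply/measurable_EFinP.
  exact: measurableT_comp.
- exact: measurable_Lnorm_integrand.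
- by apply: filterS (Lnorm_lty_ae mf Nf) => x xfin _; congr (`| _ | `^ _); exact: fineK.
Qed.

Lemma minkowski_ge0 f g : measurable_fun [set: T] f -> measurable_fun [set: T] g ->
  (forall x, 0 <= f x) -> (forall x, 0 <= g x) ->
  'N[mu]_p%:E[(fun x => f x + g x)] <= 'N[mu]_p%:E[f] + 'N[mu]_p%:E[g].
Proof.
move=> mf mg f0 g0.
have [Nf|] := ltP 'N[mu]_p%:E[f] +oo; last first.
  by rewrite leye_eq => /eqP ->; rewrite addye ?leey// -ltNye (lt_le_trans _ (Lnorm_ge0 _ _ _)).
have [Ng|] := ltP 'N[mu]_p%:E[g] +oo; last first.
  by rewrite leye_eq => /eqP ->; rewrite addey ?leey// -ltNye (lt_le_trans _ (Lnorm_ge0 _ _ _)).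
rewrite -(Lnorm_fine mf)// -(Lnorm_fine mg)//.
apply: le_trans (minkowski_EFin _ _ _ _) => //; last 2 first.
- exact: measurableT_comp.
- exact: measurableT_comp.
apply: le_Lnorm_ae => //.
- exact: emeasurable_funD.
- by apply/measurable_EFinP; apply: measurable_funD; exact: measurableT_comp.
- by move=> x; rewrite adde_ge0.
- by move=> x /=; rewrite lee_fin addr_ge0// fine_ge0.
have := Lnorm_lty_ae mf Nf; have := Lnorm_lty_ae mg Ng.
apply: filterS2 => x gx fx /=.
by rewrite EFinD !fineK.
Qed.

Lemma Lnorm_sum_le (F : nat -> T -> \bar R) m :
  (forall k, measurable_fun [set: T] (F k)) -> (forall k x, 0 <= F k x) ->
  'N[mu]_p%:E[(fun x => \sum_(0 <= k < m) F k x)] <=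
  \sum_(0 <= k < m) 'N[mu]_p%:E[F k].
Proof.
move=> mF F0; elim: m => [|m IH].
  under eq_Lnorm do rewrite big_geq//.
  by rewrite big_geq// Lnorm0// eqe.
under eq_Lnorm do rewrite big_nat_recr//=.
rewrite big_nat_recr//=; apply: le_trans (minkowski_ge0 _ _ _ _) _; rewrite //=.
- exact: emeasurable_sum.
- by move=> x; apply: sume_ge0.
- exact: leeD2r.
Qed.

(** Taking [r]-th roots first leaves a bound on the partial sums themselves, which passes to the
    limit without continuity of the power. *)
Lemma poweR_nneseries_le (r : R) (a : nat -> \bar R) (c : \bar R) :
  (0 < r)%R -> (forall k, 0 <= a k) ->
  (forall m, (\sum_(0 <= k < m) a k) `^ r <= c) ->
  (\sum_(k <oo) a k) `^ r <= c.
Proof.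
move=> r0 a0 ac.
have c0 : 0 <= c by apply: le_trans (ac 0%N); exact: poweR_ge0.
suff : \sum_(k <oo) a k <= c `^ r^-1.
  move=> sc; apply: (@le_trans _ _ ((c `^ r^-1) `^ r)).
    by apply: le_poweR (ltW r0) _ sc; exact: nneseries_ge0.
  by rewrite -poweRrM mulVf ?gt_eqF// poweRe1.
apply: lime_le; first by apply: is_cvg_nneseries => k _ _; exact: a0.
apply: nearW => m /=.
have s0 : 0 <= \sum_(0 <= k < m) a k by apply: sume_ge0.
rewrite -[leLHS](@poweRe1 _ _)// -[1%R](@mulfV _ r) ?gt_eqF// poweRrM.
by apply: le_poweR; [rewrite invr_ge0 ltW|exact: poweR_ge0|exact: ac].
Qed.

(** Monotone convergence for the [p]-th powers of the partial sums reduces this to the finite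
    Minkowski inequality. *)
Lemma Lnorm_nneseries_le (F : nat -> T -> \bar R) :
  (forall k, measurable_fun [set: T] (F k)) -> (forall k x, 0 <= F k x) ->
  'N[mu]_p%:E[(fun x => \sum_(k <oo) F k x)] <= \sum_(k <oo) 'N[mu]_p%:E[F k].
Proof.
move=> mF F0; set c := leRHS.
have c0 : 0 <= c by apply: nneseries_ge0 => k _ _; exact: Lnorm_ge0.
pose S m x := \sum_(0 <= k < m) F k x.
have S0 m x : 0 <= S m x by apply: sume_ge0.
have mS m : measurable_fun [set: T] (S m) by exact: emeasurable_sum.
have ndS x : {homo (fun m => S m x) : m m' / (m <= m')%N >-> m <= m'}.
  by move=> m m' mm'; apply: lee_sum_nneg_natr.
have ndSp x : {homo (fun m => `|S m x| `^ p) : m m' / (m <= m')%N >-> m <= m'}.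
  by move=> m m' mm'; rewrite le_poweR ?(ltW p_gt0)// !gee0_abs// ndS.
have int_le : \int[mu]_x (`|\sum_(k <oo) F k x| `^ p) <= c `^ p.
  apply: (@le_trans _ _ (\int[mu]_x (limn (fun m => `|S m x| `^ p)))).
    apply: ge0_le_integral => //.
    - by move=> x _; exact: poweR_ge0.
    - apply: measurable_Lnorm_integrand; apply: ge0_emeasurable_sum => //.
    - apply: (emeasurable_fun_cvg (fun m x => `|S m x| `^ p)).
        by move=> m; exact: measurable_Lnorm_integrand.
      by move=> x _; apply: ereal_nondecreasing_is_cvgn => m m' /ndSp.
    - move=> x _; rewrite gee0_abs; last by apply: nneseries_ge0.
      apply: poweR_nneseries_le => // m.
      apply: lime_ge; first by apply: ereal_nondecreasing_is_cvgn => ? ? /ndSp.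
      near=> m'; rewrite le_poweR ?(ltW p_gt0)//; first exact: S0.
      rewrite gee0_abs// ndS//; near: m'; exact: nbhs_infty_ge.
  rewrite monotone_convergence//; last 2 first.
  - by move=> m; exact: measurable_Lnorm_integrand.
  - by move=> m x _; exact: poweR_ge0.
  apply: lime_le.
    apply: ereal_nondecreasing_is_cvgn => m m' mm'; apply: ge0_le_integral => //.
    - by move=> x _; exact: poweR_ge0.
    - exact: measurable_Lnorm_integrand.
    - exact: measurable_Lnorm_integrand.
    - by move=> x _; exact: ndSp.
  apply: nearW => m; rewrite -poweR_Lnorm// le_poweR ?(ltW p_gt0)//.
    exact: Lnorm_ge0.
  apply: le_trans (@Lnorm_sum_le F m mF F0) _.
  by apply: nneseries_lim_ge => k _ _; exact: Lnorm_ge0.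
rewrite unlock -[leRHS](@poweRe1 _ _)// -[1%R](@mulfV _ p)// poweRrM.
apply: le_poweR => //; first by rewrite invr_ge0 ltW.
by apply: integral_ge0 => x _; exact: poweR_ge0.
Unshelve. all: by end_near. Qed.

Lemma Lnorm_esum_le (I : countType) (F : I -> T -> \bar R) :
  (forall k, measurable_fun [set: T] (F k)) -> (forall k x, 0 <= F k x) ->
  'N[mu]_p%:E[(fun x => \esum_(k in setT) F k x)] <=
  \esum_(k in setT) 'N[mu]_p%:E[F k].
Proof.
move=> mF F0; under eq_Lnorm do rewrite esum_countType//.
rewrite esum_countType; last by move=> i; exact: Lnorm_ge0.
apply: le_trans (Lnorm_nneseries_le _ _) _.
- by move=> k; case: pickle_inv => //= i; exact: mF.
- by move=> k x; case: (pickle_inv k) => [i|] /=.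
apply: lee_nneseries => k _; first by move=> _; exact: Lnorm_ge0.
by case: pickle_inv => //=; rewrite Lnorm0// eqe.
Qed.

End nonnegative_Lnorm.

Section Lnorm_convergence.
Local Open Scope ereal_scope.
Variable R : realType.

Lemma cvg0P (a : nat -> \bar R) : (forall m, 0 <= a m) ->
  a @ \oo --> 0 <-> forall e : R, (0 < e)%R -> \forall m \near \oo, a m <= e%:E.
Proof.
move=> a0; split.
  move=> /fine_cvgP[afin /cvgr0_norm_le acvg] e e0.
  near=> m; rewrite -(@fineK _ (a m)); last by near: m.
  rewrite lee_fin (le_trans (ler_norm _))//.
  by near: m; exact: acvg.
move=> ae; apply/fine_cvgP; split.
  have := ae 1%R ltr01; apply: filterS => m am.
  by rewrite ge0_fin_numE// (le_lt_trans am)// ltry.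
apply/cvgr0Pnorm_le => e e0.
have := ae e e0; apply: filterS => m am /=.
have afin : a m \is a fin_num by rewrite ge0_fin_numE// (le_lt_trans am)// ltry.
by rewrite ger0_norm ?fine_ge0// -lee_fin fineK.
Unshelve. all: by end_near. Qed.

Lemma cvg0_poweR (a : nat -> \bar R) (r : R) : (0 < r)%R ->
  (forall m, 0 <= a m) -> a @ \oo --> 0 -> (fun m => a m `^ r) @ \oo --> 0.
Proof.
move=> r0 a0 /(cvg0P a0) ae; apply/cvg0P => [m|e e0]; first exact: poweR_ge0.
have := ae (e `^ r^-1)%R (powR_gt0 _ e0); apply: filterS => m am.
apply: le_trans (le_poweR (ltW r0) _ am) _ => //.
by rewrite poweR_EFin -powRrM mulVf ?gt_eqF// powRr1// ltW.
Qed.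

Context d (T : measurableType d) (mu : {measure set T -> \bar R}).
Implicit Types f g : T -> \bar R.

(** The powers [F m ^ p] are dominated by [f ^ p], integrable as the norm of [f] is finite; the root
    preserves convergence to 0. *)
Lemma Lnorm_dominated_cvg0 (p : R) (F : nat -> T -> \bar R) f :
  (1 <= p)%R -> (forall m, measurable_fun [set: T] (F m)) ->
  measurable_fun [set: T] f -> (forall m x, 0 <= F m x <= f x) ->
  'N[mu]_p%:E[f] < +oo -> {ae mu, forall x, F ^~ x @ \oo --> 0} ->
  (fun m => 'N[mu]_p%:E[F m]) @ \oo --> 0.
Proof.
move=> p1 mF mf F0f Nf Fcvg; have p0 : (0 < p)%R by exact: lt_le_trans p1.
have F0 m x : 0 <= F m x by have /andP[] := F0f m x.
have f0 x : 0 <= f x by have /andP[/le_trans] := F0f 0%N x; apply.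
rewrite (_ : (fun m => _) = (fun m => (\int[mu]_x `|F m x| `^ p) `^ p^-1)); last first.
  by apply/funext => m; rewrite unlock.
apply: cvg0_poweR; first by rewrite invr_gt0.
  by move=> m; apply: integral_ge0 => x _; exact: poweR_ge0.
rewrite -[X in _ --> X](@integral0 _ _ _ mu setT).
have [] // := @dominated_convergence _ _ _ mu setT measurableT
  (fun m x => `|F m x| `^ p) (cst 0) (fun x => `|f x| `^ p).
- by move=> m; exact: measurable_Lnorm_integrand.
- apply: filterS Fcvg => x Fx _; apply: cvg0_poweR => //.
  by under eq_fun do rewrite gee0_abs//.
- apply/integrableP; split; first exact: measurable_Lnorm_integrand.
  under eq_integral do rewrite gee0_abs ?poweR_ge0//.
  move: Nf; rewrite unlock => /lty_poweRy; apply.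
  by rewrite invr_eq0 gt_eqF.
- apply: aeW => x m _; rewrite gee0_abs ?poweR_ge0// !gee0_abs//.
  by apply: le_poweR (ltW p0) _ _ => //; have /andP[] := F0f m x.
Qed.

Lemma Lnorm_indic (p : R) (A : set T) : (0 < p)%R -> measurable A ->
  'N[mu]_p%:E[EFin \o \1_A] = mu A `^ p^-1.
Proof.
move=> p0 mA; rewrite unlock; congr (_ `^ _).
rewrite -[in RHS](setIT A) -integral_indic//.
apply: eq_integral => x _ /=; rewrite indicE.
by case: (x \in A); rewrite /= ?normr1 ?normr0 ?powR1 ?powR0// gt_eqF.
Qed.

(** Hoelder against the indicator of [A]. The positive measure of [A] keeps the right-hand side
    infinite when the norm is. *)
Lemma integral_le_Lnorm (p : R) (A : set T) f : (1 < p)%R ->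
  measurable A -> 0 < mu A -> measurable_fun [set: T] f ->
  (forall x, 0 <= f x) -> (forall x, ~ A x -> f x = 0) ->
  \int[mu]_x f x <= mu A `^ (1 - p^-1) * 'N[mu]_p%:E[f].
Proof.
move=> p1 mA A0 mf f0 fA; have p0 : (0 < p)%R by exact: lt_trans p1.
have [Nf|] := ltP 'N[mu]_p%:E[f] +oo; last first.
  by rewrite leye_eq => /eqP ->; rewrite gt0_muley ?leey// poweR_gt0.
have ffin := Lnorm_lty_ae (ltW p1) mf Nf.
rewrite -(Lnorm_fine (ltW p1) mf Nf).
pose q := (1 - p^-1)^-1%R.
have q0 : (0 < q)%R by rewrite invr_gt0 subr_gt0 invf_lt1.
have -> : \int[mu]_x f x = 'N[mu]_1[EFin \o ((fine \o f) \* \1_A)%R].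
  rewrite Lnorm1; apply: ae_eq_integral => //.
    apply: measurableT_comp => //; apply/measurable_EFinP.
    by apply: measurable_funM => //; exact: measurableT_comp.
  apply: filterS ffin => x fx _ /=; rewrite indicE.
  have [xA|] := boolP (x \in A); first by rewrite mulr1 ger0_norm ?fine_ge0// fineK.
  by rewrite notin_setE => /fA ->; rewrite mulr0 normr0.
apply: le_trans (hoelder _ _ _ p0 q0 _) _ => //; first exact: measurableT_comp.
  by rewrite /q invrK addrCA subrr addr0.
by rewrite Lnorm_indic// /q invrK muleC.
Qed.

End Lnorm_convergence.

(** * Slicing Lebesgue measure on R^n *)

Section leb_slices.
Local Open Scope ereal_scope.
Variable R : realType.
Local Notation l1 := (@lebesgue_measure R).

Let cons2 n (z : measurableTypeR R * n.-tuple R) : n.+1.-tuple R := consR z.1 z.2.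

Let measurable_cons2 n : measurable_fun [set: measurableTypeR R * n.-tuple R] (@cons2 n).
Proof. exact: measurable_cons. Qed.

Lemma measurable_slice n (F : n.+1.-tuple R -> \bar R) (y : n.-tuple R) :
  measurable_fun [set: n.+1.-tuple R] F ->
  measurable_fun [set: measurableTypeR R] (fun x => F (consR x y)).
Proof.
move=> mF; apply: (@measurableT_comp _ _ _ _ _ _ F) => //.
exact: (@measurable_cons _ _ (measurableTypeR R) R id n (cst y)).
Qed.

Lemma measurable_integral_slice n (F : n.+1.-tuple R -> \bar R) :
  measurable_fun [set: n.+1.-tuple R] F -> (forall x, 0 <= F x) ->
  measurable_fun [set: n.-tuple R] (fun y => \int[l1]_x F (consR x y)).
Proof.
move=> mF F0.
have mFc : measurable_fun setT (F \o @cons2 n).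
  exact: (measurableT_comp mF (@measurable_cons2 n)).
have h := @measurable_fun_fubini_tonelli_G _ _ _ _ _ l1 (F \o @cons2 n) mFc.
exact: (h (fun x => F0 _)).
Qed.

Lemma integral_leb0 (F : 0.-tuple R -> \bar R) :
  (forall x, 0 <= F x) -> \int[leb]_x F x = F [tuple].
Proof.
move=> F0; rewrite (eq_measure_integral (\d_([tuple] : 0.-tuple R))).
  rewrite integral_dirac//; last first.
    by move=> _ Y mY; rewrite setTI; case: (pselect (Y (F [tuple]))) => YF;
      [rewrite (_ : _ @^-1` _ = setT)|rewrite (_ : _ @^-1` _ = set0)] => //;
      apply/seteqP; split => // z; rewrite /= (tuple0 z).
  by rewrite diracT mul1e.
by move=> A _ _; exact: (congr1 (@^~ A) (lebE R 0)).
Qed.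

(** [leb] is sliced with x_1 outermost, whereas the mixed norm has x_1 innermost; Tonelli reconciles
    the two orders. *)
Lemma integral_lebS n (F : n.+1.-tuple R -> \bar R) :
  measurable_fun [set: n.+1.-tuple R] F -> (forall x, 0 <= F x) ->
  \int[leb]_x F x = \int[leb]_y \int[l1]_x F (consR x y).
Proof.
move=> mF F0.
pose pm : {measure set (measurableTypeR R * n.-tuple R)%type -> \bar R} :=
  (l1 \x leb)%E.
pose nu : {measure set (n.+1.-tuple R) -> \bar R} :=
  measure_function_pushforward__canonical__measure_function_Measure pm
    (@measurable_cons2 n).
rewrite (eq_measure_integral nu); last first.
  move=> A mA _; transitivity (leb_fun A); first exact: (congr1 (@^~ A) (lebE R n.+1)).
  rewrite /= /pushforward /pm /= /product_measure1.
  apply: eq_integral => x _ /=; rewrite -lebE; congr (leb _).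
  by apply/seteqP; split => y /=; rewrite /xsection /= ?inE.
rewrite (@ge0_integral_pushforward _ _ _ _ _ _ (@measurable_cons2 n) pm)//=.
rewrite (_ : @cons2 n @^-1` _ = setT)//.
have mFc : measurable_fun setT (F \o @cons2 n).
  exact: (measurableT_comp mF (@measurable_cons2 n)).
exact: (@fubini_tonelli2 _ _ _ _ _ l1 leb (F \o @cons2 n) mFc (fun x => F0 _)).
Qed.

End leb_slices.

Section almost_everywhere_slices.
Local Open Scope ereal_scope.
Variable R : realType.
Local Notation l1 := (@lebesgue_measure R).

Lemma ge0_integral_eq0_ae d (T : measurableType d) (mu : {measure set T -> \bar R})
    (f : T -> \bar R) : measurable_fun [set: T] f -> (forall x, 0 <= f x) ->
  \int[mu]_x f x = 0 -> {ae mu, forall x, f x = 0}.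
Proof.
move=> mf f0 intf.
have /(ae_eq_integral_abs mu measurableT mf) : \int[mu]_x `|f x| = 0.
  by under eq_integral do rewrite gee0_abs//.
by apply: filterS => x /(_ I).
Qed.

Lemma ae0_integral d (T : measurableType d) (mu : {measure set T -> \bar R})
    (f : T -> \bar R) : measurable_fun [set: T] f ->
  {ae mu, forall x, f x = 0} -> \int[mu]_x f x = 0.
Proof.
move=> mf f0; rewrite -[RHS](integral0 mu setT); apply: ae_eq_integral => //.
by apply: filterS f0.
Qed.

(** For a nonnegative function, vanishing almost everywhere is vanishing of the integral, and
    integrals are computed by slices. *)
Lemma ae_lebS n (F : n.+1.-tuple R -> \bar R) :
  measurable_fun [set: n.+1.-tuple R] F -> (forall x, 0 <= F x) ->
  {ae leb, forall x, F x = 0} <->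
  {ae leb, forall y, {ae l1, forall x, F (consR x y) = 0}}.
Proof.
move=> mF F0; have mG := measurable_integral_slice mF F0.
have G0 y : 0 <= \int[l1]_x F (consR x y) by apply: integral_ge0.
split => [F_eq0|slice_eq0].
  have : \int[leb]_y \int[l1]_x F (consR x y) = 0.
    by rewrite -integral_lebS//; exact: ae0_integral.
  move=> /(ge0_integral_eq0_ae mG G0); apply: filterS => y.
  by apply: ge0_integral_eq0_ae => //; exact: measurable_slice.
apply: ge0_integral_eq0_ae => //.
rewrite integral_lebS//; apply: ae0_integral => //.
by apply: filterS slice_eq0 => y; apply: ae0_integral; exact: measurable_slice.
Qed.

Lemma ae_lebesgueS (P Q : R -> Prop) : (forall x, P x -> Q x) ->
  {ae l1, forall x, P x} -> {ae l1, forall x, Q x}.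
Proof. exact: (@filterS _ _ (@ae_filter_ringOfSetsType _ _ _ l1)). Qed.

(** [P] may fail to be measurable, so what is sliced is the indicator of a measurable null set
    outside which [P] holds. *)
Lemma ae_slice n (P : n.+1.-tuple R -> Prop) : {ae leb, forall x, P x} ->
  {ae leb, forall y, {ae l1, forall x, P (consR x y)}}.
Proof.
move=> [N [mN N0 NP]].
have mI : measurable_fun setT (EFin \o (\1_N : _ -> R)).
  by apply/measurable_EFinP; exact: measurable_indic.
have I0 x : 0 <= (EFin \o (\1_N : _ -> R)) x by rewrite lee_fin.
have : {ae leb, forall x, (EFin \o (\1_N : _ -> R)) x = 0}.
  exists N; split=> // x /= /eqP; rewrite indicE.
  by case: (boolP (x \in N)) => [|_]; [rewrite inE|rewrite eqxx].
move=> /(ae_lebS mI I0); apply: filterS => y; apply: ae_lebesgueS => x /=.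
rewrite indicE; case: (boolP (_ \in N)) => [_ /eqP|+ _].
  by rewrite eqe oner_eq0.
by rewrite notin_setE => Nx; apply: contrapT => /NP.
Qed.

End almost_everywhere_slices.

(** * Mixed norms *)

Section mixed_norms.
Local Open Scope ereal_scope.
Variable R : realType.
Local Notation l1 := (@lebesgue_measure R).

Definition exponents_ge1 n (q : n.-tuple R) := forall i, (1 <= tnth q i)%R.

Lemma exponents_ge1_thead n (q : n.+1.-tuple R) :
  exponents_ge1 q -> (1 <= thead q)%R.
Proof. exact. Qed.

Lemma exponents_ge1_behead n (q : n.+1.-tuple R) :
  exponents_ge1 q -> exponents_ge1 [tuple of behead q].
Proof. by move=> q1 i; rewrite tnth_behead. Qed.

Definition slice_norm n (q : n.+1.-tuple R) (F : n.+1.-tuple R -> \bar R) y :=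
  'N[l1]_(thead q)%:E[(fun x => F (consR x y))].

Lemma mixed_normS n (q : n.+1.-tuple R) F :
  mixed_norm q F = mixed_norm [tuple of behead q] (slice_norm q F).
Proof. by []. Qed.

Lemma measurable_slice_norm n (q : n.+1.-tuple R) (F : n.+1.-tuple R -> \bar R) :
  measurable_fun [set: n.+1.-tuple R] F ->
  measurable_fun [set: n.-tuple R] (slice_norm q F).
Proof.
move=> mF; rewrite /slice_norm unlock.
apply: (@measurableT_comp _ _ _ _ _ _ (fun x : \bar R => x `^ _)).
  exact: measurable_poweR.
apply: (@measurable_integral_slice R n (fun x => `|F x| `^ thead q)).
  exact: measurable_Lnorm_integrand.
by move=> x; exact: poweR_ge0.
Qed.

Lemma mixed_norm_ge0 n (q : n.-tuple R) (F : n.-tuple R -> \bar R) :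
  (forall x, 0 <= F x) -> 0 <= mixed_norm q F.
Proof.
elim: n q F => [|n IH] q F F0; first exact: F0.
by rewrite mixed_normS; apply: IH => y; exact: Lnorm_ge0.
Qed.

(** In dimension 0 the measure is a Dirac mass, so the empty tuple is not negligible; this starts
    the inductions on [n]. *)
Lemma ae_tuple0 (P : 0.-tuple R -> Prop) : {ae leb, forall x, P x} -> P [tuple].
Proof.
move=> [N [mN N0 NP]]; apply: contrapT => nP.
have : leb N = (\d_([tuple] : 0.-tuple R) N : \bar R).
  exact: (congr1 (@^~ N) (lebE R 0)).
by rewrite N0 diracE (mem_set (NP _ nP)) => /esym/eqP; rewrite eqe oner_eq0.
Qed.

Lemma ae_tuple0_intro (P : 0.-tuple R -> Prop) :
  P [tuple] -> {ae leb, forall x, P x}.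
Proof. by move=> P0; apply: aeW => x; rewrite (tuple0 x). Qed.

Lemma le_mixed_norm_ae n (q : n.-tuple R) (F G : n.-tuple R -> \bar R) :
  exponents_ge1 q -> measurable_fun [set: n.-tuple R] F ->
  measurable_fun [set: n.-tuple R] G -> (forall x, 0 <= F x) ->
  (forall x, 0 <= G x) -> {ae leb, forall x, F x <= G x} ->
  mixed_norm q F <= mixed_norm q G.
Proof.
elim: n q F G => [|n IH] q F G q1 mF mG F0 G0 FG; first exact: ae_tuple0 FG.
rewrite !mixed_normS; apply: IH.
- exact: exponents_ge1_behead.
- exact: measurable_slice_norm.
- exact: measurable_slice_norm.
- by move=> y; exact: Lnorm_ge0.
- by move=> y; exact: Lnorm_ge0.
apply: filterS (ae_slice FG) => y FGy; apply: le_Lnorm_ae => //.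
- exact: exponents_ge1_thead.
- exact: measurable_slice.
- exact: measurable_slice.
Qed.

Lemma le_mixed_norm n (q : n.-tuple R) (F G : n.-tuple R -> \bar R) :
  exponents_ge1 q -> measurable_fun [set: n.-tuple R] F ->
  measurable_fun [set: n.-tuple R] G -> (forall x, 0 <= F x) ->
  (forall x, F x <= G x) -> mixed_norm q F <= mixed_norm q G.
Proof.
move=> q1 mF mG F0 FG; apply: le_mixed_norm_ae => //; last exact: aeW.
by move=> x; exact: le_trans (FG x).
Qed.

Lemma mixed_norm_scale n (q : n.-tuple R) (c : R) (F : n.-tuple R -> \bar R) :
  exponents_ge1 q -> (0 <= c)%R -> measurable_fun [set: n.-tuple R] F ->
  mixed_norm q (fun x => c%:E * F x) = c%:E * mixed_norm q F.
Proof.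
move=> + c0; elim: n q F => [//|n IH] q F q1 mF.
rewrite !mixed_normS -IH//; last 2 first.
- exact: exponents_ge1_behead.
- exact: measurable_slice_norm.
congr mixed_norm; apply/funext => y; rewrite /slice_norm.
by rewrite Lnorm_scale//; [exact: exponents_ge1_thead|exact: measurable_slice].
Qed.

Lemma mixed_norm_cst0 n (q : n.-tuple R) :
  exponents_ge1 q -> mixed_norm q (fun=> 0) = 0.
Proof.
move=> q1; rewrite -[RHS](mul0e (mixed_norm q (cst 0))) -mixed_norm_scale//.
by congr mixed_norm; apply/funext => x; rewrite mul0e.
Qed.

(** Minkowski in x_1 bounds the slice norm of the sum by the sum of the slice norms, to which the
    induction hypothesis applies. *)
Lemma mixed_norm_esum_le n (q : n.-tuple R) (I : countType)
    (F : I -> n.-tuple R -> \bar R) : exponents_ge1 q ->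
  (forall i, measurable_fun [set: n.-tuple R] (F i)) ->
  (forall i x, 0 <= F i x) ->
  mixed_norm q (fun x => \esum_(i in setT) F i x) <=
  \esum_(i in setT) mixed_norm q (F i).
Proof.
elim: n q F => [//|n IH] q F q1 mF F0; rewrite mixed_normS.
apply: (@le_trans _ _ (mixed_norm [tuple of behead q]
    (fun y => \esum_(i in setT) slice_norm q (F i) y))).
  apply: le_mixed_norm => //.
  - exact: exponents_ge1_behead.
  - by apply: measurable_slice_norm; exact: measurable_esum.
  - apply: measurable_esum => [i|i y]; last exact: Lnorm_ge0.
    exact: measurable_slice_norm.
  - by move=> y; exact: Lnorm_ge0.
  - move=> y; apply: Lnorm_esum_le => [|i|//]; first exact: exponents_ge1_thead.
    exact: measurable_slice.
apply: IH => [|i|i y]; first exact: exponents_ge1_behead.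
  exact: measurable_slice_norm.
exact: Lnorm_ge0.
Qed.

Lemma mixed_norm_eq0_ae n (q : n.-tuple R) (F : n.-tuple R -> \bar R) :
  exponents_ge1 q -> measurable_fun [set: n.-tuple R] F ->
  (forall x, 0 <= F x) -> mixed_norm q F = 0 -> {ae leb, forall x, F x = 0}.
Proof.
elim: n q F => [|n IH] q F q1 mF F0; first exact: ae_tuple0_intro.
rewrite mixed_normS => /IH H; apply/ae_lebS => //.
apply: filterS (H _ _ _) => [y sl0| | |y]; last exact: Lnorm_ge0.
- have q0 : 0 < (thead q)%:E by rewrite lte_fin (lt_le_trans _ (exponents_ge1_thead q1)).
  have := Lnorm_eq0_eq0 (measurable_slice y mF) q0 sl0.
  by apply: filterS => x /(_ I).
- exact: exponents_ge1_behead.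
- exact: measurable_slice_norm.
Qed.

(** Every multiple of the indicator of the set where [F] is infinite lies below [F], so a finite
    norm of [F] forces that indicator to have norm 0. *)
Lemma mixed_norm_lty_ae n (q : n.-tuple R) (F : n.-tuple R -> \bar R) :
  exponents_ge1 q -> measurable_fun [set: n.-tuple R] F ->
  (forall x, 0 <= F x) -> mixed_norm q F < +oo ->
  {ae leb, forall x, F x \is a fin_num}.
Proof.
move=> q1 mF F0 NF; pose A := [set x | F x = +oo].
have mA : measurable A.
  rewrite (_ : A = F @^-1` [set +oo])// -[X in measurable X]setTI.
  by apply: mF => //; exact: emeasurable_set1.
pose G x : \bar R := (\1_A x)%:E.
have mG : measurable_fun [set: n.-tuple R] G.
  by apply/measurable_EFinP; exact: measurable_indic.
have G0 x : 0 <= G x by rewrite lee_fin.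
have GF (c : R) : (0 <= c)%R -> c%:E * mixed_norm q G <= mixed_norm q F.
  move=> c0; rewrite -mixed_norm_scale//; apply: le_mixed_norm => //.
  - exact: measurable_funeM.
  - by move=> x; rewrite mule_ge0.
  move=> x; rewrite /G indicE; case: (boolP (x \in A)) => [|_].
    by rewrite inE => ->; rewrite leey.
  by rewrite mule0.
have /(mixed_norm_eq0_ae q1 mG G0) : mixed_norm q G = 0.
  have NG0 : 0 <= mixed_norm q G by exact: mixed_norm_ge0.
  apply/eqP; rewrite eq_le NG0 andbT.
  have Nfin : mixed_norm q F \is a fin_num by rewrite ge0_fin_numE// mixed_norm_ge0.
  have NGfin : mixed_norm q G \is a fin_num.
    rewrite ge0_fin_numE//; apply: le_lt_trans NF.
    by have := GF 1%R ler01; rewrite mul1e.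
  rewrite leNgt; apply/negP => NGpos.
  have g0 : (0 < fine (mixed_norm q G))%R by rewrite fine_gt0// NGpos ltey_eq NGfin.
  have f0 : (0 <= fine (mixed_norm q F))%R by rewrite fine_ge0// mixed_norm_ge0.
  (* This multiple of [G] would have norm [mixed_norm q F + 1]. *)
  have := GF ((fine (mixed_norm q F) + 1) / fine (mixed_norm q G))%R.
  rewrite divr_ge0 ?addr_ge0// ?(ltW g0)// => /(_ isT).
  rewrite -{2}(fineK NGfin) -{2}(fineK Nfin) -EFinM lee_fin divfK ?gt_eqF//.
  by rewrite gerDl ler10.
apply: filterS => x /eqP; rewrite eqe indicE pnatr_eq0 eqb0 notin_setE /A /=.
by rewrite ge0_fin_numE// ltey => /eqP.
Qed.

(** Almost every slice norm of [f] is finite. On such slices dominated convergence in x_1 sends the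
    slice norms of [F m] to 0, and the slice norm of [f] is their majorant for the induction. *)
Lemma mixed_norm_dominated_cvg0 n (q : n.-tuple R)
    (F : nat -> n.-tuple R -> \bar R) (f : n.-tuple R -> \bar R) :
  exponents_ge1 q -> (forall m, measurable_fun [set: n.-tuple R] (F m)) ->
  measurable_fun [set: n.-tuple R] f -> (forall m x, 0 <= F m x <= f x) ->
  mixed_norm q f < +oo -> {ae leb, forall x, F ^~ x @ \oo --> 0} ->
  (fun m => mixed_norm q (F m)) @ \oo --> 0.
Proof.
elim: n q F f => [|n IH] q F f q1 mF mf F0f Nf Fcvg; first exact: ae_tuple0 Fcvg.
have q1' := exponents_ge1_behead q1.
apply: (IH _ (fun m => slice_norm q (F m)) (slice_norm q f)) => //.
- by move=> m; exact: measurable_slice_norm.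
- exact: measurable_slice_norm.
- move=> m y; rewrite Lnorm_ge0/=; apply: le_Lnorm_ae => //.
  + exact: exponents_ge1_thead.
  + exact: measurable_slice.
  + exact: measurable_slice.
  + by move=> x; have /andP[] := F0f m (consR x y).
  + by move=> x; have /andP[/le_trans] := F0f m (consR x y); apply.
  + by apply: aeW => x; have /andP[] := F0f m (consR x y).
have := mixed_norm_lty_ae q1' (measurable_slice_norm q mf) _ Nf.
move=> /(_ (fun y => Lnorm_ge0 _ _ _)); move: (ae_slice Fcvg).
apply: filterS2 => y Fy fy.
apply: (@Lnorm_dominated_cvg0 _ _ _ l1 (thead q) (fun m x => F m (consR x y))
  (fun x => f (consR x y))) => //.
- exact: exponents_ge1_thead.
- by move=> m; exact: measurable_slice.
- exact: measurable_slice.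
- by rewrite -ge0_fin_numE// Lnorm_ge0.
Qed.

End mixed_norms.

Lemma tnth_behead_lift n T (t : n.+1.-tuple T) i :
  tnth [tuple of behead t] i = tnth t (lift ord0 i).
Proof.
by rewrite tnth_behead; congr tnth; apply/val_inj; rewrite /= inordK// ltnS.
Qed.

Lemma measurable_EFin_indic d (T : measurableType d) (R : realType) (A : set T) :
  measurable A -> measurable_fun [set: T] (fun x => (\1_A x)%:E : \bar R).
Proof. by move=> mA; apply/measurable_EFinP; exact: measurable_indic. Qed.

(** * Dyadic cubes *)

Section dyadic_cubes.
Local Open Scope ereal_scope.
Variable R : realType.
Local Notation l1 := (@lebesgue_measure R).

Definition side (j : int) : R := (2 ^ (- j))%R.

Lemma side_gt0 j : (0 < side j)%R.
Proof. by rewrite /side exprz_gt0. Qed.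

Definition cube_itv (j m : int) : set R :=
  `[(side j * m%:~R)%R, (side j * (m%:~R + 1))%R[%classic.

Lemma dyadic_cubeE n (j : int) (k : n.-tuple int) :
  @dyadic_cube R n j k = [set x | forall i, cube_itv j (tnth k i) (tnth x i)].
Proof.
by apply/seteqP; split => x Qx i; have := Qx i; rewrite /cube_itv /= in_itv.
Qed.

Lemma dyadic_cube_consR n j (k : n.+1.-tuple int) x (y : n.-tuple R) :
  dyadic_cube j k (consR x y) <->
  cube_itv j (thead k) x /\ dyadic_cube j [tuple of behead k] y.
Proof.
rewrite !dyadic_cubeE; split => [Q|[Qx Qy] i].
  split => [|i]; first exact: (Q ord0).
  by have := Q (lift ord0 i); rewrite /= tnthS tnth_behead_lift.
case: (unliftP ord0 i) => [i'|] ->; last exact: Qx.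
by rewrite tnthS; have := Qy i'; rewrite /= tnth_behead_lift.
Qed.

Lemma measurable_dyadic_cube n j (k : n.-tuple int) :
  measurable (@dyadic_cube R n j k).
Proof.
rewrite dyadic_cubeE (_ : [set x | _] =
    \bigcap_(i in [set: 'I_n]) (@tnth n R ^~ i) @^-1` cube_itv j (tnth k i)).
  apply: fin_bigcap_measurable => // i _; rewrite -[X in measurable X]setTI.
  by apply: measurable_tnth => //; exact: measurable_itv.
by apply/seteqP; split => x Qx i; [move=> _|]; exact: Qx.
Qed.

Lemma lebesgue_cube_itv j m : l1 (cube_itv j m) = (side j)%:E.
Proof.
rewrite /cube_itv lebesgue_measure_itv/= lte_fin ltr_pM2l ?side_gt0//.
by rewrite ltrDl ltr01 -EFinD -mulrBr addrAC subrr add0r mulr1.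
Qed.

Lemma leb_dyadic_cube n j (k : n.-tuple int) :
  leb (@dyadic_cube R n j k) = (side j ^+ n)%:E.
Proof.
rewrite lebE; elim: n k => [|n IH] k /=.
  by rewrite diracE mem_set// => -[].
transitivity (\int[l1]_x ((side j ^+ n)%:E * (\1_(cube_itv j (thead k)) x)%:E)).
  apply: eq_integral => x _; rewrite indicE.
  have [xI|xI] := boolP (x \in cube_itv _ _).
    rewrite mule1 -(IH [tuple of behead k]); congr leb_fun.
    apply/seteqP; split => y; first by move=> /dyadic_cube_consR[].
    by move=> Qy; apply/dyadic_cube_consR; split => //; rewrite inE in xI.
  rewrite mule0 -lebE.
  rewrite (_ : [set y | _] = set0) ?measure0//.
  apply/seteqP; split => // y /dyadic_cube_consR[+ _].
  by rewrite notin_setE in xI.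
rewrite ge0_integralZl//; last 2 first.
- by apply: measurable_EFin_indic; exact: measurable_itv.
- by rewrite lee_fin exprn_ge0// ltW// side_gt0.
rewrite integral_indic ?setIT//; last exact: measurable_itv.
by rewrite [X in _ * X](lebesgue_cube_itv j (thead k)) -EFinM -exprSr.
Qed.

Lemma harmonic_sumS n (q : n.+1.-tuple R) :
  harmonic_sum q = ((thead q)^-1 + harmonic_sum [tuple of behead q])%R.
Proof.
rewrite /harmonic_sum big_ord_recl; congr (_ + _)%R.
by apply: eq_bigr => i _; rewrite tnth_behead_lift.
Qed.

(** The indicator of a cube is a product of indicators of intervals, and the norm in x_i contributes
    the exponent [1 / q_i]. *)
Lemma mixed_norm_dyadic_cube n (q : n.-tuple R) j (k : n.-tuple int) :
  exponents_ge1 q ->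
  mixed_norm q (EFin \o \1_(@dyadic_cube R n j k)) =
  (side j `^ harmonic_sum q)%:E.
Proof.
elim: n q k => [|n IH] q k q1.
  by rewrite /harmonic_sum big_ord0 powRr0/= indicE mem_set// => -[].
have q0 : (0 < thead q)%R by rewrite (lt_le_trans _ (exponents_ge1_thead q1)).
rewrite mixed_normS harmonic_sumS powRD; last first.
  by apply/implyP => _; rewrite gt_eqF// side_gt0.
rewrite EFinM -(IH _ [tuple of behead k]); last exact: exponents_ge1_behead.
rewrite -mixed_norm_scale ?powR_ge0//; last 2 first.
- exact: exponents_ge1_behead.
- by apply: measurable_EFin_indic; exact: measurable_dyadic_cube.
congr mixed_norm; apply/funext => y; rewrite /slice_norm muleC /=.
have -> : (fun x => (\1_(dyadic_cube j k) (consR x y))%:E) =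
    (fun x => (\1_(dyadic_cube j [tuple of behead k]) y)%:E *
      (EFin \o \1_(cube_itv j (thead k))) x) :> (R -> \bar R).
  apply/funext => x /=; rewrite -EFinM !indicE -natrM mulnb; congr (_%:R%:E).
  rewrite (_ : _ && _ =
    (x \in cube_itv j (thead k)) && (y \in dyadic_cube j [tuple of behead k]));
    last by rewrite andbC.
  congr nat_of_bool; apply/idP/andP; rewrite !inE; first by move=> /dyadic_cube_consR.
  by move=> ?; apply/dyadic_cube_consR.
rewrite Lnorm_scale//; last 2 first.
- exact: exponents_ge1_thead.
- by apply: measurable_EFin_indic; exact: measurable_itv.
rewrite Lnorm_indic//; last exact: measurable_itv.
by rewrite [X in X `^ _](lebesgue_cube_itv j (thead k)).
Qed.

(** Hoelder is applied once per coordinate, on an interval of length [side j], and contributes the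
    exponents [1 - 1 / q_i]. *)
Lemma integral_le_mixed_norm n (q : n.-tuple R) j (k : n.-tuple int)
    (F : n.-tuple R -> \bar R) : (forall i, 1 < tnth q i)%R ->
  measurable_fun [set: n.-tuple R] F -> (forall x, 0 <= F x) ->
  (forall x, ~ dyadic_cube j k x -> F x = 0) ->
  \int[leb]_x F x <= (side j `^ (n%:R - harmonic_sum q))%:E * mixed_norm q F.
Proof.
elim: n q k F => [|n IH] q k F q1 mF F0 FQ.
  by rewrite integral_leb0// /harmonic_sum big_ord0 subrr powRr0 mul1e.
have q1' i : (1 < tnth [tuple of behead q] i)%R by rewrite tnth_behead.
have q1_ge1 : exponents_ge1 q by move=> i; exact: ltW.
rewrite integral_lebS//.
apply: (@le_trans _ _ (\int[leb]_y
    ((side j `^ (1 - (thead q)^-1))%:E * slice_norm q F y))).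
  apply: ge0_le_integral => //.
  - by move=> y _; apply: integral_ge0.
  - exact: measurable_integral_slice.
  - by apply: measurable_funeM; exact: measurable_slice_norm.
  move=> y _; rewrite -poweR_EFin -(lebesgue_cube_itv j (thead k)).
  apply: integral_le_Lnorm => //.
  - exact: (q1 ord0).
  - exact: measurable_itv.
  - by rewrite [ltRHS](lebesgue_cube_itv j (thead k)) lte_fin side_gt0.
  - exact: measurable_slice.
  - by move=> x Ix; apply: FQ => /dyadic_cube_consR[].
rewrite ge0_integralZl//; last 3 first.
- exact: measurable_slice_norm.
- by move=> y _; exact: Lnorm_ge0.
- by rewrite lee_fin powR_ge0.
have slQ y : ~ dyadic_cube j [tuple of behead k] y -> slice_norm q F y = 0.
  move=> Qy; rewrite /slice_norm.
  rewrite (_ : (fun x => _) = (fun=> 0)); last first.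
    by apply/funext => x; apply: FQ => /dyadic_cube_consR[].
  by rewrite Lnorm0// eqe gt_eqF// (lt_trans _ (q1 ord0)).
have := IH _ _ _ q1' (measurable_slice_norm q mF) (fun y => Lnorm_ge0 _ _ _) slQ.
move=> /(lee_wpmul2l (_ : 0 <= (side j `^ (1 - (thead q)^-1))%:E)).
rewrite lee_fin powR_ge0 => /(_ isT) /le_trans; apply.
rewrite muleA -EFinM -powRD; last by apply/implyP => _; rewrite gt_eqF// side_gt0.
by rewrite harmonic_sumS opprD addrACA nat1r mixed_normS.
Qed.

End dyadic_cubes.

(** * Decompositions into atoms *)

Section ell_norms.
Local Open Scope ereal_scope.
Variables (R : realType) (rho : R).
Hypothesis rho_ge1 : (1 <= rho)%R.

Let rho_gt0 : (0 < rho)%R. Proof. exact: lt_le_trans rho_ge1. Qed.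

Definition ell_norm (I : choiceType) (c : I -> \bar R) : \bar R :=
  (\esum_(a in setT) c a `^ rho) `^ rho^-1.

Lemma ell_norm_ge0 (I : choiceType) (c : I -> \bar R) : 0 <= ell_norm c.
Proof. exact: poweR_ge0. Qed.

Lemma le_ell_norm (I : choiceType) (c c' : I -> \bar R) :
  (forall a, 0 <= c a) -> (forall a, c a <= c' a) -> ell_norm c <= ell_norm c'.
Proof.
move=> c0 cc'; apply: le_poweR; first by rewrite invr_ge0 ltW.
  by apply: esum_ge0 => a _; exact: poweR_ge0.
by apply: le_esum => a _; apply: le_poweR => //; exact: ltW.
Qed.

Lemma ell_norm_scale (I : countType) (k : R) (c : I -> \bar R) :
  (0 <= k)%R -> (forall a, 0 <= c a) ->
  ell_norm (fun a => k%:E * c a) = k%:E * ell_norm c.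
Proof.
move=> k0 c0; rewrite /ell_norm.
under eq_esum => a _ do rewrite poweRM ?lee_fin// poweR_EFin.
rewrite esumZl ?powR_ge0//; last by move=> a; exact: poweR_ge0.
rewrite poweRM ?lee_fin ?powR_ge0//; last first.
  by apply: esum_ge0 => a _; exact: poweR_ge0.
by rewrite poweR_EFin -powRrM mulfV ?gt_eqF// powRr1.
Qed.

(** In this form the Minkowski inequality of Lebesgue norms applies to sequences. *)
Lemma ell_norm_counting (I : countType) (c : I -> \bar R) :
  (forall a, 0 <= c a) ->
  ell_norm c = 'N[counting]_rho%:E[(fun k : nat => oapp c 0 (pickle_inv k))].
Proof.
move=> c0; rewrite Lnorm_counting// /ell_norm esum_countType; last first.
  by move=> a; exact: poweR_ge0.
congr (_ `^ _); apply: eq_eseriesr => k _; case: (pickle_inv k) => [a|] /=.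
  by rewrite gee0_abs.
by rewrite normr0 powR0// gt_eqF.
Qed.

Lemma ell_norm_esum_le (I J : countType) (c : J -> I -> \bar R) :
  (forall k a, 0 <= c k a) ->
  ell_norm (fun a => \esum_(k in setT) c k a) <= \esum_(k in setT) ell_norm (c k).
Proof.
move=> c0; rewrite ell_norm_counting; last by move=> a; apply: esum_ge0.
under [leRHS]eq_esum => k _ do rewrite ell_norm_counting//.
apply: le_trans (Lnorm_esum_le _ _ _ _) => //.
  rewrite le_eqVlt; apply/orP; left; apply/eqP; congr Lnorm; apply/funext => k.
  by case: (pickle_inv k) => //=; rewrite esum1.
by move=> k m; case: (pickle_inv m) => /=.
Qed.

Lemma le_ell_norm_coef (I : countType) (c : I -> \bar R) a :
  (forall a, 0 <= c a) -> c a <= ell_norm c.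
Proof.
move=> c0; rewrite -[leLHS]poweRe1// -[1%R](@mulfV _ rho) ?gt_eqF// poweRrM.
apply: le_poweR; [by rewrite invr_ge0 ltW|exact: poweR_ge0|].
by apply: (@esum_sup_term _ _ (fun a => c a `^ rho)) => b; exact: poweR_ge0.
Qed.

Lemma ell_norm_ltyP (I : countType) (c : I -> \bar R) :
  (ell_norm c < +oo) = (\esum_(a in setT) c a `^ rho < +oo).
Proof.
apply/idP/idP; last exact: poweR_lty.
by apply: lty_poweRy; rewrite invr_eq0 gt_eqF.
Qed.

(** The tail is cut along the coding of the index set; its [rho]-th power is a tail of a convergent
    series. *)
Lemma ell_norm_tail_cvg0 (I : countType) (c : I -> \bar R) :
  (forall a, 0 <= c a) -> ell_norm c < +oo ->
  (fun m => ell_norm (fun a => if (choice.pickle a < m)%N then 0 else c a))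
    @ \oo --> 0.
Proof.
move=> c0; rewrite ell_norm_ltyP => cfin.
apply: cvg0_poweR; first by rewrite invr_gt0.
  by move=> m; apply: esum_ge0 => a _; exact: poweR_ge0.
move: cfin; rewrite esum_countType; last by move=> a; exact: poweR_ge0.
pose f k := oapp (fun a => c a `^ rho) 0 (@pickle_inv I k).
rewrite -[X in X < _]/(\sum_(k <oo) f k) => cfin.
have f0 k : 0 <= f k.
  by rewrite /f; case: (pickle_inv k) => [a|//]; exact: poweR_ge0.
rewrite [X in X @ _ --> _](_ : _ = fun m => \sum_(m <= k <oo) f k); last first.
  apply/funext => m; rewrite esum_countType; last by move=> a; exact: poweR_ge0.
  rewrite (nneseries_split 0 m)//; last first.
    by move=> k _; case: (pickle_inv k) => [a|//]; exact: poweR_ge0.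
  rewrite add0n big_nat_cond big1 ?add0e.
    rewrite (eseries_cond f) [LHS]eseries_cond; apply: eq_eseriesr => k /andP[_ mk].
    rewrite /f; case E : (pickle_inv k) => [a|]//=.
    have -> : choice.pickle a = k by have := @pickle_invK I k; rewrite E.
    by rewrite ltnNge mk.
  move=> k /andP[/andP[_ km] _]; case E : (pickle_inv k) => [a|]//=.
  have -> : choice.pickle a = k by have := @pickle_invK I k; rewrite E.
  by rewrite km poweR0r// gt_eqF.
exact: nneseries_tail_cvg.
Qed.

End ell_norms.

Section decomposition_norm.
Local Open Scope ereal_scope.
Variables (R : realType) (n : nat) (q : n.-tuple R) (s rho : R).
Local Notation E := (n.-tuple R).
Local Notation I := (int * n.-tuple int)%type.
Hypothesis q_ge1 : exponents_ge1 q.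
Hypothesis rho_ge1 : (1 <= rho)%R.

(* [coef a F] is the smallest [lambda] for which [F / lambda] is a block on
   the cube of index [a], where [s] is the exponent [sum_i 1/p_i - n/t]. *)
Definition coef (a : I) (F : E -> \bar R) : \bar R :=
  (side R a.1 `^ s)%:E * mixed_norm q F.

(** Only localization is asked; the size of an atom is left to [coef], so that families can be added
    cube by cube. *)
Definition atoms (u : I -> E -> \bar R) := forall a,
  [/\ measurable_fun [set: E] (u a), forall x, 0 <= u a x &
      forall x, ~ dyadic_cube a.1 a.2 x -> u a x = 0].

Definition atoms_norm (u : I -> E -> \bar R) := ell_norm rho (fun a => coef a (u a)).

Definition dominates (u : I -> E -> \bar R) (F : E -> \bar R) :=
  {ae leb, forall x, F x <= \esum_(a in setT) u a x}.

Definition decomp_norm (F : E -> \bar R) : \bar R :=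
  ereal_inf [set atoms_norm u | u in [set u | atoms u /\ dominates u F]].

Lemma coef_ge0 a F : (forall x, 0 <= F x) -> 0 <= coef a F.
Proof. by move=> F0; rewrite mule_ge0 ?lee_fin ?powR_ge0// mixed_norm_ge0. Qed.

Lemma le_coef a F G : measurable_fun [set: E] F -> measurable_fun [set: E] G ->
  (forall x, 0 <= F x) -> (forall x, F x <= G x) -> coef a F <= coef a G.
Proof.
by move=> *; rewrite lee_wpmul2l ?lee_fin ?powR_ge0//; exact: le_mixed_norm.
Qed.

Lemma coef_cst0 a : coef a (fun=> 0) = 0.
Proof. by rewrite /coef mixed_norm_cst0// mule0. Qed.

Lemma decomp_norm_ge0 F : 0 <= decomp_norm F.
Proof. by apply: le_ereal_inf_tmp => _ [u _ <-]; exact: ell_norm_ge0. Qed.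

Lemma decomp_norm_le u F : atoms u -> dominates u F ->
  decomp_norm F <= atoms_norm u.
Proof. by move=> au uF; apply: ereal_inf_lbound; exists u. Qed.

Lemma decomp_norm_lt F (c : \bar R) : decomp_norm F < c ->
  exists u, [/\ atoms u, dominates u F & atoms_norm u < c].
Proof. by move=> /ereal_inf_lt[_ [u [au uF] <-] uc]; exists u. Qed.

Lemma le_decomp_norm F G : {ae leb, forall x, F x <= G x} ->
  decomp_norm F <= decomp_norm G.
Proof.
move=> FG; apply: le_ereal_inf_tmp => _ [u [au uG] <-].
apply: ereal_inf_lbound; exists u => //; split => //; apply: filterS2 uG FG => x uG FG.
exact: le_trans uG.
Qed.

Lemma atoms_esum (J : countType) (u : J -> I -> E -> \bar R) :
  (forall k, atoms (u k)) -> atoms (fun a x => \esum_(k in setT) u k a x).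
Proof.
move=> au a; split=> [|x|x Qx].
- by apply: measurable_esum => [k|k x]; have [] := au k a.
- by apply: esum_ge0 => k _; have [] := au k a.
- by rewrite esum1// => k _; have [_ _ ->] := au k a.
Qed.

(** Minkowski is used twice: in the mixed norm on each cube, and in l^rho over the cubes. *)
Lemma atoms_norm_esum_le (J : countType) (u : J -> I -> E -> \bar R) :
  (forall k, atoms (u k)) ->
  atoms_norm (fun a x => \esum_(k in setT) u k a x) <=
  \esum_(k in setT) atoms_norm (u k).
Proof.
move=> au; apply: le_trans (ell_norm_esum_le _ _) => //; last first.
  by move=> k a; apply: coef_ge0; have [] := au k a.
apply: le_ell_norm => // a.
  by apply: coef_ge0 => x; apply: esum_ge0 => k _; have [] := au k a.
rewrite esumZl ?powR_ge0//; last first.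
  by move=> k; apply: mixed_norm_ge0; have [] := au k a.
rewrite lee_wpmul2l ?lee_fin ?powR_ge0//; apply: mixed_norm_esum_le => //.
  by move=> k; have [] := au k a.
by move=> k; have [] := au k a.
Qed.

Lemma esum_exchange (J K : countType) (f : J -> K -> \bar R) :
  (forall j k, 0 <= f j k) ->
  \esum_(j in setT) \esum_(k in setT) f j k =
  \esum_(k in setT) \esum_(j in setT) f j k.
Proof.
move=> f0; rewrite !esum_esum//.
rewrite (reindex_esum (setT `*`` (fun=> setT)) _ (fun z : K * J => (z.2, z.1)))//.
split => [[]//|[a b] [c d] _ _ [-> ->]//|[a b] _].
by exists (b, a).
Qed.

(** Near-optimal families for the [G k], with errors summing to [e], are added cube by cube. Since
    only majorants are added, no convergence of signed series intervenes. *)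
Lemma decomp_norm_nneseries (F : E -> \bar R) (G : nat -> E -> \bar R) :
  (forall k x, 0 <= G k x) ->
  {ae leb, forall x, F x <= \sum_(k <oo) G k x} ->
  decomp_norm F <= \sum_(k <oo) decomp_norm (G k).
Proof.
move=> G0 FG; have [fin|] := ltP (\sum_(k <oo) decomp_norm (G k)) +oo; last first.
  by rewrite leye_eq => /eqP ->; exact: leey.
apply/lee_addgt0Pr => e e0.
apply: le_trans (epsilon_trick _ (fun k => decomp_norm_ge0 (G k)) (ltW e0)).
have Gfin k : decomp_norm (G k) \is a fin_num.
  rewrite ge0_fin_numE ?decomp_norm_ge0//; apply: le_lt_trans fin.
  rewrite nneseries_esumT; last by move=> i; exact: decomp_norm_ge0.
  by apply: (@esum_sup_term _ _ (fun i => decomp_norm (G i))) => i; exact: decomp_norm_ge0.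
have /choice[u hu] : forall k, exists u, [/\ atoms u, dominates u (G k) &
    atoms_norm u < decomp_norm (G k) + (e / (2 ^ k.+1)%:R)%:E].
  move=> k; apply: decomp_norm_lt; rewrite lteDl//.
  by rewrite lte_fin divr_gt0// ltr0n expn_gt0.
have au k : atoms (u k) by have [] := hu k.
apply: le_trans (decomp_norm_le (atoms_esum au) _) _.
  have : {ae leb, forall x k, G k x <= \esum_(a in setT) u k a x}.
    by apply/ae_foralln => k; have [] := hu k.
  apply: filterS2 FG => x /= FG uG; apply: le_trans FG _.
  rewrite esum_exchange; last by move=> a k; have [] := au k a.
  rewrite nneseries_esumT; last first.
    by move=> k; exact: G0.
  by apply: le_esum.
apply: le_trans (atoms_norm_esum_le au) _.
rewrite -nneseries_esumT; last by move=> k; exact: ell_norm_ge0.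
apply: lee_nneseries => k _; first by move=> _; exact: ell_norm_ge0.
by have [_ _ /ltW] := hu k.
Qed.

End decomposition_norm.

(** * Cutting a majorant down to exact portions *)

Section greedy.
Local Open Scope ereal_scope.
Context d (T : measurableType d) (R : realType) (I : countType).
Variables (u : I -> T -> \bar R) (G : T -> R).
Hypothesis mu : forall a, measurable_fun [set: T] (u a).
Hypothesis u0 : forall a x, 0 <= u a x.
Hypothesis mG : measurable_fun [set: T] G.
Hypothesis G0 : forall x, (0 <= G x)%R.

(* [V k] is the increment of the truncations at [G] of the partial sums of [u],
   so it is at most the [k]-th term and telescopes. *)
Let U k x := oapp (fun a => u a x) 0 (@pickle_inv I k).
Let S m x := \sum_(0 <= k < m) U k x.
Let M m x := fine (mine (S m x) (G x)%:E).
Let V k x := (M k.+1 x - M k x)%R.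

Let U0 k x : 0 <= U k x.
Proof. by rewrite /U; case: (pickle_inv k) => [a|] /=. Qed.

Let S0 m x : 0 <= S m x. Proof. by apply: sume_ge0 => k _. Qed.

Let mS m : measurable_fun [set: T] (S m).
Proof.
apply: emeasurable_sum => k; rewrite /U.
by case: (pickle_inv k) => [a|] /=; [exact: mu|exact: measurable_cst].
Qed.

Let ME m x : (M m x)%:E = mine (S m x) (G x)%:E.
Proof.
rewrite fineK// ge0_fin_numE; last by rewrite le_min S0/= lee_fin.
by apply: (@le_lt_trans _ _ (G x)%:E); [rewrite ge_min lexx orbT|exact: ltry].
Qed.

Let M_le m x : (M m x <= G x)%R.
Proof. by rewrite -lee_fin ME ge_min lexx orbT. Qed.

Let M_ge0 m x : (0 <= M m x)%R.
Proof. by rewrite fine_ge0// le_min S0/= lee_fin. Qed.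

Let mM m : measurable_fun [set: T] (M m).
Proof.
apply: measurableT_comp => //; apply: measurable_mine => //.
exact/measurable_EFinP.
Qed.

Let SS m x : S m.+1 x = S m x + U m x.
Proof. by rewrite /S big_nat_recr. Qed.

Let V0 k x : (0 <= V k x)%R.
Proof.
rewrite subr_ge0 -lee_fin !ME SS le_min ge_min leeDl//=.
by rewrite ge_min lexx orbT.
Qed.

Let V_le k x : (V k x)%:E <= U k x.
Proof.
rewrite EFinB leeBlDl// !ME SS.
have [SG|GS] := leP (S k x) (G x)%:E; first by rewrite ge_min lexx.
by rewrite ge_min leeDl// orbT.
Qed.

Let sumV m x : (\sum_(0 <= k < m) V k x = M m x)%R.
Proof.
rewrite telescope_sumr// (_ : M 0 x = 0%R) ?subr0//.
by rewrite /M /S big_geq// min_l// lee_fin.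
Qed.

(** The first [m] portions add up to the minimum of [G x] and the [m]-th partial sum of [u]. If
    their series stayed below [G x], no truncation would ever be active, and the sum of [u] itself
    would be below [G x]. *)
Lemma greedy_split_nat : exists v : nat -> T -> R,
  [/\ forall k, measurable_fun [set: T] (v k), forall k x, (0 <= v k x)%R,
      forall k x, (v k x)%:E <= oapp (fun a => u a x) 0 (@pickle_inv I k),
      forall m x, (\sum_(0 <= k < m) v k x <= G x)%R &
      forall x, (G x)%:E <= \esum_(a in setT) u a x ->
        \sum_(k <oo) (v k x)%:E = (G x)%:E].
Proof.
exists V; split=> [k|||m x|x].
- exact: measurable_funB.
- exact: V0.
- exact: V_le.
- by rewrite sumV.
rewrite esum_countType// => GU; apply/eqP; rewrite eq_le; apply/andP; split.
  apply: lime_le; first by apply: is_cvg_nneseries => k _ _; rewrite lee_fin.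
  by apply: nearW => m; rewrite /= sumEFin sumV lee_fin.
rewrite leNgt; apply/negP => VG.
move: GU; rewrite leNgt => /negP; apply.
apply: (le_lt_trans _ VG); apply: lime_le.
  by apply: is_cvg_nneseries => k _ _; exact: U0.
apply: nearW => m /=; rewrite -/(S m x).
have MV : (M m x)%:E <= \sum_(k <oo) (V k x)%:E.
  rewrite -sumV -sumEFin.
  by apply: nneseries_lim_ge => k _ _; rewrite lee_fin.
have := le_lt_trans MV VG; move: MV; rewrite ME.
by have [//|_ _] := ltP (S m x) (G x)%:E; rewrite ltxx.
Qed.

(** Numbers that code no index receive a portion bounded by 0, so nothing is lost by indexing with
    [I]. *)
Lemma greedy_split : exists v : I -> T -> R,
  [/\ forall a, measurable_fun [set: T] (v a), forall a x, (0 <= v a x)%R,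
      forall a x, (v a x)%:E <= u a x, forall a x, (v a x <= G x)%R &
      forall x, (G x)%:E <= \esum_(a in setT) u a x ->
        \esum_(a in setT) (v a x)%:E = (G x)%:E].
Proof.
have [v [mv v0 vU vG vsum]] := greedy_split_nat.
exists (fun a => v (choice.pickle a)); split=> [a|a x|a x|a x|x Gu].
- exact: mv.
- exact: v0.
- by have := vU (choice.pickle a) x; rewrite pickleK_inv.
- apply: le_trans (vG (choice.pickle a).+1 x).
  by rewrite big_nat_recr//= lerDr sumr_ge0.
rewrite esum_countType; last by move=> a; rewrite lee_fin.
rewrite -vsum//; apply: eq_eseriesr => k _; have := vU k x.
have := @pickle_invK I k; case: (pickle_inv k) => [a /= ->//|_ /= v_le0].
by apply/eqP; rewrite eq_le v_le0 lee_fin v0.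
Qed.

End greedy.

(** * The block norm as a decomposition norm *)

Section complex_functions.
Variable R : realType.
Local Notation C := (R[i]).

Lemma normc_leD (x y : C) : normc (x + y) <= normc x + normc y.
Proof. by rewrite -lecR rmorphD/=; exact: (@ler_normD _ R[i]). Qed.

Lemma normc_opp (x : C) : normc (- x) = normc x.
Proof. by case: x => a b; rewrite /normc /= !sqrrN. Qed.

Lemma normc_dist (x y : C) : normc (x - y) = normc (y - x).
Proof. by rewrite -normc_opp opprB. Qed.

Lemma normc_ge0 (x : C) : 0 <= normc x.
Proof. by case: x => a b; exact: sqrtr_ge0. Qed.

Lemma normc_real (c : R) : normc (c%:C)%C = `|c|.
Proof. by rewrite /normc /= expr0n addr0 sqrtr_sqr. Qed.

Lemma normc_Re (x : C) : `|complex.Re x| <= normc x.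
Proof. by case: x => a b; rewrite -sqrtr_sqr ler_wsqrtr// lerDl sqr_ge0. Qed.

Lemma normc_Im (x : C) : `|complex.Im x| <= normc x.
Proof. by case: x => a b; rewrite -sqrtr_sqr ler_wsqrtr// lerDr sqr_ge0. Qed.

Lemma normc_le_ReIm (x : C) : normc x <= `|complex.Re x| + `|complex.Im x|.
Proof.
case: x => a b /=; rewrite -[leRHS]ger0_norm ?addr_ge0// -sqrtr_sqr ler_wsqrtr//.
by rewrite sqrrD !real_normK ?num_real// -addrA lerD2l lerDr mulrn_wge0// mulr_ge0.
Qed.

Lemma normc_sum (I : Type) (J : seq I) (F : I -> C) :
  normc (\sum_(a <- J) F a) <= \sum_(a <- J) normc (F a).
Proof.
elim: J => [|a J IH]; first by rewrite !big_nil /= expr0n /= addr0 sqrtr0.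
by rewrite !big_cons (le_trans (normc_leD _ _))// lerD2l.
Qed.

Variable n : nat.
Local Notation E := (n.-tuple R).
Implicit Types f g : E -> C.

Lemma cmeasurable_normc f : cmeasurable f ->
  measurable_fun [set: E] (fun x => normc (f x)).
Proof.
move=> [mRe mIm].
rewrite (_ : (fun x => _) = (@Num.sqrt R) \o
    (fun x => complex.Re (f x) ^+ 2 + complex.Im (f x) ^+ 2)); last first.
  by apply/funext => x /=; case: (f x).
apply: measurableT_comp.
  by apply: continuous_measurable_fun; exact: sqrt_continuous.
by apply: measurable_funD; exact: measurable_funX.
Qed.

Lemma cmeasurable_cmod f : cmeasurable f -> measurable_fun [set: E] (cmod f).
Proof. by move=> mf; apply/measurable_EFinP; exact: cmeasurable_normc. Qed.

Lemma cmod_ge0 f x : (0 <= cmod f x)%E.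
Proof. by rewrite lee_fin normc_ge0. Qed.

Lemma cmeasurable_scaleD (a : C) f g : cmeasurable f -> cmeasurable g ->
  cmeasurable (fun x => a * f x + g x).
Proof.
move=> [fR fI] [gR gI]; split.
  rewrite (_ : (fun x => _) = (fun x => complex.Re a * complex.Re (f x) -
      complex.Im a * complex.Im (f x) + complex.Re (g x))).
    apply: measurable_funD => //.
    by apply: measurable_funB; apply: measurable_funM.
  by apply/funext => x; case: a => ? ?; case: (f x) => ? ?; case: (g x).
rewrite (_ : (fun x => _) = (fun x => complex.Re a * complex.Im (f x) +
    complex.Im a * complex.Re (f x) + complex.Im (g x))).
  apply: measurable_funD => //.
  by apply: measurable_funD; apply: measurable_funM.
apply/funext => x; case: a => ? ?; case: (f x) => ? ?; case: (g x) => ? ? /=.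
by [].
Qed.

Lemma cmeasurableB f g : cmeasurable f -> cmeasurable g ->
  cmeasurable (fun x => f x - g x).
Proof.
move=> mf mg; rewrite (_ : (fun x => _) = (fun x => (-1) * g x + f x)).
  exact: cmeasurable_scaleD.
by apply/funext => x; rewrite mulN1r addrC.
Qed.

Lemma cmeasurable_real_mul (c : E -> R) f : measurable_fun [set: E] c ->
  cmeasurable f -> cmeasurable (fun x => (c x)%:C%C * f x).
Proof.
move=> mc [fR fI]; split.
  rewrite (_ : (fun x => _) = (fun x => c x * complex.Re (f x))).
    exact: measurable_funM.
  by apply/funext => x; case: (f x) => a b /=; rewrite mul0r subr0.
rewrite (_ : (fun x => _) = (fun x => c x * complex.Im (f x))).
  exact: measurable_funM.
by apply/funext => x; case: (f x) => a b /=; rewrite mul0r addr0.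
Qed.

Lemma cmeasurable_cst (a : C) : cmeasurable (fun _ : E => a).
Proof. by split; exact: measurable_cst. Qed.

Lemma cmeasurable_sum (J : nat) (F : nat -> E -> C) :
  (forall k, cmeasurable (F k)) ->
  cmeasurable (fun x => \sum_(0 <= k < J) F k x).
Proof.
move=> mF; elim: J => [|J IH].
  under eq_fun do rewrite big_geq//; exact: cmeasurable_cst.
under eq_fun do rewrite big_nat_recr//= -[\sum_(_ <= _ < _) _]mul1r.
exact: cmeasurable_scaleD.
Qed.

End complex_functions.

Section esum_totally.
Local Open Scope ereal_scope.
Variables (R : realType) (I : choiceType).

Lemma sum_le_esum (J : {fset I}) (c : I -> R) : (forall a, 0 <= c a)%R ->
  (\sum_(a <- J) c a)%:E <= \esum_(a in setT) (c a)%:E.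
Proof.
move=> c0; apply: esum_ge; exists [set` J]; first by split.
by rewrite fsbig_finite//= set_fsetK sumEFin.
Qed.

(** A finite set that nearly exhausts the sum controls the error for all larger finite sets, the
    terms being nonnegative. [totally] is the mode of convergence of [block_representation]. *)
Lemma esum_totally (c : I -> R) (l : R) : (forall a, 0 <= c a)%R ->
  \esum_(a in setT) (c a)%:E = l%:E ->
  (fun J : {fset I} => (l - \sum_(a <- J) c a)%R) @ totally --> (0 : R)%R.
Proof.
move=> c0 cl; have FF := @totally_filter I.
apply/cvgr0Pnorm_lt => e e0.
have : (l - e)%:E < \esum_(a in setT) (c a)%:E by rewrite cl lte_fin ltrBlDr ltrDl.
move=> /ereal_sup_gt[_ [X [finX _] <-]].
move=> lX; exists (fset_set X) => // J /= XJ.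
have JE : (\sum_(a <- J) c a <= l)%R by rewrite -lee_fin -cl sum_le_esum.
rewrite ger0_norm ?subr_ge0// ltrBlDr -ltrBlDl -lte_fin; apply: lt_le_trans lX _.
apply: le_trans (lee_fsum_nneg_subset finX (finite_fset J) _ _) _.
- move=> a /[!inE] Xa; apply: (fsubsetP XJ).
  by rewrite in_fset_set// inE.
- by move=> a _; rewrite lee_fin.
- by rewrite fsbig_finite//= set_fsetK sumEFin.
Qed.

End esum_totally.

Section splitting.
Variables (R : realType) (n : nat).
Local Notation E := (n.-tuple R).
Local Notation C := (R[i]).
Local Notation I := (int * n.-tuple int)%type.

(** The part of [g] with modulus [v] and the phase of [g]. Where [g] vanishes the quotient is 0 by
    convention, in accordance with [v <= normc g]. *)
Definition portion (v : E -> R) (g : E -> C) x : C :=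
  (v x / normc (g x))%:C%C * g x.

Lemma normc_portion v g x : 0 <= v x <= normc (g x) ->
  normc (portion v g x) = v x.
Proof.
move=> /andP[v0 vg]; rewrite normcM normc_real.
have [g0|g0] := eqVneq (normc (g x)) 0.
  by rewrite g0 mulr0; apply/eqP; rewrite eq_le v0 -g0.
by rewrite ger0_norm ?divr_ge0 ?normc_ge0// divfK.
Qed.

Lemma cmeasurable_portion v g : measurable_fun [set: E] v -> cmeasurable g ->
  cmeasurable (portion v g).
Proof.
move=> mv mg; apply: cmeasurable_real_mul => //; apply: measurable_funM => //.
rewrite (_ : (fun x => _) = (fun x => normc (g x) `^ (-1))); last first.
  by apply/funext => x; rewrite powR_inv1 ?normc_ge0.
apply: (@measurableT_comp _ _ _ _ _ _ (@powR R ^~ (-1))).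
  exact: measurable_powR.
exact: cmeasurable_normc.
Qed.

(** All portions are nonnegative multiples of the one number [g x], so their moduli add and subtract
    without loss. *)
Lemma sub_sum_portion (J : Type) (l : seq J) (v : J -> E -> R) g x :
  0 <= \sum_(a <- l) v a x <= normc (g x) ->
  normc (g x - \sum_(a <- l) portion (v a) g x) =
  normc (g x) - \sum_(a <- l) v a x.
Proof.
move=> /andP[s0 sg]; rewrite -mulr_suml -rmorph_sum/= -mulr_suml.
rewrite -[X in normc (X - _)]mul1r -mulrBl -(rmorph1 (real_complex R)) -rmorphB.
rewrite normcM [X in X * _]normc_real.
have [g0|g0] := eqVneq (normc (g x)) 0.
  by rewrite g0 in sg *; rewrite mulr0 sub0r; apply/eqP; rewrite eq_sym oppr_eq0 eq_le s0 sg.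
rewrite ger0_norm; first by rewrite mulrBl mul1r divfK.
by rewrite subr_ge0 ler_pdivrMr ?mul1r// lt0r g0 normc_ge0.
Qed.

Lemma split_dominated (u : I -> E -> \bar R) (g : E -> C) :
  atoms u -> dominates u (cmod g) -> cmeasurable g ->
  exists v : I -> E -> R,
    [/\ forall a, measurable_fun [set: E] (v a),
        forall a x, 0 <= v a x <= normc (g x),
        forall a x, ((v a x)%:E <= u a x)%E &
        {ae leb, forall x, (\esum_(a in setT) (v a x)%:E)%E = (normc (g x))%:E}].
Proof.
move=> au ug mg.
have [||||v [mv v0 vu vg vsum]] := @greedy_split _ _ _ _ u (fun x => normc (g x)).
- by move=> a; have [] := au a.
- by move=> a; have [] := au a.
- exact: cmeasurable_normc.
- by move=> x; exact: normc_ge0.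
exists v; split => // [a x|]; first by rewrite v0 vg.
by apply: filterS ug => x; exact: vsum.
Qed.

(** The enumerated form provides genuine partial sums, for approximation arguments;
    [split_dominated] is indexed by cubes, for building blocks. *)
Lemma split_dominated_nat (u : I -> E -> \bar R) (g : E -> C) :
  atoms u -> dominates u (cmod g) -> cmeasurable g ->
  exists v : nat -> E -> R,
    [/\ forall k, measurable_fun [set: E] (v k), forall k x, 0 <= v k x,
        forall k x, ((v k x)%:E <= oapp (fun a => u a x) 0 (@pickle_inv I k))%E,
        forall m x, \sum_(0 <= k < m) v k x <= normc (g x) &
        {ae leb, forall x, (\sum_(k <oo) (v k x)%:E)%E = (normc (g x))%:E}].
Proof.
move=> au ug mg.
have [||||v [mv v0 vu vg vsum]] := @greedy_split_nat _ _ _ _ u (fun x => normc (g x)).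
- by move=> a; have [] := au a.
- by move=> a; have [] := au a.
- exact: cmeasurable_normc.
- by move=> x; exact: normc_ge0.
exists v; split => //.
by apply: filterS ug => x; exact: vsum.
Qed.

End splitting.

Section block_norm_is_decomp_norm.
Variables (R : realType) (n : nat) (p : n.-tuple R) (t : R) (r : \bar R).
Hypothesis n_gt0 : (0 < n)%N.
Hypothesis q_ge1 : exponents_ge1 (conj_vec p).
Hypothesis rho_ge1 : 1 <= conj_exp r.
Local Notation E := (n.-tuple R).
Local Notation C := (R[i]).
Local Notation I := (int * n.-tuple int)%type.
Local Notation q := (conj_vec p).
Local Notation rho := (conj_exp r).
Let s : R := harmonic_sum p - n%:R / t.

(** As [|Q|] is the [n]-th power of the side, the exponent becomes [n/t - sum_i 1/p_i = - s]: the
    size condition on blocks is [coef <= 1]. *)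
Lemma leb_cube_power (a : I) :
  (leb (@dyadic_cube R n a.1 a.2) `^ (t^-1 - n%:R^-1 * harmonic_sum p))%E =
  ((side R a.1 `^ s)^-1)%:E.
Proof.
rewrite leb_dyadic_cube poweR_EFin -powR_mulrn ?ltW ?side_gt0// -powRrM -powRN.
congr (_ `^ _)%:E; rewrite /s opprB mulrBr mulrA mulfV ?mul1r//.
by rewrite pnatr_eq0 -lt0n.
Qed.

Lemma blockP (a : I) (b : E -> C) : block p t (dyadic_cube a.1 a.2) b <->
  [/\ cmeasurable b, forall x, ~ dyadic_cube a.1 a.2 x -> b x = 0 &
      (coef q s a (cmod b) <= 1)%E].
Proof.
have w0 : 0 < side R a.1 `^ s by rewrite powR_gt0// side_gt0.
rewrite /block leb_cube_power /coef.
by rewrite muleC -lee_pdivlMr// mul1e.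
Qed.

(** The functions [normc (lam a) * cmod (b a)] form a dominating family of atoms with coefficients
    at most [normc (lam a)]. *)
Lemma decomp_norm_le_lnorm (g : E -> C) lam : cmeasurable g ->
  block_coefs p t r g lam -> (decomp_norm q s rho (cmod g) <= lnorm rho lam)%E.
Proof.
move=> mg [_ [b [blk conv]]].
pose u (a : I) (x : E) : \bar R := ((normc (lam a))%:E * cmod (b a) x)%E.
have au : atoms u.
  move=> a; have /blockP[mb bQ _] := blk a; split.
  - by apply: measurable_funeM; exact: cmeasurable_cmod.
  - by move=> x; rewrite mule_ge0// ?lee_fin ?normc_ge0.
  - by move=> x /bQ bx; rewrite /u /cmod bx normc0 mule0.
have ug : dominates u (cmod g).
  apply: filterS conv => x gx; apply/lee_addgt0Pr => e e0.
  have FF := @totally_filter I.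
  (* At each point a single finite set with error below [e] is enough. *)
  move/cvgr0Pnorm_lt : gx => /(_ e e0)[J0 _ /(_ J0)] /=.
  rewrite fsubset_refl => /(_ isT) gJ.
  rewrite /cmod -[g x](subrK (\sum_(a <- J0) lam a * b a x)).
  apply: (@le_trans _ _ (e + \sum_(a <- J0) normc (lam a * b a x))%:E).
    rewrite lee_fin (le_trans (normc_leD _ _))// lerD ?normc_sum//.
    by rewrite (le_trans (ler_norm _))// ltW.
  rewrite addeC EFinD leeD2l//.
  rewrite (_ : \esum_(a in setT) u a x = \esum_(a in setT) (normc (lam a * b a x))%:E)%E.
    by apply: sum_le_esum => a; exact: normc_ge0.
  by apply: eq_esum => a _; rewrite normcM EFinM.
apply: le_trans (decomp_norm_le q s rho au ug) _.
rewrite -[leRHS]/(ell_norm rho (fun a : I => (normc (lam a))%:E)).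
apply: le_ell_norm => // [a|a].
  by apply: coef_ge0; have [] := au a.
have /blockP[mb _ b1] := blk a.
rewrite /coef mixed_norm_scale ?normc_ge0//; last exact: cmeasurable_cmod.
by rewrite muleCA -[leRHS]mule1 lee_wpmul2l// lee_fin normc_ge0.
Qed.

(** The greedy portions of [g], divided by the coefficients of the atoms above them, are blocks;
    exactness of the portions turns domination into a representation. *)
Lemma block_coefs_of_atoms (g : E -> C) (u : I -> E -> \bar R) : cmeasurable g ->
  atoms u -> dominates u (cmod g) -> (atoms_norm q s rho u < +oo)%E ->
  exists2 lam, block_coefs p t r g lam & (lnorm rho lam <= atoms_norm q s rho u)%E.
Proof.
move=> mg au ug ufin; have [v [mv v0g vu vsum]] := split_dominated au ug mg.
have cu0 a : (0 <= coef q s a (u a))%E by apply: coef_ge0; have [] := au a.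
have cufin a : coef q s a (u a) \is a fin_num.
  rewrite ge0_fin_numE//; apply: le_lt_trans ufin.
  exact: (@le_ell_norm_coef _ _ _ _ (fun a => coef q s a (u a))).
pose l a := fine (coef q s a (u a)).
have l0 a : 0 <= l a by exact: fine_ge0.
have lE : lnorm rho (fun a => (l a)%:C%C) = atoms_norm q s rho u.
  rewrite /lnorm /atoms_norm /ell_norm; congr (_ `^ _)%E.
  by apply: eq_esum => a _; rewrite normc_real ger0_norm// -poweR_EFin fineK.
exists (fun a => (l a)%:C%C); last by rewrite lE.
split; first by rewrite /= lE.
pose b a x := ((l a)^-1)%:C%C * portion (v a) g x.
have mcv a : measurable_fun [set: E] (fun x => (v a x)%:E) by apply/measurable_EFinP.
have v0 a x : 0 <= v a x by have /andP[] := v0g a x.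
have mu a : measurable_fun [set: E] (u a) by have [] := au a.
have lv a : (coef q s a (fun x => (v a x)%:E) <= (l a)%:E)%E.
  by rewrite fineK//; apply: le_coef => // x; rewrite lee_fin.
exists b; split.
  move=> a; apply/blockP; split.
  - apply: cmeasurable_real_mul; first exact: measurable_cst.
    exact: cmeasurable_portion.
  - move=> x Qx; have [_ _ /(_ _ Qx) ux] := au a.
    rewrite /b /portion (_ : v a x = 0) ?mul0r ?rmorph0 ?mul0r ?mulr0//.
    by apply/eqP; rewrite eq_le v0 andbT -lee_fin (le_trans (vu a x))// ux.
  rewrite (_ : cmod (b a) = fun x => ((l a)^-1)%:E * (v a x)%:E)%E; last first.
    apply/funext => x; rewrite /cmod normcM normc_real normc_portion//.
    by rewrite ger0_norm ?invr_ge0.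
  rewrite /coef mixed_norm_scale ?invr_ge0// muleCA -/(coef q s a (fun x => (v a x)%:E)).
  have [la0|la0] := eqVneq (l a) 0; first by rewrite la0 invr0 mul0e.
  by rewrite lee_pdivrMl ?mule1// lt0r la0 l0.
(* A vanishing coefficient makes [b a] zero by the convention on inverses. This is harmless, as the
   portion then vanishes almost everywhere. *)
have : {ae leb, forall x a, l a = 0 -> v a x = 0}.
  have : {ae leb, forall x k, oapp (fun a : I => l a = 0 -> v a x = 0) True (pickle_inv k)}.
    apply/ae_foralln => k; case: (pickle_inv k) => [a|] /=; last exact: aeW.
    have [la0|la0] := eqVneq (l a) 0; last by apply: aeW => x /eqP; rewrite (negbTE la0).
    have : mixed_norm q (fun x => (v a x)%:E) = 0.
      apply/eqP; rewrite eq_le mixed_norm_ge0 ?andbT//; last by move=> x; rewrite lee_fin.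
      have := lv a; rewrite la0 /coef muleC.
      by rewrite -lee_pdivlMr ?mul0e// powR_gt0// side_gt0.
    move=> /(mixed_norm_eq0_ae q_ge1 (mcv a)) H.
    by apply: filterS (H _) => [x [//]|x]; rewrite lee_fin.
  apply: filterS => x H a; have := H (choice.pickle a).
  by rewrite pickleK_inv.
move=> lv0; apply: filterS2 vsum lv0 => x vsum lv0.
rewrite [X in X @ _ --> _](_ : _ =
    fun J : {fset I} => normc (g x) - \sum_(a <- J) v a x).
  exact: esum_totally.
apply/funext => J.
rewrite -(sub_sum_portion (l := J)); last first.
  by rewrite sumr_ge0//= -lee_fin -vsum sum_le_esum.
congr (normc (_ - _)); apply: eq_bigr => a _; rewrite /b mulrA -rmorphM.
have [la0|la0] := eqVneq (l a) 0; last by rewrite mulfV// rmorph1 mul1r.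
by rewrite /portion lv0// mul0r rmorph0 mul0r mulr0.
Qed.

Lemma block_normE (g : E -> C) : cmeasurable g ->
  block_norm p t r g = decomp_norm q s rho (cmod g).
Proof.
move=> mg; apply/eqP; rewrite eq_le; apply/andP; split; last first.
  by apply: le_ereal_inf_tmp => _ [lam hlam <-]; exact: decomp_norm_le_lnorm.
apply: le_ereal_inf_tmp => _ [u [au ug] <-].
have [ufin|] := ltP (atoms_norm q s rho u) +oo%E; last first.
  by rewrite leye_eq => /eqP ->; exact: leey.
have [lam hlam /(le_trans _)] := block_coefs_of_atoms mg au ug ufin; apply.
by apply: ereal_inf_lbound; exists lam.
Qed.

Lemma block_spaceP (g : E -> C) : block_space p t r g <->
  cmeasurable g /\ (decomp_norm q s rho (cmod g) < +oo)%E.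
Proof.
split=> [[mg [lam hlam]]|[mg /decomp_norm_lt[u [au ug ufin]]]].
  by split => //; apply: le_lt_trans (decomp_norm_le_lnorm mg hlam) _; case: hlam.
by split => //; have [lam hlam _] := block_coefs_of_atoms mg au ug ufin; exists lam.
Qed.

End block_norm_is_decomp_norm.

(** * Power means of finite sums *)

Section finite_jensen.
Local Open Scope ereal_scope.
Variables (R : realType) (rho : R).
Hypothesis rho_ge1 : (1 <= rho)%R.

(** Hoelder for the counting measure on [N] points; [rho = 1] is treated apart because
    [integral_le_Lnorm] asks for an exponent above 1. *)
Lemma poweR_sum_nat_le (N : nat) (x : nat -> \bar R) : (0 < N)%N ->
  (forall k, 0 <= x k) ->
  (\sum_(0 <= k < N) x k) `^ rho <=
  (N%:R `^ (rho - 1))%:E * \sum_(0 <= k < N) x k `^ rho.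
Proof.
move=> N0 x0; have [->|rho1] := eqVneq rho 1%R.
  rewrite subrr powRr0 mul1e poweRe1 ?sume_ge0//.
  by apply: lee_sum => k _; rewrite poweRe1.
have {}rho1 : (1 < rho)%R by rewrite lt_neqAle eq_sym rho1.
have rho0 : (0 < rho)%R by exact: lt_trans rho1.
pose f k := if (k < N)%N then x k else 0.
have f0 k : 0 <= f k by rewrite /f; case: ifP.
have sumf (g : \bar R -> \bar R) : g 0 = 0 -> (forall y, 0 <= y -> 0 <= g y) ->
    \sum_(k <oo) g (f k) = \sum_(0 <= k < N) g (x k).
  move=> g0 gge0; rewrite (nneseries_split 0 N); last by move=> k _; exact: gge0.
  rewrite add0n [X in _ + X]eseries0 ?adde0; last first.
    by move=> k Nk _; rewrite /f ltnNge Nk.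
  by apply: eq_big_nat => k /andP[_ kN]; rewrite /f kN.
have cardN : (counting : {measure set nat -> \bar R}) `I_N = N%:R%:E.
  rewrite /= /counting asboolT//; congr (_%:R%:E).
  by rewrite fset_set_II card_imfset//= ?size_enum_ord//; exact: val_inj.
have := @integral_le_Lnorm R _ _ counting rho `I_N f rho1.
rewrite cardN lte_fin ltr0n => /(_ I N0 _ f0).
have mf : measurable_fun [set: nat] f by [].
have fN k : ~ `I_N k -> f k = 0 by rewrite /f /= => /negP/negbTE ->.
move=> /(_ mf fN).
rewrite ge0_integral_count// (sumf id)// Lnorm_counting//.
have -> : \sum_(k <oo) `|f k| `^ rho = \sum_(0 <= k < N) x k `^ rho.
  rewrite -(sumf (fun y => y `^ rho)); last 2 first.
  - by rewrite poweR0r// gt_eqF.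
  - by move=> y _; exact: poweR_ge0.
  by apply: eq_eseriesr => k _; rewrite gee0_abs.
have s0 : 0 <= \sum_(0 <= k < N) x k by exact: sume_ge0.
move=> /(le_poweR (ltW rho0) s0) /le_trans; apply.
rewrite poweRM ?poweR_ge0// -!poweRrM mulVf ?gt_eqF// poweRe1; last first.
  by apply: sume_ge0 => k _; exact: poweR_ge0.
by rewrite poweR_EFin mulrBl mul1r mulVf ?gt_eqF.
Qed.

Lemma poweR_sum_le (D : finType) (x : D -> \bar R) : (0 < #|D|)%N ->
  (forall d, 0 <= x d) ->
  (\sum_d x d) `^ rho <= (#|D|%:R `^ (rho - 1))%:E * \sum_d x d `^ rho.
Proof.
move=> D0 x0.
pose y k := if insub k is Some i then x (@enum_val D predT i) else 0.
have sumE (g : \bar R -> \bar R) :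
    \sum_d g (x d) = \sum_(0 <= k < #|D|) g (y k).
  rewrite big_mkord (big_enum_val (A := predT) (fun d => g (x d))).
  by apply: eq_bigr => i _; rewrite /y valK.
rewrite (sumE id) (sumE (fun z => z `^ rho)); apply: poweR_sum_nat_le => // k.
by rewrite /y; case: insub.
Qed.

End finite_jensen.

(** * Ancestors and neighbours of cubes *)

Section index_maps.
Variable n : nat.
Local Notation I := (int * n.-tuple int)%type.

(** Integer division by [2 ^+ l] rounds down also on negative coordinates, as the nesting of dyadic
    intervals demands. *)
Definition ancestor (l : nat) (a : I) : I :=
  (a.1 - l%:Z, [tuple (tnth a.2 i %/ 2 ^+ l)%Z | i < n]).

Definition child (l : nat) (a : I) (d : n.-tuple 'I_(2 ^ l)) : I :=
  (a.1 + l%:Z, [tuple tnth a.2 i * 2 ^+ l + (nat_of_ord (tnth d i))%:Z | i < n]).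

Definition translate (e : n.-tuple 'I_3) (a : I) : I :=
  (a.1, [tuple tnth a.2 i + ((nat_of_ord (tnth e i))%:Z - 1) | i < n]).

Definition untranslate (e : n.-tuple 'I_3) (a : I) : I :=
  (a.1, [tuple tnth a.2 i - ((nat_of_ord (tnth e i))%:Z - 1) | i < n]).

Lemma index_eq (a b : I) : a.1 = b.1 -> (forall i, tnth a.2 i = tnth b.2 i) ->
  a = b.
Proof. by case: a b => [j k] [j' k'] /= -> /eq_from_tnth ->. Qed.

Lemma translateK e : cancel (translate e) (untranslate e).
Proof. by move=> a; apply: index_eq => //= i; rewrite !tnth_mktuple addrK. Qed.

Lemma untranslateK e : cancel (untranslate e) (translate e).
Proof. by move=> a; apply: index_eq => //= i; rewrite !tnth_mktuple subrK. Qed.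

Lemma pow2_int_gt0 l : (0 : int) < 2 ^+ l.
Proof. by rewrite exprn_gt0. Qed.

Lemma ltn_pow2_int l (d : 'I_(2 ^ l)) : 0 <= (d : nat)%:Z < 2 ^+ l.
Proof. by rewrite /= -natrX natz ltz_nat ltn_ord. Qed.

Lemma ancestor_child l a d : ancestor l (@child l a d) = a.
Proof.
apply: index_eq => /= [|i]; first by rewrite addrK.
rewrite !tnth_mktuple divzMDl ?gt_eqF ?pow2_int_gt0//.
by rewrite divz_small ?addr0// gtz0_abs ?pow2_int_gt0// ltn_pow2_int.
Qed.

Lemma child_inj l (a : I) : injective (@child l a).
Proof.
move=> d d' /(congr1 snd) /= dd'; apply: eq_from_tnth => i.
have := congr1 (fun w => tnth w i) dd'; rewrite !tnth_mktuple.
by move=> /addrI [] /val_inj.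
Qed.

Lemma child_ancestor l (a : I) : exists d, a = @child l (ancestor l a) d.
Proof.
have pos i : (`|(tnth a.2 i %% 2 ^+ l)%Z|%N < 2 ^ l)%N.
  rewrite -ltz_nat gez0_abs ?modz_ge0 ?gt_eqF ?pow2_int_gt0//.
  by rewrite (_ : (2 ^ l)%:Z = 2 ^+ l) ?ltz_pmod ?pow2_int_gt0// -natrX natz.
exists [tuple Ordinal (pos i) | i < n].
apply: index_eq => /= [|i]; first by rewrite subrK.
rewrite !tnth_mktuple/= gez0_abs ?modz_ge0 ?gt_eqF ?pow2_int_gt0//.
exact: divz_eq.
Qed.

Variable R : realType.
Local Open Scope ereal_scope.

Lemma esum_finType (D : finType) (f : D -> \bar R) : (forall d, 0 <= f d) ->
  \esum_(d in setT) f d = \sum_d f d.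
Proof.
move=> f0; rewrite esum_fset//; last exact: finite_finset.
rewrite (fsbigTE [fset d | d in D]%fset) => [|i]; last by rewrite inE.
by rewrite big_imfset//= big_enum.
Qed.

(** [child l] is a bijection from pairs of a cube and a position onto cubes: each cube descends from
    exactly one cube [l] generations above. *)
Lemma esum_children l (f : I -> \bar R) : (forall a, 0 <= f a) ->
  \esum_(a in setT) f a = \esum_(b in setT) \sum_d f (@child l b d).
Proof.
move=> f0; under [RHS]eq_esum => b _ do rewrite -esum_finType//.
rewrite esum_esum//.
apply: (reindex_esum (setT `*`` (fun=> setT)) _ (fun z => @child l z.1 z.2)).
split => //.
- move=> [a d] [b d'] _ _ /= E.
  have ab : a = b by rewrite -(ancestor_child a d) E ancestor_child.
  by move: E; rewrite ab => /child_inj ->.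
- by move=> a _; have [d ->] := child_ancestor l a; exists (ancestor l a, d).
Qed.

Lemma ell_norm_translate (rho : R) e (c : I -> \bar R) :
  ell_norm rho (fun a => c (untranslate e a)) = ell_norm rho c.
Proof.
rewrite /ell_norm; congr (_ `^ _).
rewrite [RHS](reindex_esum setT setT (untranslate e))//.
split=> // [a b _ _ /(can_inj (untranslateK e))//|a _].
by exists (translate e a) => //; exact: translateK.
Qed.

Lemma card_children l : #|{: n.-tuple 'I_(2 ^ l)}| = (2 ^ (l * n))%N.
Proof. by rewrite card_tuple card_ord expnM. Qed.

(** With [N = 2 ^ (l * n)] descendants, the factor [N ^ (rho - 1)] of the power mean inequality
    becomes [N ^ (1 - 1 / rho)] after the root. *)
Lemma ell_norm_children (rho : R) l (c : I -> \bar R) : (1 <= rho)%R ->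
  (forall a, 0 <= c a) ->
  ell_norm rho (fun b => \sum_d c (@child l b d)) <=
  (2 `^ ((l * n)%:R * (1 - rho^-1)))%:E * ell_norm rho c.
Proof.
move=> rho1 c0; have rho0 : (0 < rho)%R by exact: lt_le_trans rho1.
have N0 : (0 < #|{: n.-tuple 'I_(2 ^ l)}|)%N by rewrite card_children expn_gt0.
set N := #|{: n.-tuple 'I_(2 ^ l)}|.
have -> : (2 `^ ((l * n)%:R * (1 - rho^-1)) = (N%:R `^ (rho - 1)) `^ rho^-1 :> R)%R.
  rewrite /N card_children natrX -powR_mulrn// -!powRrM; congr (_ `^ _)%R.
  by rewrite mulrBl mulfV ?gt_eqF// mul1r.
rewrite -poweR_EFin -poweRM ?lee_fin ?powR_ge0//; last first.
  by apply: esum_ge0 => a _; exact: poweR_ge0.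
apply: le_poweR; first by rewrite invr_ge0 ltW.
  by apply: esum_ge0 => a _; exact: poweR_ge0.
rewrite [in leRHS](esum_children l) => [|a]; last exact: poweR_ge0.
rewrite -esumZl ?powR_ge0//; last by move=> a; apply: sume_ge0 => d _; exact: poweR_ge0.
by apply: le_esum => b _; exact: poweR_sum_le.
Qed.

End index_maps.

(** * The dyadic cubes containing a point *)

Section locations.
Variables (R : realType) (n : nat).
Local Notation E := (n.-tuple R).

Definition location (j : int) (x : E) : n.-tuple int :=
  [tuple Num.floor (tnth x i / side R j) | i < n].

Lemma sideD (j k : int) : side R (j + k) = side R j * side R k.
Proof. by rewrite /side opprD expfzDr// pnatr_eq0. Qed.

Lemma side_nat (l : nat) : side R (- l%:Z) = 2 ^+ l.
Proof. by rewrite /side opprK. Qed.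

Lemma cube_itvP (j m : int) (x : R) :
  cube_itv j m x <-> m = Num.floor (x / side R j).
Proof.
rewrite /cube_itv /= in_itv /=.
have -> : (side R j * m%:~R <= x < side R j * (m%:~R + 1)) =
    (m%:~R <= x / side R j < m%:~R + 1).
  by rewrite ler_pdivlMr ?ltr_pdivrMr ?side_gt0// ![side R j * _]mulrC.
split => [mx|->]; first by apply/esym/floor_def; rewrite intrD.
by have := floor_itv (x / side R j); rewrite intrD.
Qed.

Lemma dyadic_cubeP (j : int) (k : n.-tuple int) (x : E) :
  dyadic_cube j k x <-> k = location j x.
Proof.
rewrite dyadic_cubeE; split => [Q|-> i].
  by apply: eq_from_tnth => i; rewrite tnth_mktuple; apply/cube_itvP.
by apply/cube_itvP; rewrite tnth_mktuple.
Qed.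

Lemma dyadic_cube_location (j : int) (x : E) : dyadic_cube j (location j x) x.
Proof. exact/dyadic_cubeP. Qed.

(** Rounding down at the fine scale and then dividing by [2 ^ l] rounds down at the coarse scale:
    dyadic cubes are nested. *)
Lemma ancestor_location l (j : int) (x : E) :
  ancestor l (j, location j x) = (j - l%:Z, location (j - l%:Z) x).
Proof.
apply: index_eq => //= i; rewrite !tnth_mktuple; apply/esym/floor_def.
rewrite sideD side_nat invfM mulrA; set y := tnth x i / side R j.
have l0 : (0 : R) < 2 ^+ l by rewrite exprn_gt0.
rewrite ler_pdivlMr// ltr_pdivrMr//.
have /andP[fy yf] := floor_itv y.
have E2 : (2 ^+ l : R) = (2 ^+ l : int)%:~R by rewrite rmorphXn.
have modge : 0 <= (Num.floor y %% 2 ^+ l)%Z by rewrite modz_ge0// gt_eqF// pow2_int_gt0.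
have modlt := ltz_pmod (Num.floor y) (pow2_int_gt0 l).
apply/andP; split.
  apply: le_trans fy; rewrite E2 -intrM ler_int.
  by rewrite [leRHS](divz_eq _ (2 ^+ l)) lerDl.
apply: (lt_le_trans yf); rewrite E2 -intrM ler_int mulrDl mul1r.
by rewrite {1}(divz_eq (Num.floor y) (2 ^+ l)) -addrA lerD2l lezD1.
Qed.

Lemma child_location l (j : int) (x : E) :
  exists d, (j + l%:Z, location (j + l%:Z) x) = @child n l (j, location j x) d.
Proof.
have [d] := child_ancestor l (j + l%:Z, location (j + l%:Z) x).
by rewrite ancestor_location addrK => E; exists d.
Qed.

End locations.

(** * Finite norm implies finite almost everywhere *)

Section almost_everywhere_finite.
Local Open Scope ereal_scope.
Variables (R : realType) (n : nat) (q : n.-tuple R) (s rho : R).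
Local Notation E := (n.-tuple R).
Local Notation I := (int * n.-tuple int)%type.
Hypothesis q_gt1 : forall i, (1 < tnth q i)%R.
Hypothesis rho_ge1 : (1 <= rho)%R.
Hypothesis s_ge0 : (0 <= s)%R.
Hypothesis s0_rho1 : s = 0%R -> rho = 1%R.
Hypothesis small_cubes : (n%:R * (1 - rho^-1) < n%:R - harmonic_sum q - s)%R.

Let q_ge1 : exponents_ge1 q. Proof. by move=> i; exact: ltW. Qed.

Lemma esum_geometric_lty (x : R) : (0 <= x < 1)%R ->
  \esum_(l in [set: nat]) (x ^+ l)%:E < +oo.
Proof.
move=> /andP[x0 x1]; rewrite -nneseries_esumT; last by move=> l; rewrite lee_fin exprn_ge0.
apply: (@le_lt_trans _ _ ((1 - x)^-1)%:E); last exact: ltry.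
apply: lime_le; first by apply: is_cvg_nneseries => l _ _; rewrite lee_fin exprn_ge0.
apply: nearW => m /=; rewrite sumEFin lee_fin big_mkord.
rewrite -[leRHS]mul1r ler_pdivlMr ?subr_gt0// mulrC -opprB mulNr -subrX1 opprB.
by rewrite gerBl exprn_ge0.
Qed.

Lemma powR2_lt1 (y : R) : (0 < y)%R -> (0 <= (2 : R) `^ (- y) < 1)%R.
Proof.
move=> y0; rewrite powR_ge0 powRN invf_lt1 ?powR_gt0//.
by rewrite -[ltLHS](congr1 (@^~ y) (@powR1 R)) gt0_ltr_powR ?nnegrE ?ltr1n.
Qed.

Lemma side_powR (l : nat) (y : R) : (side R l%:Z `^ y = (2 `^ (- y)) ^+ l)%R.
Proof.
rewrite /side -exprnN -powR_invn// -powR_mulrn ?powR_ge0// -!powRrM.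
by rewrite mulNr mulrC mulNr.
Qed.

Lemma side_opp_powR (l : nat) (y : R) : (side R (- l%:Z) `^ (- y) = (2 `^ (- y)) ^+ l)%R.
Proof.
by rewrite side_nat -!powR_mulrn ?powR_ge0// -!powRrM mulrC.
Qed.

Lemma ae_forall_count d (T : measurableType d) (mu : {measure set T -> \bar R})
    (K : countType) (P : K -> T -> Prop) :
  (forall k, {ae mu, forall x, P k x}) -> {ae mu, forall x k, P k x}.
Proof.
move=> H.
have : {ae mu, forall x i, oapp (P ^~ x) True (@pickle_inv K i)}.
  by apply/ae_foralln => i; case: pickle_inv => [k|] /=; [exact: H|exact: aeW].
apply: filterS => x Hx k.
by have := Hx (choice.pickle k); rewrite pickleK_inv.
Qed.

Lemma integral_lty_ae d (T : measurableType d) (mu : {measure set T -> \bar R})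
    (f : T -> \bar R) : measurable_fun [set: T] f -> (forall x, 0 <= f x) ->
  \int[mu]_x f x < +oo -> {ae mu, forall x, f x < +oo}.
Proof.
move=> mf f0 foo; have : 'N[mu]_1[f] < +oo.
  by rewrite Lnorm1; under eq_integral do rewrite gee0_abs//.
move=> /(Lnorm_lty_ae (lexx 1%R) mf); apply: filterS => x.
by rewrite ge0_fin_numE.
Qed.

(** The exponent [n - harmonic_sum q] comes from Hoelder, and the weight in [coef] takes away
    [s]. *)
Lemma integral_atom_le (u : I -> E -> \bar R) a : atoms u ->
  \int[leb]_x u a x <=
  (side R a.1 `^ (n%:R - harmonic_sum q - s))%:E * coef q s a (u a).
Proof.
move=> au; have [mu u0 uQ] := au a.
apply: le_trans (integral_le_mixed_norm q_gt1 mu u0 uQ) _.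
rewrite /coef muleA -EFinM -powRD ?subrK//.
by apply/implyP => _; rewrite gt_eqF// side_gt0.
Qed.

(* A cube meeting a unit cube [B] is a descendant or an ancestor of [B]. *)
Lemma esum_atoms_le (u : I -> E -> \bar R) (k0 : n.-tuple int) x : atoms u ->
  dyadic_cube 0 k0 x ->
  \esum_(a in setT) u a x <=
    \esum_(l in [set: nat]) \sum_d u (@child n l ((0%R : int), k0) d) x +
    \esum_(l in [set: nat]) u (ancestor l ((0%R : int), k0)) x.
Proof.
move=> au /dyadic_cubeP ->.
have u0 a y : 0 <= u a y by have [] := au a.
pose f (l : nat) : I := (l%:Z, location l%:Z x).
pose g (l : nat) : I := ((- l%:Z)%R, location (- l%:Z)%R x).
have finj : set_inj [set: nat] f by move=> l l' _ _ [].
have ginj : set_inj [set: nat] g by move=> l l' _ _ [/oppr_inj[]] //.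
rewrite (esumID (range f))//; apply: leeD.
  rewrite setTI esum_image//; apply: le_esum => l _.
  have [d] := child_location l 0 x; rewrite add0r => E.
  rewrite /f E (bigD1 d)//= leeDl//.
  by apply: sume_ge0 => d' _; exact: u0.
rewrite (_ : \esum_(l in setT) _ = \esum_(a in range g) u a x).
  rewrite setTI esum_mkcond [leRHS]esum_mkcond; apply: le_esum => a _.
  case: ifPn => [|_]; last by case: ifP.
  rewrite inE => /= af; case: ifPn => // ag.
  (* Of the atoms left, one not vanishing at [x] would sit on the cube of [x] of its generation,
     which is an [f l] or a [g l] according to the sign. *)
  have [_ _ -> //] := au a => /dyadic_cubeP aE.
  move: af ag; rewrite notin_setE; case: a aE => [[l|l] k] /= -> af ag.
    by apply: af; exists l.
  by case: ag; exists l.+1.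
rewrite esum_image//; apply: eq_esum => l _.
by rewrite ancestor_location sub0r.
Qed.

(** The claim is local, so a unit cube [B] is fixed. Atoms on descendants of [B] are summed in L^1,
    where [small_cubes] gives geometric decay; atoms on ancestors are summed in the mixed norm. *)
Lemma decomp_norm_lty_ae (F : E -> \bar R) : decomp_norm q s rho F < +oo ->
  {ae leb, forall x, F x < +oo}.
Proof.
move=> /decomp_norm_lt[u [au uF ufin]].
have u0 a x : 0 <= u a x by have [] := au a.
have mu a : measurable_fun [set: E] (u a) by have [] := au a.
have c0 a : 0 <= coef q s a (u a) by exact: coef_ge0.
pose c a := coef q s a (u a).
have c_le a : c a <= atoms_norm q s rho u by exact: (@le_ell_norm_coef _ _ _ _ c).
suff : {ae leb, forall x (k0 : n.-tuple int), dyadic_cube 0 k0 x ->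
    \esum_(a in setT) u a x < +oo}.
  move=> H; apply: filterS2 uF H => x uF H; apply: le_lt_trans uF _.
  exact: (H (location 0 x) (dyadic_cube_location 0 x)).
apply: ae_forall_count => k0; pose B : I := ((0%R : int), k0).
pose G1 x := \esum_(l in [set: nat]) \sum_d u (@child n l B d) x.
pose G2 x := \esum_(l in [set: nat]) u (ancestor l B) x.
have sum0 l x : 0 <= \sum_d u (@child n l B d) x by apply: sume_ge0.
have msum l : measurable_fun [set: E] (fun x => \sum_d u (@child n l B d) x).
  by apply: emeasurable_sum.
have mG1 : measurable_fun [set: E] G1 by exact: measurable_esum.
have mG2 : measurable_fun [set: E] G2 by exact: measurable_esum.
have G1_fin : {ae leb, forall x, G1 x < +oo}.
  apply: integral_lty_ae => // [x|]; first exact: esum_ge0.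
  rewrite integral_esum//.
  (* The gain [n/t] on small cubes minus the loss [n/r] for counting them. *)
  pose delta := (n%:R - harmonic_sum q - s - n%:R * (1 - rho^-1))%R.
  apply: (@le_lt_trans _ _ (\esum_(l in [set: nat])
      ((fine (atoms_norm q s rho u))%:E * ((2 `^ (- delta)) ^+ l)%:E))).
    apply: le_esum => l _; rewrite ge0_integral_sum//.
    apply: (@le_trans _ _ (\sum_d ((2 `^ (- (n%:R - harmonic_sum q - s))) ^+ l)%:E *
        c (@child n l B d))).
      apply: lee_sum => d _; apply: le_trans (integral_atom_le _ au) _.
      by rewrite /= add0r side_powR.
    rewrite -ge0_sume_distrr; last by move=> d _; exact: c0.
    have := ell_norm_children l rho_ge1 c0; set X := (_%:E * _) => cX.
    apply: (@le_trans _ _ (((2 `^ (- (n%:R - harmonic_sum q - s))) ^+ l)%:E * X)).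
      rewrite lee_wpmul2l ?lee_fin ?exprn_ge0 ?powR_ge0//; apply: le_trans cX.
      (* Of the l^rho norm over all cubes only the term of [B] is kept. *)
      apply: (@le_ell_norm_coef _ _ rho_ge1 _ (fun b => \sum_d c (@child n l b d)) B) => b.
      by apply: sume_ge0 => d _; exact: c0.
    rewrite /X muleA -EFinM [leRHS]muleC fineK; last first.
      by rewrite ge0_fin_numE// ell_norm_ge0.
    rewrite le_eqVlt; apply/orP; left; apply/eqP; congr (_%:E * _).
    rewrite (_ : (l * n)%:R * _ = (n%:R * (1 - rho^-1)) * l%:R)%R; last first.
      by rewrite natrM -mulrA mulrC.
    rewrite powRrM powR_mulrn ?powR_ge0// -exprMn -powRD; last first.
      by apply/implyP => _; rewrite pnatr_eq0.
    by congr ((_ `^ _) ^+ _)%R; rewrite /delta [RHS]opprB [RHS]addrC.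
  have := @esumZl R nat (fine (atoms_norm q s rho u))
    (fun l => ((2 `^ (- delta)) ^+ l)%:E).
  rewrite fine_ge0 ?ell_norm_ge0// => -> //.
  apply: lte_mul_pinfty; [by rewrite lee_fin fine_ge0// ell_norm_ge0|by []|].
  by apply: esum_geometric_lty; apply: powR2_lt1; rewrite subr_gt0.
have G2_fin : {ae leb, forall x, G2 x < +oo}.
  have : mixed_norm q G2 < +oo.
    apply: le_lt_trans (mixed_norm_esum_le q_ge1 _ _) _ => //.
    have -> : \esum_(l in [set: nat]) mixed_norm q (u (ancestor l B)) =
        \esum_(l in [set: nat]) ((2 `^ (- s)) ^+ l)%:E * c (ancestor l B).
      apply: eq_esum => l _; rewrite /c /coef muleA -EFinM /= sub0r.
      rewrite -side_opp_powR -powRD; last first.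
        by apply/implyP => _; rewrite gt_eqF// side_gt0.
      by rewrite addNr powRr0 mul1e.
    (* Ancestors: their sides grow, so [s > 0] gives geometric decay; for
       [s = 0] the coefficients are summable because [rho = 1]. *)
    have [s_eq0|s_neq0] := eqVneq s 0%R.
      apply: (@le_lt_trans _ _ (\esum_(a in setT) c a)).
        pose h (l : nat) := ancestor l B.
        have hinj : set_inj [set: nat] h by move=> l l' _ _ [/addrI/oppr_inj[]].
        apply: (@le_trans _ _ (\esum_(a in range h) c a)).
          rewrite esum_image//; apply: le_esum => l _.
          by rewrite s_eq0 oppr0 powRr0 expr1n mul1e.
        rewrite [leLHS]esum_mkcond; apply: le_esum => a _.
        by case: ifPn => // _; exact: c0.
      move: ufin; rewrite /atoms_norm ell_norm_ltyP// s0_rho1//.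
      by under eq_esum => a _ do rewrite poweRe1//.
    apply: (@le_lt_trans _ _ (\esum_(l in [set: nat])
        ((fine (atoms_norm q s rho u))%:E * ((2 `^ (- s)) ^+ l)%:E))).
      apply: le_esum => l _; rewrite muleC fineK; last first.
        by rewrite ge0_fin_numE// ell_norm_ge0.
      by rewrite lee_wpmul2r// lee_fin exprn_ge0// powR_ge0.
    have := @esumZl R nat (fine (atoms_norm q s rho u))
      (fun l => ((2 `^ (- s)) ^+ l)%:E).
    rewrite fine_ge0 ?ell_norm_ge0// => -> //.
    apply: lte_mul_pinfty; [by rewrite lee_fin fine_ge0// ell_norm_ge0|by []|].
    by apply: esum_geometric_lty; apply: powR2_lt1; rewrite lt0r s_neq0.
  have G20 x : 0 <= G2 x by exact: esum_ge0.
  move=> /(mixed_norm_lty_ae q_ge1 mG2 G20); apply: filterS => x.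
  by rewrite ge0_fin_numE.
apply: filterS2 G1_fin G2_fin => x G1x G2x Bx.
apply: le_lt_trans (esum_atoms_le au Bx) _.
exact: lte_add_pinfty.
Qed.

End almost_everywhere_finite.

(** * Integral bounds without measurability *)

Section integral_bounds.
Local Open Scope ereal_scope.
Context d (T : measurableType d) (R : realType).
Variable mu : {measure set T -> \bar R}.

(** The integral of a nonnegative function is a supremum over simple functions below it, hence
    monotone for arbitrary functions. It is meant for integrands that contain the kernel, whose
    measurability is not among the data. *)
Lemma ge0_le_integral_nomeas (f g : T -> \bar R) :
  (forall x, 0 <= f x <= g x) -> \int[mu]_x f x <= \int[mu]_x g x.
Proof.
move=> fg.
rewrite !ge0_integralTE; last 2 first.
- by move=> x; have /andP[/le_trans] := fg x; apply.
- by move=> x; have /andP[] := fg x.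
apply: ge_ereal_sup => _ [h /= hf <-]; apply: ereal_sup_ubound; exists h => // x.
by apply: le_trans (hf x) _; have /andP[] := fg x.
Qed.

(** The integrals of the positive and of the negative part both lie between 0 and [M], so their
    difference is at most [M] in absolute value. *)
Lemma Rintegral_abs_le (g : T -> R) (h : T -> R) (M : R) :
  (forall x, `|g x| <= h x)%R -> \int[mu]_x (h x)%:E <= M%:E ->
  (`|\int[mu]_x g x| <= M)%R.
Proof.
move=> gh hM; rewrite /Rintegral integralE.
have pos_le (k : T -> \bar R) : (forall x, 0 <= k x <= (h x)%:E) ->
    0 <= \int[mu]_x k x <= M%:E.
  move=> kh; apply/andP; split; first by apply: integral_ge0 => x _; have /andP[] := kh x.
  exact: le_trans (ge0_le_integral_nomeas kh) hM.
have absE x : (EFin \o g)^\+ x + (EFin \o g)^\- x = `|g x|%:E.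
  by rewrite -[RHS]/((abse \o (EFin \o g)) x) fune_abse.
have /pos_le /andP[p0 pM] : forall x, 0 <= (EFin \o g)^\+ x <= (h x)%:E.
  move=> x; rewrite funepos_ge0/= (@le_trans _ _ `|g x|%:E) ?lee_fin//.
  by rewrite -absE leeDl// funeneg_ge0.
have /pos_le /andP[n0 nM] : forall x, 0 <= (EFin \o g)^\- x <= (h x)%:E.
  move=> x; rewrite funeneg_ge0/= (@le_trans _ _ `|g x|%:E) ?lee_fin//.
  by rewrite -absE leeDr// funepos_ge0.
move: p0 pM n0 nM.
case: (\int[mu]_x (EFin \o g)^\+ x) => [a| |] //.
case: (\int[mu]_x (EFin \o g)^\- x) => [b| |] //.
rewrite !lee_fin /= => a0 aM b0 bM; rewrite ler_norml; apply/andP; split; lra.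
Qed.

End integral_bounds.

(** * Supports and separation *)

Section supports.
Variables (R : realType) (n : nat).
Local Notation E := (n.-tuple R).
Implicit Types f : E -> R[i].

Lemma row_support_sub f (A : set 'rV[R]_n) : closed A ->
  (forall x, f x != 0 -> A (to_row x)) -> row_support f `<=` A.
Proof.
move=> cA fA; rewrite /row_support.
by rewrite closureE; apply: smallest_sub => // _ [x fx <-]; exact: fA.
Qed.

Lemma compact_support_bounded f (M : R) :
  (forall x, f x != 0 -> forall i, `|tnth x i| <= M) -> compact_support f.
Proof.
move=> fM; pose A : set 'rV[R]_n := [set v | forall i, `[- M, M]%classic (v ord0 i)].
have cA : compact A.
  by apply: (@rV_compact _ _ (fun=> `[- M, M]%classic)) => i; exact: segment_compact.
apply: (subclosed_compact _ cA); first exact: closed_closure.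
apply: row_support_sub; first by apply: compact_closed => //; exact: norm_hausdorff.
by move=> x /fM fx i; rewrite /= mxE in_itv/= -ler_norml.
Qed.

(** Separation from [x] in one coordinate is a closed condition, so it passes from the points where
    [f] is nonzero to their closure; [x] itself violates it. *)
Lemma notin_row_support f (x : E) (i : 'I_n) (c : R) : 0 < c ->
  (forall y, f y != 0 -> c <= `|tnth x i - tnth y i|) -> ~ row_support f (to_row x).
Proof.
move=> c0 fc.
have cA : closed [set v : 'rV[R]_n | c <= `|tnth x i - v ord0 i| ].
  apply: (@closed_comp _ _ (fun v : 'rV[R]_n => `|tnth x i - v ord0 i|) [set r | c <= r]).
    move=> v _; have cv : (fun w : 'rV[R]_n => w ord0 i) w @[w --> v] --> v ord0 i.
      exact: (@coord_continuous R 1 n ord0 i v).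
    have : (fun w : 'rV[R]_n => tnth x i - w ord0 i) w @[w --> v] --> tnth x i - v ord0 i.
      exact: (cvgB (cvg_cst (tnth x i)) cv).
    by move=> /cvg_norm; rewrite /continuous_at; apply.
  exact: closed_ge.
move=> /(row_support_sub cA) /= H.
have : c <= `|tnth x i - to_row x ord0 i|.
  by apply: H => y fy; rewrite mxE; exact: fc.
by rewrite mxE subrr normr0 leNgt c0.
Qed.

Lemma eucl_dist_ge (x y : E) (i : 'I_n) : `|tnth x i - tnth y i| <= eucl_dist x y.
Proof.
rewrite -sqrtr_sqr ler_wsqrtr// (bigD1 i)//= lerDl sumr_ge0// => j _.
exact: sqr_ge0.
Qed.

End supports.

(** * Points near to and far from a cube *)

Section far_points.
Variables (R : realType) (n : nat).
Local Notation E := (n.-tuple R).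
Local Notation I := (int * n.-tuple int)%type.

(* The entries 0, 1, 2 of [e] stand for the translations by -1, 0, 1. *)
Definition near_cube (l : nat) (a : I) : set E :=
  [set x | exists e, dyadic_cube (translate e (ancestor l a)).1 (translate e (ancestor l a)).2 x].

Lemma near_cubeP l (a : I) (x : E) :
  (forall i, `|tnth (location (a.1 - l%:Z) x) i - tnth (ancestor l a).2 i| <= 1) ->
  near_cube l a x.
Proof.
move=> H; set k := location _ x in H.
pose m i : int := tnth k i - tnth (ancestor l a).2 i + 1.
have m3 i : (`|m i|%N < 3)%N /\ m i = `|m i|%N%:Z.
  have := H i; rewrite /m; set z := _ - _; lia.
pose e := [tuple Ordinal (m3 i).1 | i < n]; exists e.
apply/dyadic_cubeP => /=; rewrite -/k; apply: eq_from_tnth => i.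
rewrite tnth_mktuple (_ : (tnth e i : nat)%:Z = m i); last first.
  by rewrite [RHS](m3 i).2 /e tnth_mktuple.
by rewrite /m addrK addrC subrK.
Qed.

(** Some coordinate index of [x] differs by at least 2 from that of the ancestor, so a full ancestor
    side separates [x] from the cube in that coordinate. *)
Lemma far_cube_coord l (a : I) (x : E) : ~ near_cube l a x ->
  exists i, forall y, dyadic_cube a.1 a.2 y ->
    side R (a.1 - l%:Z) <= `|tnth x i - tnth y i|.
Proof.
move=> far; apply: contrapT => nfar; apply: far; apply: near_cubeP => i.
rewrite leNgt; apply/negP => gt1; apply: nfar; exists i => y /dyadic_cubeP ay.
set s := side R _; have s0 : 0 < s by exact: side_gt0.
have ya : tnth (ancestor l a).2 i = Num.floor (tnth y i / s).
  by rewrite (surjective_pairing a) ay ancestor_location tnth_mktuple.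
move: gt1; rewrite ya tnth_mktuple -/s.
set u := tnth x i / s; set v := tnth y i / s => gt1.
have -> : tnth x i - tnth y i = (u - v) * s by rewrite mulrBl !divfK ?gt_eqF.
rewrite normrM (gtr0_norm s0) -[leLHS]mul1r ler_pM2r//.
have /andP[u1 u2] := floor_itv u; have /andP[v1 v2] := floor_itv v.
move: u1 u2 v1 v2 gt1; set U := Num.floor u; set V := Num.floor v.
rewrite !intrD => u1 u2 v1 v2 UV.
have [UV2|VU2] : (V + 2 <= U) \/ (U + 2 <= V) by lia.
- have : (V + 2)%:~R <= U%:~R :> R by rewrite ler_int.
  by rewrite intrD ler_normr => ?; apply/orP; left; lra.
- have : (U + 2)%:~R <= V%:~R :> R by rewrite ler_int.
  by rewrite intrD ler_normr => ?; apply/orP; right; lra.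
Qed.

(** Ancestors alone never leave their orthant; together with their neighbours they exhaust R^n. The
    [l] chosen makes the ancestor side at least every coordinate distance from [x] to the corner [y]
    of the cube. *)
Lemma near_cube_exists (a : I) (x : E) : exists l, near_cube l a x.
Proof.
pose y : E := [tuple side R a.1 * (tnth a.2 i)%:~R | i < n].
have ay : dyadic_cube a.1 a.2 y.
  rewrite dyadic_cubeE => i; rewrite /cube_itv /= in_itv/= tnth_mktuple lexx/=.
  by rewrite ltr_pM2l ?side_gt0// ltrDl.
pose M := \sum_(i < n) `|tnth x i - tnth y i| / side R a.1.
have [l Ml] : exists l : nat, M <= 2 ^+ l.
  exists (Num.truncn M).+1.
  have M0 : 0 <= M by apply: sumr_ge0 => i _; rewrite divr_ge0// ltW// side_gt0.
  rewrite ltW//; apply: lt_le_trans (truncnS_gt _) _.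
  by rewrite -natrX ler_nat ltnW// ltn_expl.
exists l; apply: near_cubeP => i.
set s := side R (a.1 - l%:Z); have s0 : 0 < s by exact: side_gt0.
have ya : tnth (ancestor l a).2 i = Num.floor (tnth y i / s).
  move/dyadic_cubeP : ay => ay.
  by rewrite (surjective_pairing a) ay ancestor_location tnth_mktuple.
rewrite ya tnth_mktuple -/s; set u := tnth x i / s; set v := tnth y i / s.
have uv : `|u - v| <= 1.
  have si : `|s^-1| = s^-1 by rewrite gtr0_norm ?invr_gt0.
  rewrite -mulrBl normrM si ler_pdivrMr// mul1r.
  rewrite /s sideD side_nat mulrC -ler_pdivrMr ?side_gt0//; apply: le_trans Ml.
  rewrite /M (bigD1 i)//= lerDl sumr_ge0// => j _.
  by rewrite divr_ge0// ltW// side_gt0.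
have /andP[u1 u2] := floor_itv u; have /andP[v1 v2] := floor_itv v.
move: u1 u2 v1 v2; set U := Num.floor u; set V := Num.floor v.
rewrite !intrD => u1 u2 v1 v2; move: uv; rewrite ler_norml => /andP[uv1 uv2].
have UV : U < V + 2 by rewrite -(ltr_int R) intrD; lra.
have VU : V < U + 2 by rewrite -(ltr_int R) intrD; lra.
lia.
Qed.

End far_points.

(** * The operator on functions supported in a cube *)

Section operator_bounds.
Variables (R : realType) (n : nat) (q : n.-tuple R).
Local Notation E := (n.-tuple R).
Local Notation C := (R[i]).
Local Notation I := (int * n.-tuple int)%type.
Hypothesis q_gt1 : forall i, 1 < tnth q i.

Let q_ge1 : exponents_ge1 q. Proof. by move=> i; exact: ltW. Qed.

Lemma mixed_normD_le (F G : E -> \bar R) : measurable_fun [set: E] F ->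
  measurable_fun [set: E] G -> (forall x, 0 <= F x)%E -> (forall x, 0 <= G x)%E ->
  (mixed_norm q (fun x => F x + G x) <= mixed_norm q F + mixed_norm q G)%E.
Proof.
move=> mF mG F0 G0.
have := @mixed_norm_esum_le R n q bool (fun b => if b then F else G) q_ge1.
rewrite esum_finType; last by case; exact: mixed_norm_ge0.
rewrite big_bool /= => H; apply: le_trans (H _ _); [|by case|by case].
rewrite le_eqVlt; apply/orP; left; apply/eqP; congr mixed_norm; apply/funext => x.
by rewrite esum_finType ?big_bool//; case.
Qed.

Lemma Lmixed_scaleD (a : C) (f g : E -> C) : Lmixed q f -> Lmixed q g ->
  Lmixed q (fun x => a * f x + g x).
Proof.
move=> [mf fq] [mg gq]; split; first exact: cmeasurable_scaleD.
have mcf := cmeasurable_cmod mf; have mcg := cmeasurable_cmod mg.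
apply: (@le_lt_trans _ _ (mixed_norm q (fun x => (normc a)%:E * cmod f x + cmod g x)%E)).
  apply: le_mixed_norm => //.
  - by apply: cmeasurable_cmod; exact: cmeasurable_scaleD.
  - by apply: emeasurable_funD => //; exact: measurable_funeM.
  - by move=> x; exact: cmod_ge0.
  - by move=> x; rewrite lee_fin (le_trans (normc_leD _ _))// normcM.
apply: le_lt_trans (mixed_normD_le _ mcg _ _) _.
- exact: measurable_funeM.
- by move=> x; rewrite mule_ge0 ?cmod_ge0// lee_fin normc_ge0.
- by move=> x; exact: cmod_ge0.
rewrite mixed_norm_scale ?normc_ge0//; apply: lte_add_pinfty => //.
by rewrite lte_mul_pinfty ?lee_fin ?normc_ge0.
Qed.

Lemma LmixedB (f g : E -> C) : Lmixed q f -> Lmixed q g ->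
  Lmixed q (fun x => f x - g x).
Proof.
move=> Lf Lg; rewrite (_ : (fun x => _) = (fun x => (-1) * g x + f x)).
  exact: Lmixed_scaleD.
by apply/funext => x; rewrite mulN1r addrC.
Qed.

Lemma Lmixed_dominated (f g : E -> C) : Lmixed q f -> cmeasurable g ->
  (forall x, normc (g x) <= normc (f x)) -> Lmixed q g.
Proof.
move=> [mf fq] mg gf; split => //; apply: le_lt_trans fq.
by apply: le_mixed_norm => //; [exact: cmeasurable_cmod|exact: cmeasurable_cmod|
  move=> x; exact: cmod_ge0].
Qed.

Lemma L2_bounded_on_cube (f : E -> C) (M : R) (a : I) : cmeasurable f ->
  (forall x, normc (f x) <= M) -> (forall x, ~ dyadic_cube a.1 a.2 x -> f x = 0) ->
  L2 f.
Proof.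
move=> mf fM fQ; split => //.
have mQ := @measurable_dyadic_cube R n a.1 a.2.
have mI : measurable_fun [set: E] (fun x => (\1_(dyadic_cube a.1 a.2) x)%:E : \bar R).
  exact: measurable_EFin_indic.
have M0 : 0 <= M by apply: le_trans (fM [tuple of nseq n 0]); exact: normc_ge0.
apply: (@le_lt_trans _ _ ('N[leb]_2%:E[(fun x => M%:E * (\1_(dyadic_cube a.1 a.2) x)%:E)%E])%E).
  apply: le_Lnorm_ae => //.
  - by rewrite ler1n.
  - exact: cmeasurable_cmod.
  - exact: measurable_funeM.
  - by move=> x; exact: cmod_ge0.
  - by move=> x; rewrite mule_ge0// lee_fin.
  apply: aeW => x; rewrite indicE; have [_|] := boolP (x \in _).
    by rewrite mule1 lee_fin.
  by rewrite notin_setE => /fQ fx; rewrite mule0 /cmod fx normc0.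
rewrite Lnorm_scale//; last by rewrite ler1n.
rewrite Lnorm_indic// [X in (X `^ _)%E](@leb_dyadic_cube R n a.1 a.2).
by rewrite poweR_EFin -EFinM ltry.
Qed.

(** All points of the cube are at least one ancestor side away from [x]. The factor 2 comes from
    integrating real and imaginary parts separately. *)
Lemma kernel_integral_le (K : E -> E -> C) (c M : R) (f : E -> C) (a : I) l x :
  0 < c -> (forall x y, x != y -> normc (K x y) <= c * eucl_dist x y ^- n) ->
  cmeasurable f -> (forall y, ~ dyadic_cube a.1 a.2 y -> f y = 0) ->
  ~ near_cube l a x -> (\int[leb]_y cmod f y <= M%:E)%E ->
  normc (cintegral (fun y => K x y * f y)) <=
    2 * (c * side R (a.1 - l%:Z) ^- n) * M.
Proof.
move=> c0 Kc mf fQ /far_cube_coord[i far] fM.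
set s := side R _ in far *; have s0 : 0 < s by exact: side_gt0.
have B0 : 0 <= c * s ^- n by rewrite mulr_ge0 ?(ltW c0)// invr_ge0 exprn_ge0// ltW.
have Kf y : normc (K x y * f y) <= c * s ^- n * normc (f y).
  have [Qy|Qy] := pselect (dyadic_cube a.1 a.2 y); last by rewrite fQ// mulr0 normc0 mulr0.
  have sd : s <= eucl_dist x y by exact: le_trans (far y Qy) (eucl_dist_ge x y i).
  have xy : x != y.
    apply/eqP => xy; have := far y Qy.
    by rewrite xy subrr normr0 leNgt s0.
  rewrite normcM ler_wpM2r ?normc_ge0//; apply: le_trans (Kc x y xy) _.
  rewrite ler_pM2l// lef_pV2 ?posrE ?exprn_gt0//; last exact: lt_le_trans sd.
  by rewrite lerXn2r// nnegrE ?ltW// (lt_le_trans s0).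
have intle : (\int[leb]_y (c * s ^- n * normc (f y))%:E <= (c * s ^- n * M)%:E)%E.
  under eq_integral do rewrite EFinM.
  rewrite ge0_integralZl_EFin//; last 2 first.
  - by move=> y _; rewrite lee_fin normc_ge0.
  - exact: cmeasurable_cmod.
  by rewrite (EFinM (c * s ^- n) M) lee_wpmul2l// lee_fin.
apply: le_trans (normc_le_ReIm _) _; rewrite /cintegral /=.
rewrite -mulrA mulr_natl mulr2n; apply: lerD.
  by apply: Rintegral_abs_le intle => y; exact: le_trans (normc_Re _) (Kf y).
by apply: Rintegral_abs_le intle => y; exact: le_trans (normc_Im _) (Kf y).
Qed.

Lemma measurable_near_cube l (a : I) : measurable (near_cube l a : set E).
Proof.
rewrite (_ : near_cube l a = \bigcup_(e in [set: n.-tuple 'I_3])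
    dyadic_cube (translate e (ancestor l a)).1 (translate e (ancestor l a)).2).
  apply: fin_bigcup_measurable; first exact: finite_finset.
  by move=> e _; exact: measurable_dyadic_cube.
by apply/seteqP; split => x [e]; [exists e|move=> _; exists e].
Qed.

Variables (T Tp : (E -> C) -> (E -> C)).
Hypothesis Tp_ext : Lmixed_extension q T Tp.

Lemma Tp_Lmixed f : Lmixed q f -> Lmixed q (Tp f).
Proof. by have [[+ _ _] _] := Tp_ext; exact. Qed.

Lemma Tp_sub f g : Lmixed q f -> Lmixed q g ->
  {ae leb, forall x, Tp (fun x => f x - g x) x = Tp f x - Tp g x}.
Proof.
move=> Lf Lg; have [[_ lin _] _] := Tp_ext.
have := lin (-1) g f Lg Lf.
rewrite (_ : (fun x => _) = (fun x => f x - g x)); last first.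
  by apply/funext => x; rewrite mulN1r addrC.
by apply: filterS => x ->; rewrite mulN1r addrC.
Qed.

(** This is how pointwise estimates reach [Tp f] when they are known only for functions close to [f]
    in the mixed norm; it serves for truncations and for partial sums of portions. *)
Lemma Tp_limit_le (f : E -> C) (A : set E) (H : E -> \bar R) : Lmixed q f ->
  measurable A -> measurable_fun [set: E] H -> (forall x, 0 <= H x)%E ->
  (forall e : R, 0 < e -> exists f', [/\ Lmixed q f',
      (mixed_norm q (cmod (fun x => f x - f' x)%R) <= e%:E)%E &
      {ae leb, forall x, A x -> (cmod (Tp f') x <= H x)%E}]) ->
  {ae leb, forall x, A x -> (cmod (Tp f) x <= H x)%E}.
Proof.
move=> Lf mA mH H0 approx.
have [[_ _ [c c0 Tpc]] _] := Tp_ext.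
have [mTf Tfq] := Tp_Lmixed Lf; have mcTf := cmeasurable_cmod mTf.
(* The excess of [Tp f] over [H] is at most [Tp (f - f')], whose norm is
   arbitrarily small. *)
pose D x := ((\1_A x)%:E * maxe 0 (cmod (Tp f) x - H x))%E.
have D0 x : (0 <= D x)%E by rewrite mule_ge0 ?lee_fin// le_max lexx.
have mD : measurable_fun [set: E] D.
  apply: emeasurable_funM; first exact: measurable_EFin_indic.
  by apply: measurable_maxe => //; exact: emeasurable_funB.
have ND0 : mixed_norm q D = 0%E.
  apply/eqP; rewrite eq_le mixed_norm_ge0// andbT.
  apply/lee_addgt0Pr => e e0; rewrite add0e.
  have [|f' [Lf' ff' Tf']] := approx (e / c); first exact: divr_gt0.
  have Lff' := LmixedB Lf Lf'; have [mTff' _] := Tp_Lmixed Lff'.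
  apply: (@le_trans _ _ (mixed_norm q (cmod (Tp (fun x => f x - f' x))))).
    apply: le_mixed_norm_ae => //; first exact: cmeasurable_cmod.
      by move=> x; exact: cmod_ge0.
    apply: filterS2 Tf' (Tp_sub Lf Lf') => x Tf'H Tsub.
    rewrite /D indicE; have [|_] := boolP (x \in A); last by rewrite mul0e cmod_ge0.
    rewrite inE => /Tf'H {}Tf'H; rewrite mul1e ge_max cmod_ge0/=.
    rewrite /cmod Tsub; apply: (@le_trans _ _ (cmod (Tp f) x - cmod (Tp f') x)%E).
      exact: leeB.
    rewrite lee_fin lerBlDr -{1}[Tp f x](subrK (Tp f' x)).
    exact: normc_leD.
  apply: le_trans (Tpc _ Lff') _.
  apply: (@le_trans _ _ (c%:E * (e / c)%:E)%E).
    by rewrite lee_wpmul2l// lee_fin ltW.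
  by rewrite -EFinM mulrC divfK// gt_eqF.
have := mixed_norm_eq0_ae q_ge1 mD D0 ND0.
apply: filterS => x; rewrite /D indicE => + Ax; rewrite mem_set// mul1e => D_eq0.
have : (cmod (Tp f) x - H x <= 0)%E by rewrite -D_eq0 le_max lexx orbT.
by case: (H x) (H0 x) => [h| |]//= _; rewrite ?leey// /cmod -EFinB !lee_fin subr_le0.
Qed.

End operator_bounds.

Lemma dyadic_cube_bounded (R : realType) n (a : int * n.-tuple int) :
  exists M : R, forall x, dyadic_cube a.1 a.2 x -> forall i, `|tnth x i| <= M.
Proof.
exists (\sum_(i < n) side R a.1 * (`|(tnth a.2 i)%:~R| + 1)) => x Qx i.
have s0 := side_gt0 R a.1.
rewrite (bigD1 i)//=; apply: (@le_trans _ _ (side R a.1 * (`|(tnth a.2 i)%:~R| + 1))).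
  move: Qx; rewrite dyadic_cubeE => /(_ i); rewrite /cube_itv/= in_itv/= => /andP[x1 x2].
  rewrite -ler_pdivrMl// -[_^-1]gtr0_norm ?invr_gt0// -normrM ler_norml.
  rewrite ler_pdivlMl ?ler_pdivrMl//.
  apply/andP; split.
    apply: le_trans x1; rewrite ler_pM2l//.
    by have := ler_norm (- (tnth a.2 i)%:~R : R); rewrite normrN; lra.
  by apply: (le_trans (ltW x2)); rewrite ler_pM2l// lerD2r ler_norm.
rewrite lerDl sumr_ge0// => j _; apply: mulr_ge0; first exact: ltW.
by rewrite addr_ge0.
Qed.

Section operator_on_atoms.
Variables (R : realType) (n : nat) (q : n.-tuple R).
Local Notation E := (n.-tuple R).
Local Notation C := (R[i]).
Local Notation I := (int * n.-tuple int)%type.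
Hypothesis q_gt1 : forall i, 1 < tnth q i.

Let q_ge1 : exponents_ge1 q. Proof. by move=> i; exact: ltW. Qed.

Variables (T Tp : (E -> C) -> (E -> C)).
Hypothesis T_sio : singular_integral_operator T.
Hypothesis Tp_ext : Lmixed_extension q T Tp.

Lemma integral_cmod_le (f : E -> C) (a : I) : cmeasurable f ->
  (forall x, ~ dyadic_cube a.1 a.2 x -> f x = 0) ->
  (\int[leb]_x cmod f x <=
    (side R a.1 `^ (n%:R - harmonic_sum q))%:E * mixed_norm q (cmod f))%E.
Proof.
move=> mf fQ; apply: integral_le_mixed_norm => //.
- exact: cmeasurable_cmod.
- by move=> x; exact: cmod_ge0.
- by move=> x /fQ fx; rewrite /cmod fx normc0.
Qed.

Lemma integral_cmod_lty (f : E -> C) (a : I) : Lmixed q f ->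
  (forall x, ~ dyadic_cube a.1 a.2 x -> f x = 0) ->
  (\int[leb]_x cmod f x < +oo)%E.
Proof.
move=> [mf fq] fQ; apply: le_lt_trans (integral_cmod_le mf fQ) _.
by rewrite lte_mul_pinfty// lee_fin powR_ge0.
Qed.

(** Multiplication by an indicator, rather than a conditional, makes measurability an instance of
    [cmeasurable_real_mul]. *)
Definition truncate (f : E -> C) (m : nat) : E -> C :=
  fun x => (\1_[set x | normc (f x) <= m%:R] x)%:C%C * f x.

Lemma truncateE f m x : truncate f m x = if normc (f x) <= m%:R then f x else 0.
Proof.
rewrite /truncate indicE; case: ifPn => fm.
  by rewrite mem_set// mul1r.
by rewrite memNset ?mul0r//; exact/negP.
Qed.

Lemma cmeasurable_truncate f m : cmeasurable f -> cmeasurable (truncate f m).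
Proof.
move=> mf; apply: cmeasurable_real_mul => //; apply: measurable_indic.
rewrite -[X in measurable X]setTI.
exact: (cmeasurable_normc mf measurableT (measurable_itv `]-oo, m%:R])).
Qed.

Lemma truncate_cvg f : Lmixed q f ->
  (fun m => mixed_norm q (cmod (fun x => f x - truncate f m x))) @ \oo --> 0%E.
Proof.
move=> [mf fq]; apply: (mixed_norm_dominated_cvg0 q_ge1 (f := cmod f)) => //.
- by move=> m; exact: cmeasurable_cmod (cmeasurableB mf (cmeasurable_truncate m mf)).
- exact: cmeasurable_cmod.
- move=> m x; rewrite cmod_ge0/= lee_fin truncateE.
  by case: ifP => _; [rewrite subrr normc0 normc_ge0|rewrite subr0 lexx].
apply: aeW => x; apply/cvg0P => [m|e e0]; first exact: cmod_ge0.
near=> m; rewrite /cmod truncateE (_ : normc (f x) <= m%:R).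
  by rewrite subrr normc0 lee_fin ltW.
by near: m; exact: nbhs_infty_ger.
Unshelve. all: by end_near. Qed.

(** The kernel formula is available for bounded functions of compact support, so it is applied to
    truncations of [f]. The resulting bound involves only the integral of [cmod f] and therefore
    survives the limit. *)
Lemma far_bound : exists2 cK : R, 0 < cK &
  forall (f : E -> C) (a : I) l, Lmixed q f ->
    (forall x, ~ dyadic_cube a.1 a.2 x -> f x = 0) ->
    {ae leb, forall x, ~ near_cube l a x -> (cmod (Tp f) x <=
      (2 * (cK * side R (a.1 - l%:Z) ^- n))%:E * \int[leb]_x cmod f x)%E}.
Proof.
have [_ [K [eps [cK [_ cK0 Kle _]]] Kint]] := T_sio.
have [_ TpT] := Tp_ext.
exists cK => // f a l Lf fQ; have [mf fq] := Lf.
have intfin := integral_cmod_lty Lf fQ.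
have int0 : (0 <= \int[leb]_x cmod f x)%E by apply: integral_ge0 => x _; exact: cmod_ge0.
pose A : set E := ~` near_cube l a.
apply: (Tp_limit_le q_gt1 Tp_ext (A := A) Lf).
- by apply: measurableC; exact: measurable_near_cube.
- exact: measurable_cst.
- move=> x; rewrite mule_ge0// lee_fin mulr_ge0// mulr_ge0 ?(ltW cK0)//.
  by rewrite invr_ge0 exprn_ge0// ltW// side_gt0.
move=> e e0.
have ge0 m : (0 <= mixed_norm q (cmod (fun x => (f x - truncate f m x)%R)))%E.
  by apply: mixed_norm_ge0 => x; exact: cmod_ge0.
have [m _ /(_ m (leqnn m)) /= fm] := iffLR (cvg0P ge0) (truncate_cvg Lf) e e0.
have mfm := cmeasurable_truncate m mf.
have fmf x : normc (truncate f m x) <= normc (f x).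
  by rewrite truncateE; case: ifP => // _; rewrite normc0 normc_ge0.
have fmM x : normc (truncate f m x) <= m%:R.
  by rewrite truncateE; case: ifP => // _; rewrite normc0.
have fmQ x : ~ dyadic_cube a.1 a.2 x -> truncate f m x = 0.
  by move=> /fQ fx; rewrite truncateE fx; case: ifP.
have Lfm : Lmixed q (truncate f m) by exact: Lmixed_dominated Lf mfm fmf.
have L2fm : L2 (truncate f m) by exact: L2_bounded_on_cube mfm fmM fmQ.
have cfm : compact_support (truncate f m).
  have [M QM] := dyadic_cube_bounded R a.
  apply: (@compact_support_bounded _ _ _ M) => x fx; apply: QM.
  by apply: contrapT => /fmQ fx0; rewrite fx0 eqxx in fx.
exists (truncate f m); split => //.
have := Kint _ mfm (ex_intro _ _ fmM) cfm.
have := TpT _ L2fm Lfm.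
apply: filterS2 => x TpTx Tx Ax.
have [i far] := far_cube_coord Ax.
rewrite /cmod TpTx Tx; last first.
  apply: (notin_row_support (side_gt0 R (a.1 - l%:Z)) (i := i)) => y fy.
  by apply: far; apply: contrapT => /fmQ fy0; rewrite fy0 eqxx in fy.
rewrite -(@fineK _ (\int[leb]_x cmod f x)%E) ?ge0_fin_numE// -EFinM lee_fin.
apply: (kernel_integral_le cK0 Kle mfm fmQ Ax).
rewrite fineK ?ge0_fin_numE//; apply: ge0_le_integral => //.
- by move=> y _; exact: cmod_ge0.
- exact: (cmeasurable_cmod mfm).
- exact: (cmeasurable_cmod mf).
- by move=> y _; rewrite lee_fin.
Qed.

End operator_on_atoms.

Section operator_on_decompositions.
Variables (R : realType) (n : nat) (q : n.-tuple R) (s : R).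
Local Notation E := (n.-tuple R).
Local Notation C := (R[i]).
Local Notation I := (int * n.-tuple int)%type.
Local Notation J := (nat * n.-tuple 'I_3)%type.
Hypothesis q_gt1 : forall i, 1 < tnth q i.

Let q_ge1 : exponents_ge1 q. Proof. by move=> i; exact: ltW. Qed.

(* This is [n/t] for [s = sum_i 1/p_i - n/t] and [q = p']. *)
Let tau : R := n%:R - harmonic_sum q - s.

Variable Tp : (E -> C) -> (E -> C).

Definition piece_index (z : J) (a : I) : I := translate z.2 (ancestor z.1 a).

(* [z.1 = 0] is the part of [Tp f] near the cube [a], where only the norm of
   [Tp f] is known; [z.1 = l.+1] is the tail bound at distance [2 ^ l]. *)
Definition piece (cK : R) (f : E -> C) (a : I) (z : J) : E -> \bar R :=
  (fun x => (\1_(dyadic_cube (piece_index z a).1 (piece_index z a).2) x)%:E *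
    (if z.1 is l.+1 then (2 * (cK * side R (a.1 - l%:Z) ^- n))%:E * \int[leb]_y cmod f y
     else cmod (Tp f) x))%E.

Lemma measurable_piece cK (f : E -> C) a z : cmeasurable (Tp f) ->
  measurable_fun [set: E] (piece cK f a z).
Proof.
move=> mT; apply: emeasurable_funM.
  by apply: measurable_EFin_indic; exact: measurable_dyadic_cube.
by case: z.1 => [|l]; [exact: cmeasurable_cmod|exact: measurable_cst].
Qed.

Lemma tail_ge0 cK (f : E -> C) (a : I) l : 0 < cK ->
  (0 <= (2 * (cK * side R (a.1 - l%:Z) ^- n))%:E * \int[leb]_y cmod f y)%E.
Proof.
move=> cK0; rewrite mule_ge0//; last by apply: integral_ge0 => x _; exact: cmod_ge0.
by rewrite lee_fin !mulr_ge0 ?(ltW cK0)// invr_ge0 exprn_ge0// ltW// side_gt0.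
Qed.

Lemma piece_ge0 cK (f : E -> C) a z x : 0 < cK -> (0 <= piece cK f a z x)%E.
Proof.
move=> cK0; rewrite /piece mule_ge0 ?lee_fin//.
by case: z.1 => [|l]; [exact: cmod_ge0|exact: tail_ge0].
Qed.

Lemma piece_support cK (f : E -> C) a z x :
  ~ dyadic_cube (piece_index z a).1 (piece_index z a).2 x -> piece cK f a z x = 0%E.
Proof. by move=> Qx; rewrite /piece indicE memNset// mul0e. Qed.

(** The coefficient on the ancestor contributes the exponent [s + harmonic_sum q] and the kernel
    [- n], in all [- tau]. The kernel bound refers to generation [j - l] but the atom to
    [j - l - 1], whence [2 ^+ n]. *)
Lemma far_coef_eq (j : int) (l : nat) :
  side R (j - l.+1%:Z) `^ s * side R (j - l.+1%:Z) `^ harmonic_sum q *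
    side R (j - l%:Z) ^- n * side R j `^ (n%:R - harmonic_sum q) =
  2 ^+ n * (2 `^ (- tau)) ^+ l.+1 * side R j `^ s.
Proof.
set u := side R (j - l.+1%:Z); have u0 : 0 < u by exact: side_gt0.
set w := side R j; have w0 : 0 < w by exact: side_gt0.
have uE : u = w * 2 ^+ l.+1 by rewrite /u sideD side_nat.
have E1 : side R (j - l%:Z) ^- n = 2 ^+ n * u `^ (- n%:R).
  rewrite powR_invn ?ltW// uE sideD side_nat -/w -exprVn -[in RHS]exprVn -exprMn.
  by congr (_ ^+ _); rewrite exprS; field; rewrite ?gt_eqF ?exprn_gt0.
have E2 : u `^ s * u `^ harmonic_sum q * u `^ (- n%:R) =
    w `^ (- tau) * (2 `^ (- tau)) ^+ l.+1.
  rewrite -!powRD; try by apply/implyP => _; rewrite gt_eqF.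
  rewrite (_ : s + harmonic_sum q + - n%:R = - tau); last by rewrite /tau; ring.
  rewrite uE powRM ?ltW ?exprn_gt0//; congr (_ * _).
  by rewrite -!powR_mulrn ?powR_ge0// -!powRrM mulrC.
have E3 : w `^ (- tau) * w `^ (n%:R - harmonic_sum q) = w `^ s.
  rewrite -powRD; last by apply/implyP => _; rewrite gt_eqF.
  by congr (_ `^ _); rewrite /tau; ring.
rewrite E1 -E3.
transitivity (2 ^+ n * (u `^ s * u `^ harmonic_sum q * u `^ (- n%:R)) *
  w `^ (n%:R - harmonic_sum q)); first by ring.
by rewrite E2; ring.
Qed.

(** For [z.1 = 0] the norm bound on [Tp f] gives the constant [c]; for [z.1 = l.+1] the tail value
    and Hoelder on the cube of [f] give [2 * cK * 2 ^+ n] and the decay. The sum of the two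
    constants serves both cases. *)
Lemma coef_piece_le cK c (f : E -> C) a z : 0 < cK -> 0 < c -> Lmixed q f ->
  cmeasurable (Tp f) -> (mixed_norm q (cmod (Tp f)) <= c%:E * mixed_norm q (cmod f))%E ->
  (forall x, ~ dyadic_cube a.1 a.2 x -> f x = 0) ->
  (coef q s (piece_index z a) (piece cK f a z) <=
   ((c + 2 * cK * 2 ^+ n) * (2 `^ (- tau)) ^+ z.1)%:E * coef q s a (cmod f))%E.
Proof.
move=> cK0 c0 Lf mT Tc fQ; have [mf _] := Lf; case: z => [[|l] e] /=.
  rewrite expr0 mulr1 /coef /piece_index /=.
  apply: (@le_trans _ _ ((side R a.1 `^ s)%:E * (c%:E * mixed_norm q (cmod f)))%E).
    rewrite subr0 lee_wpmul2l ?lee_fin ?powR_ge0//; apply: le_trans Tc.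
    apply: le_mixed_norm => //.
    - exact: measurable_piece.
    - exact: cmeasurable_cmod.
    - by move=> x; exact: piece_ge0.
    move=> x; rewrite /piece indicE; case: (x \in _) => /=.
      by rewrite mul1e.
    by rewrite mul0e cmod_ge0.
  rewrite muleCA lee_wpmul2r ?lee_fin//.
    by rewrite mule_ge0 ?lee_fin ?powR_ge0// mixed_norm_ge0// => x; exact: cmod_ge0.
  by rewrite lerDl !mulr_ge0// ?(ltW cK0)// exprn_ge0.
have int0 : (0 <= \int[leb]_y cmod f y)%E.
  by apply: integral_ge0 => y _; exact: cmod_ge0.
have intfin : (\int[leb]_y cmod f y)%E \is a fin_num.
  by rewrite ge0_fin_numE//; exact: (integral_cmod_lty q_gt1 Lf fQ).
set k := 2 * (cK * side R (a.1 - l%:Z) ^- n).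
have k0 : 0 <= k.
  by rewrite !mulr_ge0 ?(ltW cK0)// invr_ge0 exprn_ge0// ltW// side_gt0.
have -> : piece cK f a (l.+1, e) =
    (fun x => (k * fine (\int[leb]_y cmod f y))%:E * (EFin \o \1_(
      dyadic_cube (piece_index (l.+1, e) a).1 (piece_index (l.+1, e) a).2)) x)%E.
  by apply/funext => x; rewrite /piece /= muleC (EFinM k) fineK.
rewrite /coef mixed_norm_scale//; last 2 first.
- by rewrite mulr_ge0// fine_ge0.
- by apply: measurable_EFin_indic; exact: measurable_dyadic_cube.
rewrite mixed_norm_dyadic_cube//= EFinM fineK//.
have := integral_cmod_le q_gt1 mf fQ.
set S := side R (a.1 - l.+1%:Z) `^ s; set H := side R (a.1 - l.+1%:Z) `^ harmonic_sum q.
have SH0 : 0 <= S * H * k.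
  by apply: mulr_ge0 => //; apply: mulr_ge0; exact: powR_ge0.
move=> fint; apply: (@le_trans _ _ ((S * H * k)%:E * \int[leb]_y cmod f y)%E).
  rewrite le_eqVlt; apply/orP; left; apply/eqP.
  by rewrite -(fineK intfin) -!EFinM; congr (_%:E); ring.
apply: le_trans (lee_wpmul2l _ fint) _; first by rewrite lee_fin.
rewrite !muleA -!EFinM lee_wpmul2r//; last first.
  rewrite lee_fin -subr_ge0.
  have := far_coef_eq a.1 l; rewrite -/S -/H => SHE.
  have -> : S * H * k * side R a.1 `^ (n%:R - harmonic_sum q) =
     2 * cK * (S * H * side R (a.1 - l%:Z) ^- n * side R a.1 `^ (n%:R - harmonic_sum q)).
    by rewrite /k; ring.
  rewrite SHE; set X := (2 `^ (- tau)) ^+ l.+1; set Y := side R a.1 `^ s.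
  have -> : (c + 2 * cK * 2 ^+ n) * X * Y - 2 * cK * (2 ^+ n * X * Y) = c * X * Y by ring.
  by rewrite !mulr_ge0 ?powR_ge0 ?exprn_ge0 ?powR_ge0// ltW.
by apply: mixed_norm_ge0 => x; exact: cmod_ge0.
Qed.

End operator_on_decompositions.

(** * Convergence of partial sums of portions *)

Section partial_sums.
Variables (R : realType) (n : nat) (q : n.-tuple R).
Local Notation E := (n.-tuple R).
Local Notation C := (R[i]).
Hypothesis q_gt1 : forall i, 1 < tnth q i.

Let q_ge1 : exponents_ge1 q. Proof. by move=> i; exact: ltW. Qed.

Variables (f : E -> C) (V : nat -> E -> R).
Hypothesis mf : cmeasurable f.
Hypothesis mV : forall k, measurable_fun [set: E] (V k).
Hypothesis V0 : forall k x, 0 <= V k x.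
Hypothesis Vf : forall m x, \sum_(0 <= k < m) V k x <= normc (f x).

Definition partial_portion (m : nat) : E -> C :=
  fun x => \sum_(0 <= k < m) portion (V k) f x.

Lemma portion_le k x : 0 <= V k x <= normc (f x).
Proof.
rewrite V0 /=; apply: le_trans (Vf k.+1 x).
by rewrite big_nat_recr//= lerDr sumr_ge0.
Qed.

Lemma cmeasurable_partial_portion m : cmeasurable (partial_portion m).
Proof.
apply: cmeasurable_sum => k.
exact: cmeasurable_portion.
Qed.

Lemma normc_sub_partial_portion m x : normc (f x - partial_portion m x) =
  normc (f x) - \sum_(0 <= k < m) V k x.
Proof. by rewrite sub_sum_portion// Vf sumr_ge0. Qed.

Lemma normc_partial_portion m x : normc (partial_portion m x) <= normc (f x).
Proof.
apply: le_trans (normc_sum _ _) _; apply: le_trans (Vf m x).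
by apply: ler_sum => k _; rewrite normc_portion// portion_le.
Qed.

Lemma Lmixed_portion k : Lmixed q f -> Lmixed q (portion (V k) f).
Proof.
move=> Lf; apply: (Lmixed_dominated q_gt1 Lf) => [|x].
  exact: cmeasurable_portion.
by rewrite normc_portion ?portion_le//; have /andP[] := portion_le k x.
Qed.

Lemma Lmixed_partial_portion m : Lmixed q f -> Lmixed q (partial_portion m).
Proof.
move=> Lf; apply: (Lmixed_dominated q_gt1 Lf) => [|x]; first exact: cmeasurable_partial_portion.
exact: normc_partial_portion.
Qed.

Hypothesis Vsum : {ae leb, forall x, (\sum_(k <oo) (V k x)%:E)%E = (normc (f x))%:E}.

(** The modulus of the remainder is [normc f] minus a partial sum of [V]: it is dominated by
    [normc f] and tends to 0 almost everywhere. *)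
Lemma partial_portion_cvg : Lmixed q f ->
  (fun m => mixed_norm q (cmod (fun x => f x - partial_portion m x))) @ \oo --> 0%E.
Proof.
move=> [_ fq].
apply: (mixed_norm_dominated_cvg0 q_ge1 (f := cmod f)) => //.
- move=> m; exact: cmeasurable_cmod (cmeasurableB mf (cmeasurable_partial_portion m)).
- exact: cmeasurable_cmod.
- move=> m x; rewrite cmod_ge0/= lee_fin normc_sub_partial_portion.
  by rewrite gerBl sumr_ge0.
apply: filterS Vsum => x Vx; apply/cvg0P => [m|e e0]; first exact: cmod_ge0.
have [m0 em0] : exists m0, normc (f x) - e < \sum_(0 <= k < m0) V k x.
  apply: contrapT => /forallNP Vm.
  have : ((normc (f x))%:E <= (normc (f x) - e)%:E)%E.
    rewrite -Vx; apply: lime_le.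
      by apply: is_cvg_nneseries => k _ _; rewrite lee_fin.
    apply: nearW => m; rewrite sumEFin lee_fin leNgt; apply/negP; exact: Vm.
  by rewrite lee_fin lerBrDr gerDl leNgt e0.
exists m0 => // m /= m0m; rewrite /cmod normc_sub_partial_portion lee_fin.
rewrite lerBlDr -lerBlDl (le_trans (ltW em0))//.
by rewrite [leRHS](big_cat_nat (n := m0))//= lerDl sumr_ge0.
Qed.

End partial_sums.

(** * The operator on decompositions *)

Section pushed_atoms.
Local Open Scope ereal_scope.
Variables (R : realType) (n : nat) (q : n.-tuple R) (s rho : R).
Local Notation E := (n.-tuple R).
Local Notation I := (int * n.-tuple int)%type.
Local Notation J := (nat * n.-tuple 'I_3)%type.
Hypothesis q_ge1 : exponents_ge1 q.
Hypothesis rho_ge1 : (1 <= rho)%R.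

Variables (z : J) (w : I -> E -> \bar R) (c : I -> \bar R) (m : R).
Hypothesis mw : forall a, measurable_fun [set: E] (w a).
Hypothesis w0 : forall a x, 0 <= w a x.
Hypothesis wQ : forall a x,
  ~ dyadic_cube (piece_index z a).1 (piece_index z a).2 x -> w a x = 0.
Hypothesis m0 : (0 <= m)%R.
Hypothesis c0 : forall a, 0 <= c a.
Hypothesis wc : forall a, coef q s (piece_index z a) (w a) <= m%:E * c a.

Let preindex (a : I) (d : n.-tuple 'I_(2 ^ z.1)) : I :=
  child (untranslate z.2 a) d.

Let preindexK a d : piece_index z (preindex a d) = a.
Proof. by rewrite /piece_index ancestor_child untranslateK. Qed.

(** The preimages of [a] under [piece_index z] are the descendants of [untranslate z.2 a], so this
    collects all the functions [w] that land on [a]. *)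
Definition push (a : I) (x : E) : \bar R :=
  \esum_(d in [set: n.-tuple 'I_(2 ^ z.1)]) w (child (untranslate z.2 a) d) x.

Lemma atoms_push : atoms push.
Proof.
move=> a; split=> [|x|x Qx].
- by apply: measurable_esum.
- by apply: esum_ge0.
- rewrite /push esum1// => d _; apply: wQ.
  by rewrite (preindexK a d).
Qed.

Lemma esum_push x : \esum_(a in [set: I]) push a x = \esum_(a in [set: I]) w a x.
Proof.
rewrite [RHS](esum_children z.1)//.
rewrite [RHS](reindex_esum setT setT (untranslate z.2))//; last first.
  split=> // [a b _ _ /(can_inj (untranslateK z.2))//|a _].
  by exists (translate z.2 a) => //; exact: translateK.
by apply: eq_esum => a _; rewrite /push esum_finType.
Qed.

(** The coefficient on a cube is at most [m] times a sum of [c] over descendants; translation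
    permutes the cubes and so preserves the l^rho norm. *)
Lemma atoms_norm_push : atoms_norm q s rho push <=
  (m * 2 `^ ((z.1 * n)%:R * (1 - rho^-1)))%:E * ell_norm rho c.
Proof.
pose g b := \sum_d c (@child n z.1 b d).
have g0 b : 0 <= g b by apply: sume_ge0.
apply: (@le_trans _ _ (ell_norm rho (fun a => m%:E * g (untranslate z.2 a)))).
  apply: le_ell_norm => // a; first by apply: coef_ge0 => x; exact: esum_ge0.
  apply: (@le_trans _ _ (\esum_(d in [set: n.-tuple 'I_(2 ^ z.1)])
      coef q s a (w (preindex a d)))).
    rewrite esumZl ?powR_ge0//; last by move=> d; exact: mixed_norm_ge0.
    rewrite lee_wpmul2l ?lee_fin ?powR_ge0//.
    exact: mixed_norm_esum_le.
  rewrite esum_finType; last by move=> d; exact: coef_ge0.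
  rewrite ge0_sume_distrr//; apply: lee_sum => d _.
  by rewrite -{1}(preindexK a d); exact: wc.
rewrite ell_norm_scale// ell_norm_translate EFinM -muleA lee_wpmul2l ?lee_fin//.
exact: ell_norm_children.
Qed.

End pushed_atoms.

(** * The norm inequality on the mixed space *)

Section operator_bound.
Variables (R : realType) (n : nat) (q : n.-tuple R) (s rho : R).
Local Notation E := (n.-tuple R).
Local Notation C := (R[i]).
Local Notation I := (int * n.-tuple int)%type.
Local Notation J := (nat * n.-tuple 'I_3)%type.
Hypothesis q_gt1 : forall i, 1 < tnth q i.
Hypothesis rho_ge1 : 1 <= rho.
Hypothesis small_cubes : n%:R * (1 - rho^-1) < n%:R - harmonic_sum q - s.

Let q_ge1 : exponents_ge1 q. Proof. by move=> i; exact: ltW. Qed.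

(* This is [n/t - n/r] for [rho = r']. *)
Let delta : R := n%:R - harmonic_sum q - s - n%:R * (1 - rho^-1).

Variables (T Tp : (E -> C) -> (E -> C)).
Hypothesis T_sio : singular_integral_operator T.
Hypothesis Tp_ext : Lmixed_extension q T Tp.

(** For each [x] take the least [l] for which [x] is near the [l]-th ancestor. If it is a successor,
    [x] is far from the ancestor just before, whose tail bound is the value of the piece of index
    [l]. *)
Lemma Tp_le_pieces cK (f : E -> C) (a : I) : 0 < cK ->
  (forall l, {ae leb, forall x, ~ near_cube l a x -> (cmod (Tp f) x <=
      (2 * (cK * side R (a.1 - l%:Z) ^- n))%:E * \int[leb]_x cmod f x)%E}) ->
  {ae leb, forall x, (cmod (Tp f) x <= \esum_(z in [set: J]) piece Tp cK f a z x)%E}.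
Proof.
move=> cK0 /ae_foralln; apply: filterS => x far.
have ex : exists l, `[< near_cube l a x >].
  by have [l near_l] := near_cube_exists a x; exists l; exact/asboolP.
case: (ex_minnP ex) => l /asboolP[e Qe] lmin.
apply: le_trans (esum_sup_term (l, e) _); last by move=> z; exact: piece_ge0.
rewrite /piece indicE mem_set//= mul1e.
case: l Qe lmin => [//|l] _ lmin; apply: far => near_l.
by have := lmin l (asboolT near_l); rewrite ltnn.
Qed.

Lemma Tp_cst0 : {ae leb, forall x, Tp (fun=> 0) x = 0}.
Proof.
have L0 : Lmixed q (fun=> 0 : C).
  split; first exact: cmeasurable_cst.
  rewrite (_ : cmod _ = fun=> 0%E); first by rewrite mixed_norm_cst0// ltry.
  by apply/funext => x; rewrite /cmod normc0.
have := Tp_sub Tp_ext L0 L0.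
rewrite (_ : (fun x => 0 - 0 : C) = fun=> 0); last by apply/funext => x; rewrite subrr.
by apply: filterS => x ->; rewrite subrr.
Qed.

Lemma Tp_portions_le (f : E -> C) (V : nat -> E -> R) (m : nat) :
  Lmixed q f -> (forall k, measurable_fun [set: E] (V k)) ->
  (forall k x, 0 <= V k x) -> (forall m x, \sum_(0 <= k < m) V k x <= normc (f x)) ->
  (forall k x, @pickle_inv I k = None -> V k x = 0) ->
  {ae leb, forall x, (cmod (Tp (partial_portion f V m)) x <=
    \sum_(0 <= k < m) oapp (fun a => cmod (Tp (portion (V (choice.pickle a)) f)) x) 0
      (@pickle_inv I k))%E}.
Proof.
move=> Lf mV V0 Vf Vnone; have [mf _] := Lf.
have [[_ lin _] _] := Tp_ext.
elim: m => [|m IH].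
  rewrite (_ : partial_portion f V 0 = fun=> 0); last first.
    by apply/funext => x; rewrite /partial_portion big_geq.
  by apply: filterS Tp_cst0 => x Tx; rewrite /cmod Tx normc0 big_geq.
case E : (@pickle_inv I m) => [a|]; last first.
  rewrite (_ : partial_portion f V m.+1 = partial_portion f V m); last first.
    apply/funext => x; rewrite /partial_portion big_nat_recr//= /portion Vnone//.
    by rewrite mul0r rmorph0 mul0r addr0.
  by apply: filterS IH => x; rewrite big_nat_recr//= E/= adde0.
have am : choice.pickle a = m by have := @pickle_invK I m; rewrite E.
have Lm : Lmixed q (partial_portion f V m) by exact: Lmixed_partial_portion.
have Lv : Lmixed q (portion (V m) f) by exact: Lmixed_portion.
have := lin 1 _ _ Lv Lm.
rewrite (_ : (fun x => _) = partial_portion f V m.+1); last first.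
  by apply/funext => x; rewrite /partial_portion big_nat_recr//= mul1r addrC.
apply: filterS2 IH => x IH Tx; rewrite big_nat_recr//= E/= am.
apply: le_trans (leeD IH (lexx _)).
by rewrite /cmod Tx mul1r -EFinD lee_fin addrC normc_leD.
Qed.

(** Domination by [cmod f] makes the portions sum to [f] in the mixed norm, which the atoms [u] do
    not provide by themselves; the estimate for finitely many portions then passes to the limit. *)
Lemma Tp_le_esum_portions (f : E -> C) (u : I -> E -> \bar R) : Lmixed q f ->
  atoms u -> dominates u (cmod f) ->
  exists B : I -> E -> C,
    [/\ forall a, Lmixed q (B a),
        forall a x, (cmod (B a) x <= u a x)%E &
        {ae leb, forall x,
          (cmod (Tp f) x <= \esum_(a in [set: I]) cmod (Tp (B a)) x)%E}].
Proof.
move=> Lf au uf; have [mf fq] := Lf.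
have [V [mV V0 Vu Vf Vsum]] := split_dominated_nat au uf mf.
pose B a := portion (V (@choice.pickle I a)) f.
have LB a : Lmixed q (B a) by exact: Lmixed_portion.
exists B; split => // [a x|].
  rewrite /cmod normc_portion; last exact: portion_le.
  by have := Vu (@choice.pickle I a) x; rewrite pickleK_inv.
have mTB a : cmeasurable (Tp (B a)) by have [] := Tp_Lmixed Tp_ext (LB a).
suff : {ae leb, forall x, [set: E] x ->
    (cmod (Tp f) x <= \esum_(a in [set: I]) cmod (Tp (B a)) x)%E}.
  by apply: filterS => x; apply.
apply: (Tp_limit_le q_gt1 Tp_ext) => //.
- by apply: measurable_esum => a; [exact: cmeasurable_cmod|exact: cmod_ge0].
- by move=> x; apply: esum_ge0 => a _; exact: cmod_ge0.
move=> e e0.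
have ge0 m : (0 <= mixed_norm q (cmod (fun x => (f x - partial_portion f V m x)%R)))%E.
  by apply: mixed_norm_ge0 => x; exact: cmod_ge0.
have [m _ /(_ m (leqnn m)) /= fm] :=
  iffLR (cvg0P ge0) (partial_portion_cvg q_gt1 mf mV V0 Vf Vsum Lf) e e0.
exists (partial_portion f V m); split => //; first exact: Lmixed_partial_portion.
have Vnone k x : @pickle_inv I k = None -> V k x = 0.
  move=> kN; apply/eqP; rewrite eq_le V0 andbT -lee_fin.
  by have := Vu k x; rewrite kN.
apply: filterS (Tp_portions_le m Lf mV V0 Vf Vnone) => x Tx _.
apply: le_trans Tx _; rewrite esum_countType; last by move=> a; exact: cmod_ge0.
by apply: nneseries_lim_ge => k _ _; case: (pickle_inv k) => [a|]//=; exact: cmod_ge0.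
Qed.

Let y : R := 2 `^ (- delta).

Lemma esum_piece_weights_lty : (\esum_(z in [set: J]) (y ^+ z.1)%:E < +oo)%E.
Proof.
have y01 : 0 <= y < 1 by apply: powR2_lt1; rewrite /delta subr_gt0.
have /andP[y0 _] := y01.
have -> : (\esum_(z in [set: J]) (y ^+ z.1)%:E =
    (#|{: n.-tuple 'I_3}|%:R)%:E * \esum_(l in [set: nat]) (y ^+ l)%:E)%E.
  rewrite -esumZl//; last by move=> l; rewrite lee_fin exprn_ge0.
  transitivity (\esum_(l in [set: nat]) \esum_(e in [set: n.-tuple 'I_3]) (y ^+ l)%:E)%E.
    rewrite esum_esum; last by move=> l e _ _; rewrite lee_fin exprn_ge0.
    by congr esum; apply/seteqP; split=> -[].
  apply: eq_esum => l _; rewrite esum_finType; last by move=> e; rewrite lee_fin exprn_ge0.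
  by rewrite sumEFin sumr_const -EFinM mulr_natl.
by rewrite lte_mul_pinfty ?lee_fin// esum_geometric_lty.
Qed.

(** The images of the portions of [f] are covered by pieces of shapes [z]. Pushed to their cubes,
    the pieces of one shape cost [C0 * y ^+ z.1], and [y < 1] allows summing over the shapes. *)
Lemma decomp_norm_Tp_le : exists2 Cm : R, 0 < Cm & forall f, Lmixed q f ->
  (decomp_norm q s rho (cmod (Tp f)) <= Cm%:E * decomp_norm q s rho (cmod f))%E.
Proof.
have [[_ _ [c c0 Tpc]] _] := Tp_ext.
have [cK cK0 far] := far_bound q_gt1 T_sio Tp_ext.
pose C0 := c + 2 * cK * 2 ^+ n.
have C00 : 0 < C0 by rewrite addr_gt0// !mulr_gt0// exprn_gt0.
have y0 : 0 <= y by exact: powR_ge0.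
have Y0 : (0 <= \esum_(z in [set: J]) (y ^+ z.1)%:E)%E.
  by apply: esum_ge0 => z _; rewrite lee_fin exprn_ge0.
pose Y := fine (\esum_(z in [set: J]) (y ^+ z.1)%:E)%E.
have YE : (\esum_(z in [set: J]) (y ^+ z.1)%:E = Y%:E)%E.
  by rewrite fineK// ge0_fin_numE// esum_piece_weights_lty.
have Yge0 : 0 <= Y by exact: fine_ge0.
(* The added 1 gives positivity from [0 <= Y] alone. *)
have Cm0 : 0 < C0 * (Y + 1) by rewrite mulr_gt0// ltr_wpDl.
exists (C0 * (Y + 1)) => // f Lf.
(* Dividing by the constant exposes the infimum on the right, so an arbitrary dominating family [u]
   of [f] can be fixed. *)
rewrite -lee_pdivrMl//; apply: le_ereal_inf_tmp => _ [u [au uf] <-].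
rewrite lee_pdivrMl//.
have [B [LB Bu TB]] := Tp_le_esum_portions Lf au uf.
have mB a : cmeasurable (B a) by have [] := LB a.
have BQ a x : ~ dyadic_cube a.1 a.2 x -> B a x = 0.
  move=> Qx; have [_ _ /(_ _ Qx) ux] := au a.
  have := Bu a x; rewrite ux lee_fin => Bx.
  by apply: eq0_normc; apply/eqP; rewrite eq_le Bx normc_ge0.
have mTB a : cmeasurable (Tp (B a)) by have [] := Tp_Lmixed Tp_ext (LB a).
pose w (z : J) a := piece Tp cK (B a) a z.
have mw z a : measurable_fun [set: E] (w z a) by exact: measurable_piece.
have w0 z a x : (0 <= w z a x)%E by exact: piece_ge0.
have wQ z a x : ~ dyadic_cube (piece_index z a).1 (piece_index z a).2 x -> w z a x = 0%E.
  exact: piece_support.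
pose cu a := coef q s a (u a).
have cu0 a : (0 <= cu a)%E by apply: coef_ge0; have [] := au a.
pose tau := n%:R - harmonic_sum q - s.
pose m (z : J) := C0 * (2 `^ (- tau)) ^+ z.1.
have m0 z : 0 <= m z by rewrite mulr_ge0 ?(ltW C00)// exprn_ge0// powR_ge0.
have wc z a : (coef q s (piece_index z a) (w z a) <= (m z)%:E * cu a)%E.
  apply: (@le_trans _ _ ((m z)%:E * coef q s a (cmod (B a)))%E).
    by apply: coef_piece_le => //; [exact: Tpc|exact: BQ].
  rewrite lee_wpmul2l ?lee_fin//; apply: le_coef => //.
  - exact: cmeasurable_cmod.
  - by have [] := au a.
  - by move=> x; exact: cmod_ge0.
pose U a x := (\esum_(z in [set: J]) push z (w z) a x)%E.
have apush z : atoms (push z (w z)) by exact: (atoms_push (mw z) (w0 z) (wQ z)).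
have aU : atoms U by exact: atoms_esum.
have pieces : {ae leb, forall x a,
    (cmod (Tp (B a)) x <= \esum_(z in [set: J]) w z a x)%E}.
  apply: ae_forall_count => a; apply: Tp_le_pieces => // l.
  exact: far (LB a) (BQ a).
have UT : dominates U (cmod (Tp f)).
  apply: filterS2 TB pieces => x TB pieces; apply: le_trans TB _.
  apply: le_trans (le_esum (fun a _ => pieces a)) _.
  rewrite esum_exchange; last by move=> *; exact: w0.
  rewrite [leRHS]esum_exchange; last by move=> a z; have [] := apush z a.
  by apply: le_esum => z _; rewrite esum_push.
apply: le_trans (decomp_norm_le q s rho aU UT) _.
apply: le_trans (atoms_norm_esum_le s q_ge1 rho_ge1 apush) _.
apply: (@le_trans _ _ (\esum_(z in [set: J])
    ((C0 * y ^+ z.1)%:E * atoms_norm q s rho u)))%E.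
  apply: le_esum => z _; have := atoms_norm_push q_ge1 rho_ge1 (mw z) (w0 z) (m0 z) cu0 (wc z).
  (* The decay [tau] of the coefficients minus the cost [n * (1 - 1 / rho)] of regrouping is
     [delta]. *)
  rewrite (_ : m z * _ = C0 * y ^+ z.1)//.
  rewrite /m -mulrA; congr (_ * _).
  rewrite -!powR_mulrn ?powR_ge0// -!powRrM -powRD; last by rewrite pnatr_eq0 implybT.
  by congr (_ `^ _); rewrite /delta/tau natrM; ring.
have M0 : (0 <= atoms_norm q s rho u)%E by exact: ell_norm_ge0.
have [->|Mfin] := eqVneq (atoms_norm q s rho u) +oo%E.
  by rewrite mulry gtr0_sg// mul1e leey.
have ME : (atoms_norm q s rho u = (fine (atoms_norm q s rho u))%:E)%E.
  by rewrite fineK// ge0_fin_numE// ltey.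
have M0' : 0 <= fine (atoms_norm q s rho u) by exact: fine_ge0.
rewrite ME; set M := fine _ in M0' *.
apply: (@le_trans _ _ ((C0 * M)%:E * \esum_(z in [set: J]) (y ^+ z.1)%:E)%E).
  rewrite -esumZl; [|by rewrite mulr_ge0// ltW|by move=> z; rewrite lee_fin exprn_ge0].
  by apply: le_esum => z _; rewrite -!EFinM mulrAC.
by rewrite YE -!EFinM lee_fin mulrAC ler_wpM2r// ler_wpM2l ?lerDl// ltW.
Qed.

End operator_bound.

(** * Density and completeness *)

Section null_sequences.
Local Open Scope ereal_scope.
Variable R : realType.

Lemma cvg0_dominated (c : R) (a a' b : nat -> \bar R) : (0 < c)%R ->
  (forall m, 0 <= a m) -> (forall m, 0 <= a' m) -> (forall m, 0 <= b m) ->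
  (forall m, b m <= c%:E * (a m + a' m)) ->
  a @ \oo --> 0 -> a' @ \oo --> 0 -> b @ \oo --> 0.
Proof.
move=> c0 a0 a'0 b0 bc /(cvg0P a0) ha /(cvg0P a'0) ha'; apply/(cvg0P b0) => e e0.
have e1 : (0 < e / c / 2)%R by rewrite !divr_gt0.
near=> m; apply: le_trans (bc m) _.
apply: (@le_trans _ _ (c%:E * ((e / c / 2)%:E + (e / c / 2)%:E))).
  rewrite lee_wpmul2l ?lee_fin ?(ltW c0)// leeD//; near: m; [exact: ha|exact: ha'].
by rewrite -EFinD -EFinM lee_fin -splitr mulrC divfK ?gt_eqF.
Unshelve. all: by end_near. Qed.

(** Bounded variation makes the telescoping series absolutely convergent. *)
Lemma bounded_variation_cvg (r : nat -> R) (M : R) :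
  (forall m, \sum_(0 <= i < m) `|r i.+1 - r i| <= M)%R -> cvgn r.
Proof.
move=> rM; have cs : cvgn (series (telescope r)).
  apply: normed_cvg; apply: nondecreasing_is_cvgn.
    by apply: nondecreasing_series => i _ _; exact: normr_ge0.
  by exists M => _ [m _ <-]; exact: rM.
rewrite (_ : r = (fun m => r 0%N + series (telescope r) m)%R).
  by apply: is_cvgD => //; exact: is_cvg_cst.
by apply/funext => m; exact: eq_sum_telescope.
Qed.

End null_sequences.

(** * Pointwise limits of fast Cauchy sequences *)

Section fast_limits.
Variables (R : realType) (n : nat).
Local Notation E := (n.-tuple R).
Local Notation C := (R[i]).
Variable F : nat -> E -> C.
Hypothesis mF : forall m, cmeasurable (F m).

Definition increment (i : nat) : E -> C := fun x => F i.+1 x - F i x.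

Lemma normc_sub_le_increments k m x : (k <= m)%N ->
  normc (F m x - F k x) <= \sum_(k <= i < m) normc (increment i x).
Proof.
move=> km; rewrite -(@telescope_sumr _ k m (F ^~ x))//.
exact: normc_sum.
Qed.

(** [h] is built from the limits of [\1_A * F m], where [A] is the set of summable increments: these
    sequences converge everywhere, which makes [h] measurable. *)
Lemma fast_limit : exists2 h : E -> C, cmeasurable h &
  forall x, (\sum_(0 <= i <oo) cmod (increment i) x < +oo)%E ->
  forall k, (cmod (fun x => h x - F k x)%R x <= \sum_(k <= i <oo) cmod (increment i) x)%E.
Proof.
pose D x := (\sum_(0 <= i <oo) cmod (increment i) x)%E.
have mI i : cmeasurable (increment i) by exact: cmeasurableB.
have mD : measurable_fun [set: E] D.
  by apply: ge0_emeasurable_sum => [i x _ _|i _]; [exact: cmod_ge0|exact: cmeasurable_cmod].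
pose A := [set x | (D x < +oo)%E].
have mA : measurable A.
  by rewrite -[A]setTI; exact: emeasurable_fun_infty_o.
have A_cvg (P : C -> R) x : (forall a b, P (a - b) = P a - P b) ->
    (forall a, `|P a| <= normc a) -> cvgn (fun m => \1_A x * P (F m x)).
  move=> PB Ple; rewrite indicE; have [|_] := boolP (x \in A); last first.
    by under eq_fun do rewrite mul0r; exact: is_cvg_cst.
  rewrite inE => Ax; under eq_fun do rewrite mul1r.
  apply: (@bounded_variation_cvg _ _ (fine (D x))) => m.
  rewrite -lee_fin fineK; last first.
    by rewrite ge0_fin_numE//; apply: nneseries_ge0 => i _ _; exact: cmod_ge0.
  apply: (@le_trans _ _ (\sum_(0 <= i < m) cmod (increment i) x)%E); last first.
    by apply: nneseries_lim_ge => i _ _; exact: cmod_ge0.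
  by rewrite sumEFin lee_fin; apply: ler_sum => i _; rewrite -PB; exact: Ple.
have reB (a b : C) : complex.Re (a - b) = complex.Re a - complex.Re b by rewrite raddfB.
have imB (a b : C) : complex.Im (a - b) = complex.Im a - complex.Im b by rewrite raddfB.
have mlim (P : C -> R) : (forall a b, P (a - b) = P a - P b) ->
    (forall a, `|P a| <= normc a) -> (forall m, measurable_fun [set: E] (P \o F m)) ->
    measurable_fun [set: E] (fun x => limn (fun m => \1_A x * P (F m x))).
  move=> PB Ple mP; apply: (@measurable_fun_cvg _ _ _ _ (fun m x => \1_A x * P (F m x))).
    by move=> m; apply: measurable_funM => //; exact: mP.
  by move=> x _; exact: A_cvg.
exists (fun x => Complex (limn (fun m => \1_A x * complex.Re (F m x)))
    (limn (fun m => \1_A x * complex.Im (F m x)))).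
  split; apply: mlim => //; try exact: normc_Re; try exact: normc_Im.
  - by move=> m; have [] := mF m.
  - by move=> m; have [] := mF m.
move=> x Ax k; apply/lee_addgt0Pr => e e0.
have e2 : 0 < e / 2 by rewrite divr_gt0.
have xA : \1_A x = 1 :> R by rewrite indicE mem_set.
have := A_cvg (@complex.Re R) x reB (@normc_Re R).
have := A_cvg (@complex.Im R) x imB (@normc_Im R).
rewrite xA.
move=> /cvgrPdist_le/(_ _ e2) him /cvgrPdist_le/(_ _ e2) hre.
rewrite /cmod /= xA; set h := (X in normc (X - F k x)).
near \oo => m.
have km : (k <= m)%N by near: m; exact: nbhs_infty_ge.
have hm : normc (h - F m x) <= e.
  apply: le_trans (normc_le_ReIm _) _; rewrite reB imB /h/= [leRHS]splitr.
  apply: lerD; rewrite -[X in _ - X]mul1r; near: m; [exact: hre|exact: him].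
rewrite addeC; apply: (@le_trans _ _ (e%:E + \sum_(k <= i < m) cmod (increment i) x)%E).
  rewrite sumEFin -EFinD lee_fin -[X in normc X](subrKA (F m x)).
  apply: le_trans (normc_leD _ _) _.
  by apply: lerD => //; exact: normc_sub_le_increments.
rewrite leeD2l//; apply: nneseries_lim_ge => i _ _; exact: cmod_ge0.
Unshelve. all: by end_near. Qed.

End fast_limits.

(** * Triangle inequalities for the decomposition norm *)

Section decomp_norm_distance.
Local Open Scope ereal_scope.
Variables (R : realType) (n : nat) (q : n.-tuple R) (s rho : R).
Local Notation E := (n.-tuple R).
Local Notation C := (R[i]).
Local Notation I := (int * n.-tuple int)%type.
Hypothesis q_ge1 : exponents_ge1 q.
Hypothesis rho_ge1 : (1 <= rho)%R.
Local Notation N := (decomp_norm q s rho).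

Lemma decomp_norm_cst0 : N (fun=> 0) = 0.
Proof.
apply/eqP; rewrite eq_le decomp_norm_ge0 andbT.
have a0 : atoms (fun (_ : I) (_ : E) => 0 : \bar R).
  by move=> a; split => //; exact: measurable_cst.
apply: le_trans (decomp_norm_le q s rho a0 _) _.
  by apply: aeW => x; rewrite esum1.
have rho0 : rho != 0%R by rewrite gt_eqF// (lt_le_trans _ rho_ge1).
have E0 : \esum_(a in [set: I]) (coef q s a (fun=> 0) `^ rho) = 0.
  by apply: esum1 => a _; rewrite coef_cst0// poweR0r.
by rewrite /atoms_norm /ell_norm E0 poweR0r// invr_eq0.
Qed.

(** Countable subadditivity for a series that vanishes from its third term on. *)
Lemma decomp_normD (F F1 F2 : E -> \bar R) :
  (forall x, 0 <= F1 x) -> (forall x, 0 <= F2 x) ->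
  {ae leb, forall x, F x <= F1 x + F2 x} -> N F <= N F1 + N F2.
Proof.
move=> F10 F20 FD.
have sum2 (H : nat -> \bar R) : (forall k, 0 <= H k) -> (forall k, H k.+2 = 0) ->
    \sum_(k <oo) H k = H 0%N + H 1%N.
  move=> H0 H2; rewrite (nneseries_split 0 2)// add0n [X in _ + X]eseries0; last first.
    by move=> [|[|k]].
  by rewrite adde0 !big_nat_recr//= big_geq// add0e.
pose G k : E -> \bar R := if k is k'.+1 then if k' is 0%N then F2 else fun=> 0 else F1.
have G0 k x : 0 <= G k x by case: k => [|[|k]].
have := @decomp_norm_nneseries _ _ _ s _ q_ge1 rho_ge1 F G G0.
rewrite sum2; [|by move=> k; exact: decomp_norm_ge0|by move=> k; exact: decomp_norm_cst0].
by apply; apply: filterS FD => x; rewrite sum2.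
Qed.

Lemma decomp_norm_dist (f g h : E -> C) :
  N (cmod (fun x => f x - h x)%R) <=
  N (cmod (fun x => f x - g x)%R) + N (cmod (fun x => g x - h x)%R).
Proof.
apply: decomp_normD; [exact: cmod_ge0|exact: cmod_ge0|].
by apply: aeW => x; rewrite /cmod -EFinD lee_fin -[X in normc X](subrKA (g x)) normc_leD.
Qed.

Lemma decomp_norm_distC (f g : E -> C) :
  N (cmod (fun x => f x - g x)%R) = N (cmod (fun x => g x - f x)%R).
Proof. by congr decomp_norm; apply/funext => x; rewrite /cmod normc_dist. Qed.

Lemma decomp_norm_triangle (f g : E -> C) :
  N (cmod f) <= N (cmod (fun x => f x - g x)%R) + N (cmod g).
Proof.
apply: decomp_normD; [exact: cmod_ge0|exact: cmod_ge0|].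
by apply: aeW => x; rewrite /cmod -EFinD lee_fin -{1}[f x](subrK (g x)) normc_leD.
Qed.

End decomp_norm_distance.

(** * Approximation by finitely many portions *)

Section density.
Variables (R : realType) (n : nat) (q : n.-tuple R) (s rho : R).
Local Notation E := (n.-tuple R).
Local Notation C := (R[i]).
Local Notation I := (int * n.-tuple int)%type.
Hypothesis q_gt1 : forall i, 1 < tnth q i.
Hypothesis rho_ge1 : 1 <= rho.
Local Notation N := (decomp_norm q s rho).

Let q_ge1 : exponents_ge1 q. Proof. by move=> i; exact: ltW. Qed.

Lemma coef_lty (u : I -> E -> \bar R) a : atoms u ->
  (atoms_norm q s rho u < +oo)%E -> (mixed_norm q (u a) < +oo)%E.
Proof.
move=> au ufin; have c0 b : (0 <= coef q s b (u b))%E.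
  by apply: coef_ge0; have [] := au b.
have : (coef q s a (u a) < +oo)%E.
  exact: le_lt_trans (le_ell_norm_coef rho_ge1 a c0) ufin.
have w0 : 0 < side R a.1 `^ s by rewrite powR_gt0// side_gt0.
rewrite /coef; have : (0 <= mixed_norm q (u a))%E by apply: mixed_norm_ge0; have [] := au a.
by case: (mixed_norm q (u a)) => [x _ _| |//]; rewrite ?ltry// gt0_muley ?lte_fin.
Qed.

Variables (g : E -> C) (u : I -> E -> \bar R) (V : nat -> E -> R).
Hypothesis mg : cmeasurable g.
Hypothesis au : atoms u.
Hypothesis ufin : (atoms_norm q s rho u < +oo)%E.
Hypothesis mV : forall k, measurable_fun [set: E] (V k).
Hypothesis V0 : forall k x, 0 <= V k x.
Hypothesis Vu : forall k x,
  ((V k x)%:E <= oapp (fun a => u a x) 0 (@pickle_inv I k))%E.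
Hypothesis Vg : forall m x, \sum_(0 <= k < m) V k x <= normc (g x).
Hypothesis Vsum : {ae leb, forall x, (\sum_(k <oo) (V k x)%:E)%E = (normc (g x))%:E}.

Let normcV k x : normc (portion (V k) g x) = V k x.
Proof. by rewrite normc_portion// portion_le. Qed.

Let V_eq0 k x : (forall a, @pickle_inv I k = Some a -> ~ dyadic_cube a.1 a.2 x) ->
  V k x = 0.
Proof.
move=> Qx; apply/eqP; rewrite eq_le V0 andbT -lee_fin; apply: le_trans (Vu k x) _.
case: (pickle_inv k) Qx => [a|//] /(_ a erefl) Qx /=.
by have [_ _ ->] := au a.
Qed.

Lemma partial_portion_bounded m : exists M : R,
  forall x, partial_portion g V m x != 0 -> forall i, `|tnth x i| <= M.
Proof.
elim: m => [|m [M fM]].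
  by exists 0 => x; rewrite /partial_portion big_geq// eqxx.
have [M' VM'] : exists M', forall x, V m x != 0 -> forall i, `|tnth x i| <= M'.
  case E : (@pickle_inv I m) => [a|]; last first.
    by exists 0 => x; rewrite V_eq0 ?eqxx// => a; rewrite E.
  have [M' QM'] := dyadic_cube_bounded R a; exists M' => x Vx; apply: QM'.
  apply: contrapT => Qx; move: Vx; rewrite V_eq0 ?eqxx// => b; rewrite E => -[<-//].
exists (Num.max M M') => x fx i; rewrite le_max.
have [Vx|/VM' ->] := eqVneq (V m x) 0; last by rewrite orbT.
rewrite fM//; move: fx; rewrite /partial_portion big_nat_recr//=.
by rewrite [X in _ + X]/portion Vx mul0r rmorph0 mul0r addr0.
Qed.

(** Each portion lies below a single atom, whose mixed norm is finite because its coefficient is;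
    the bound comes from the atoms rather than from [g]. *)
Lemma Lmixed_partial_portion_of_atoms m : Lmixed q (partial_portion g V m).
Proof.
elim: m => [|m IH].
  rewrite (_ : partial_portion g V 0 = fun=> 0); last first.
    by apply/funext => x; rewrite /partial_portion big_geq.
  split; first exact: cmeasurable_cst.
  rewrite (_ : cmod _ = fun=> 0%E); first by rewrite mixed_norm_cst0// ltry.
  by apply/funext => x; rewrite /cmod normc0.
have LV : Lmixed q (portion (V m) g).
  have mp : cmeasurable (portion (V m) g) by exact: cmeasurable_portion.
  split => //.
  apply: (@le_lt_trans _ _ (mixed_norm q (fun x => oapp (fun a => u a x) 0 (@pickle_inv I m))%E)).
    apply: le_mixed_norm => //.
    - exact: cmeasurable_cmod.
    - by case: (pickle_inv m) => [a|] /=; [have [] := au a|exact: measurable_cst].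
    - by move=> x; exact: cmod_ge0.
    - by move=> x; rewrite /cmod normcV.
  case: (pickle_inv m) => [a|] /=; first exact: coef_lty.
  by rewrite mixed_norm_cst0// ltry.
rewrite (_ : partial_portion g V m.+1 =
    fun x => 1 * portion (V m) g x + partial_portion g V m x).
  exact: Lmixed_scaleD.
by apply/funext => x; rewrite /partial_portion big_nat_recr//= mul1r addrC.
Qed.

(** The remainder of [g] is the sum of the later portions, each below its atom, so it is dominated
    by [u] with the codes below [m] erased. *)
Lemma decomp_norm_sub_partial_portion m :
  (N (cmod (fun x => (g x - partial_portion g V m x)%R)) <=
   ell_norm rho (fun a => if (choice.pickle a < m)%N then 0 else coef q s a (u a)))%E.
Proof.
pose u' (a : I) : E -> \bar R := if (choice.pickle a < m)%N then fun=> 0%E else u a.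
have au' : atoms u'.
  move=> a; rewrite /u'; case: ifP => _; last exact: au.
  by split => //; exact: measurable_cst.
have -> : (fun a => if (choice.pickle a < m)%N then 0 else coef q s a (u a))%E =
    (fun a => coef q s a (u' a)).
  by apply/funext => a; rewrite /u'; case: ifP => // _; rewrite coef_cst0.
apply: decomp_norm_le => //; apply: filterS Vsum => x gx.
rewrite esum_countType; last by move=> a; have [] := au' a.
rewrite /cmod normc_sub_partial_portion//.
move: gx; rewrite (nneseries_split 0 m); last by move=> k _; rewrite lee_fin.
rewrite add0n sumEFin EFinB => <-; rewrite addeAC subee// add0e.
rewrite [leRHS](nneseries_split 0 m); last first.
  by move=> k _; case: (pickle_inv k) => [a|//] /=; have [] := au' a.
rewrite add0n; apply: le_trans (leeDr _ _); last first.
  by apply: sume_ge0 => k _; case: (pickle_inv k) => [a|//] /=; have [] := au' a.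
rewrite [leLHS]eseries_cond [leRHS]eseries_cond; apply: lee_nneseries => [k _ _|k].
  by rewrite lee_fin.
move=> /andP[_ mk]; apply: le_trans (Vu k x) _.
have := @pickle_invK I k; case: (pickle_inv k) => [a /= ak|//].
by rewrite /u' ak ltnNge mk.
Qed.

End density.

Section approximation.
Variables (R : realType) (n : nat) (q : n.-tuple R) (s rho : R).
Local Notation E := (n.-tuple R).
Local Notation C := (R[i]).
Hypothesis q_gt1 : forall i, 1 < tnth q i.
Hypothesis rho_ge1 : 1 <= rho.
Local Notation N := (decomp_norm q s rho).

Let q_ge1 : exponents_ge1 q. Proof. by move=> i; exact: ltW. Qed.

Lemma decomp_norm_approx (g : E -> C) : cmeasurable g -> (N (cmod g) < +oo)%E ->
  exists2 f : nat -> E -> C, forall k, Lmixed q (f k) /\ compact_support (f k) &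
    (fun k => N (cmod (fun x => f k x - g x))) @ \oo --> 0%E.
Proof.
move=> mg /decomp_norm_lt[u [au ug ufin]].
have [V [mV V0 Vu Vg Vsum]] := split_dominated_nat au ug mg.
exists (fun m => partial_portion g V m) => [m|].
  split; first exact: (Lmixed_partial_portion_of_atoms q_gt1 rho_ge1 mg au ufin mV V0 Vu Vg).
  have [M fM] := partial_portion_bounded g au V0 Vu m.
  exact: compact_support_bounded fM.
have c0 a : (0 <= coef q s a (u a))%E by apply: coef_ge0; have [] := au a.
have Z0 m : (0 <= (fun=> 0) m :> \bar R)%E by [].
apply: (@cvg0_dominated _ 1 (fun m => ell_norm rho (fun a =>
  if (choice.pickle a < m)%N then 0 else coef q s a (u a))%E) (fun=> 0%E)) => //.
- by move=> m; exact: ell_norm_ge0.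
- by move=> m; exact: decomp_norm_ge0.
- move=> m; rewrite adde0 mul1e decomp_norm_distC.
  exact: decomp_norm_sub_partial_portion.
- exact: ell_norm_tail_cvg0.
- exact: cvg_cst.
Qed.

End approximation.

(** * Extension by completeness *)

Section extension.
Variables (R : realType) (n : nat) (q : n.-tuple R) (s rho : R).
Local Notation E := (n.-tuple R).
Local Notation C := (R[i]).
Hypothesis q_gt1 : forall i, 1 < tnth q i.
Hypothesis rho_ge1 : 1 <= rho.
Hypothesis s_ge0 : 0 <= s.
Hypothesis s0_rho1 : s = 0 -> rho = 1.
Hypothesis small_cubes : n%:R * (1 - rho^-1) < n%:R - harmonic_sum q - s.
Local Notation N := (decomp_norm q s rho).

Let q_ge1 : exponents_ge1 q. Proof. by move=> i; exact: ltW. Qed.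

Variables (T Tp : (E -> C) -> (E -> C)) (Cm : R).
Hypothesis Tp_ext : Lmixed_extension q T Tp.
Hypothesis Cm_gt0 : 0 < Cm.
Hypothesis TpN : forall f, Lmixed q f -> (N (cmod (Tp f)) <= Cm%:E * N (cmod f))%E.

Lemma decomp_norm_Tp_sub (f1 f2 g : E -> C) : Lmixed q f1 -> Lmixed q f2 ->
  (N (cmod (fun x => (Tp f1 x - Tp f2 x)%R)) <=
   Cm%:E * (N (cmod (fun x => (f1 x - g x)%R)) + N (cmod (fun x => (f2 x - g x)%R))))%E.
Proof.
move=> L1 L2; apply: (@le_trans _ _ (N (cmod (Tp (fun x => f1 x - f2 x))))).
  by apply: le_decomp_norm; apply: filterS (Tp_sub Tp_ext L1 L2) => x; rewrite /cmod => ->.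
apply: le_trans (TpN (LmixedB q_gt1 L1 L2)) _.
rewrite lee_wpmul2l ?lee_fin ?(ltW Cm_gt0)//.
apply: le_trans (decomp_norm_dist s q_ge1 rho_ge1 f1 g f2) _.
by rewrite leeD2l// decomp_norm_distC.
Qed.

(** A sequence [psi] with errors [2^-i] determines the limit [h]; any other approximating sequence
    is compared with [psi] through [g]. *)
Lemma Tp_limit_exists (g : E -> C) : cmeasurable g -> (N (cmod g) < +oo)%E ->
  exists h : E -> C, [/\ cmeasurable h, (N (cmod h) <= Cm%:E * N (cmod g))%E &
    forall f : nat -> E -> C, (forall k, Lmixed q (f k)) ->
      (fun k => N (cmod (fun x => f k x - g x))) @ \oo --> 0%E ->
      (fun k => N (cmod (fun x => Tp (f k) x - h x))) @ \oo --> 0%E].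
Proof.
move=> mg gfin.
have [f0 df0 f0g] := decomp_norm_approx q_gt1 rho_ge1 mg gfin.
have N0 (f : E -> C) : (0 <= N (cmod f))%E by exact: decomp_norm_ge0.
have x01 : 0 <= (2^-1 : R) < 1 by lra.
have /choice[psi hpsi] : forall i : nat, exists f : E -> C, Lmixed q f /\
    (N (cmod (fun x => (f x - g x)%R)) <= (2^-1 ^+ i)%:E)%E.
  move=> i; have xi0 : 0 < (2^-1 : R) ^+ i by rewrite exprn_gt0.
  have [m _ /(_ m (leqnn m)) /= fm] := iffLR (cvg0P (fun k => N0 _)) f0g _ xi0.
  by exists (f0 m); split => //; have [] := df0 m.
have Lpsi i : Lmixed q (psi i) by have [] := hpsi i.
have Npsi i : (N (cmod (fun x => (psi i x - g x)%R)) <= (2^-1 ^+ i)%:E)%E by have [] := hpsi i.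
pose F i := Tp (psi i).
have mF i : cmeasurable (F i) by have [] := Tp_Lmixed Tp_ext (Lpsi i).
pose d i := N (cmod (increment F i)).
have d0 i : (0 <= d i)%E by exact: N0.
(* The constant 2 bounds [2^-(i+1) + 2^-i] by a multiple of [2^-i]. *)
have d_le i : (d i <= (Cm * 2)%:E * (2^-1 ^+ i)%:E)%E.
  apply: le_trans (decomp_norm_Tp_sub g (Lpsi i.+1) (Lpsi i)) _.
  rewrite EFinM -muleA lee_wpmul2l ?lee_fin ?(ltW Cm_gt0)//.
  apply: le_trans (leeD (Npsi i.+1) (Npsi i)) _.
  rewrite -EFinD -EFinM lee_fin exprS.
  have : 0 <= (2^-1 : R) ^+ i by rewrite exprn_ge0.
  by set y := _ ^+ i; lra.
have d_fin : (\sum_(0 <= i <oo) d i < +oo)%E.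
  rewrite nneseries_esumT//.
  apply: le_lt_trans (le_esum (fun i _ => d_le i)) _.
  rewrite esumZl; [|by rewrite mulr_ge0// ltW|by move=> i; rewrite lee_fin exprn_ge0].
  rewrite lte_mul_pinfty ?lee_fin ?mulr_ge0 ?(ltW Cm_gt0)//.
  exact: esum_geometric_lty.
have tail0 k : (0 <= \sum_(k <= i <oo) d i)%E by exact: nneseries_ge0.
have tail_cvg : (fun k => \sum_(k <= i <oo) d i)%E @ \oo --> 0%E.
  exact: nneseries_tail_cvg.
(* By countable subadditivity the sum of the moduli of the increments has finite norm. *)
have D_fin : {ae leb, forall x, (\sum_(0 <= i <oo) cmod (increment F i) x < +oo)%E}.
  apply: (@decomp_norm_lty_ae _ _ q s rho) => //.
  apply: le_lt_trans d_fin; apply: decomp_norm_nneseries => //; last exact: aeW.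
  by move=> k x; exact: cmod_ge0.
have [h mh hF] := fast_limit mF.
have hk k : (N (cmod (fun x => (h x - F k x)%R)) <= \sum_(k <= i <oo) d i)%E.
  rewrite -(nneseries_addn k)//; apply: decomp_norm_nneseries => //.
    by move=> i x; exact: cmod_ge0.
  apply: filterS D_fin => x /hF/(_ k) => hx; apply: le_trans hx _.
  by rewrite (nneseries_addn (f := fun i => cmod (increment F i) x))// => i; exact: cmod_ge0.
have psi_cvg : (fun k => N (cmod (fun x => psi k x - g x))) @ \oo --> 0%E.
  have geo : (fun k => ((2^-1 : R) ^+ k)%:E) @ \oo --> 0%E.
    by apply: cvg_EFin; [exact: nearW|apply: cvg_expr; rewrite ger0_norm//; lra].
  apply: (@cvg0_dominated _ 1 (fun k => ((2^-1 : R) ^+ k)%:E) (fun=> 0%E)) => //.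
  - by move=> k; rewrite adde0 mul1e.
  - exact: cvg_cst.
exists h; split => //.
  apply/lee_addgt0Pr => e e0.
  have sum0 k : (0 <= (Cm + 1)%:E * (\sum_(k <= i <oo) d i +
      N (cmod (fun x => (psi k x - g x)%R))))%E.
    by rewrite mule_ge0 ?adde_ge0// lee_fin addr_ge0// ltW.
  have sum_cvg : (fun k => (Cm + 1)%:E * (\sum_(k <= i <oo) d i +
      N (cmod (fun x => (psi k x - g x)%R))))%E @ \oo --> 0%E.
    apply: (@cvg0_dominated _ (Cm + 1) (fun k => \sum_(k <= i <oo) d i)%E
      (fun k => N (cmod (fun x => (psi k x - g x)%R)))) => //.
    by rewrite addr_gt0.
  have [k _ /(_ k (leqnn k)) /= ke] := iffLR (cvg0P sum0) sum_cvg e e0.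
  (* Here [h] is compared with [F k], and [psi k] with [g]; for the chosen [k] the two errors
     together are at most [e]. *)
  apply: le_trans (decomp_norm_triangle s q_ge1 rho_ge1 h (F k)) _.
  apply: le_trans (leeD (hk k) (TpN (Lpsi k))) _.
  apply: le_trans (leeD (lexx _) (lee_wpmul2l _
    (decomp_norm_triangle s q_ge1 rho_ge1 (psi k) g))) _.
    by rewrite lee_fin ltW.
  rewrite ge0_muleDr// addeA [leLHS]addeC leeD2l//; apply: le_trans ke.
  rewrite ge0_muleDr//; apply: leeD; last first.
    by rewrite lee_wpmul2r// lee_fin lerDl.
  by rewrite -[leLHS]mul1e lee_wpmul2r// lee_fin lerDr ltW.
move=> f Lf fg.
apply: (@cvg0_dominated _ (Cm + 1)
  (fun k => N (cmod (fun x => (f k x - g x)%R)) + N (cmod (fun x => (psi k x - g x)%R)))%E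
  (fun k => \sum_(k <= i <oo) d i)%E) => //.
- by rewrite addr_gt0.
- by move=> k; exact: adde_ge0.
- move=> k; apply: le_trans (decomp_norm_dist s q_ge1 rho_ge1 (Tp (f k)) (F k) h) _.
  rewrite ge0_muleDr ?adde_ge0//; apply: leeD.
    apply: le_trans (decomp_norm_Tp_sub g (Lf k) (Lpsi k)) _.
    by rewrite lee_wpmul2r ?adde_ge0// lee_fin lerDl.
  rewrite decomp_norm_distC; apply: le_trans (hk k) _.
  by rewrite -[leLHS]mul1e lee_wpmul2r// lee_fin lerDr ltW.
- apply: (@cvg0_dominated _ 1 (fun k => N (cmod (fun x => (f k x - g x)%R)))
    (fun k => N (cmod (fun x => (psi k x - g x)%R)))) => //.
  + by move=> k; exact: adde_ge0.
  + by move=> k; rewrite mul1e.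
Qed.

End extension.

(** * Consequences of the conditions on the exponents *)

Section exponents.
Variable R : realType.

Lemma conj_exp_fin (a : R) : 1 < a -> conj_exp a%:E = a / (a - 1).
Proof.
move=> a1; have a0 : a != 0 by rewrite gt_eqF// (lt_trans ltr01).
rewrite /conj_exp /hoelder_conjugate !eqe /= (negbTE a0).
by rewrite -EFinB inver subr_eq0 gt_eqF.
Qed.

Lemma conj_exp_gt1 (a : R) : 1 < a -> 1 < conj_exp a%:E.
Proof.
move=> a1; rewrite conj_exp_fin// ltr_pdivlMr ?subr_gt0// mul1r.
by rewrite ltrBlDr ltrDl.
Qed.

Lemma conj_exp_inv (a : R) : 1 < a -> (conj_exp a%:E)^-1 = 1 - a^-1.
Proof.
move=> a1; have a0 : a != 0 by rewrite gt_eqF// (lt_trans ltr01).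
by rewrite conj_exp_fin// invf_div mulrBl mulfV// mul1r.
Qed.

Lemma tnth_conj_vec n (p : n.-tuple R) i :
  tnth (conj_vec p) i = conj_exp (tnth p i)%:E.
Proof. by rewrite tnth_map. Qed.

Lemma harmonic_sum_conj_vec n (p : n.-tuple R) : (forall i, 1 < tnth p i) ->
  harmonic_sum (conj_vec p) = n%:R - harmonic_sum p.
Proof.
move=> p1; rewrite /harmonic_sum.
under eq_bigr do rewrite tnth_conj_vec conj_exp_inv//.
by rewrite sumrB sumr_const card_ord.
Qed.

Variables (n : nat) (p : n.-tuple R) (t : R) (r : \bar R).
Hypothesis n_gt0 : (0 < n)%N.
Hypothesis p_gt1 : forall i, 1 < tnth p i.
Hypothesis t_r_range :
  (1 < n%:R / harmonic_sum p /\ n%:R / harmonic_sum p < t /\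
     (t%:E < r)%E /\ (r < +oo)%E) \/
  (1 < n%:R / harmonic_sum p /\ n%:R / harmonic_sum p <= t /\ r = +oo%E).

Let s : R := harmonic_sum p - n%:R / t.

Let nR_gt0 : 0 < n%:R :> R. Proof. by rewrite ltr0n. Qed.

Let harmonic_gt0 : 0 < harmonic_sum p.
Proof.
rewrite /harmonic_sum (bigD1 (Ordinal n_gt0))//= ltr_pwDl//.
  by rewrite invr_gt0 (lt_trans ltr01).
by apply: sumr_ge0 => i _; rewrite invr_ge0 ltW// (lt_trans ltr01).
Qed.

Let t_gt1 : 1 < t.
Proof. by case: t_r_range => [[h1 [h2 _]]|[h1 [h2 _]]]; [lra|exact: lt_le_trans h2]. Qed.

Let t_gt0 : 0 < t. Proof. exact: lt_trans t_gt1. Qed.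

Lemma excess_ge0 : 0 <= s.
Proof.
rewrite /s subr_ge0 ler_pdivrMr// mulrC -ler_pdivrMr//.
by case: t_r_range => [[_ [/ltW]]|[_ []]].
Qed.

(** [1 - 1 / r'] is [1 / r], read as 0 for [r = +oo], where [r' = 1]; the inequality is then
    [t < r]. *)
Lemma conj_exp_r : exists2 a : R, conj_exp r = a & 1 <= a /\ 1 - a^-1 < t^-1.
Proof.
case: t_r_range => [[_ [_ []]]|[_ [_ ->]]].
  case: (r) => [b|//|//]; rewrite lte_fin => tb _.
  have b1 : 1 < b by exact: lt_trans tb.
  exists (conj_exp b%:E) => //; rewrite conj_exp_inv// ltW ?conj_exp_gt1//; split => //.
  by rewrite opprB addrC subrK ltf_pV2// posrE (lt_trans ltr01).
by exists 1; rewrite /conj_exp ?hoelder_conjugatey// lexx invr1 subrr invr_gt0.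
Qed.

Lemma conj_exp_ge1 : 1 <= conj_exp r.
Proof. by have [a -> []] := conj_exp_r. Qed.

(** [s = 0] means [t = n / harmonic_sum p], which the strict inequality excludes for finite [r]; for
    [r = +oo] the conjugate is 1. *)
Lemma s0_conj_exp1 : s = 0 -> conj_exp r = 1.
Proof.
move=> /eqP; rewrite /s subr_eq0 => /eqP hs.
case: t_r_range => [[_ [ht _]]|[_ [_ ->]]]; last by rewrite /conj_exp hoelder_conjugatey.
move: ht; rewrite hs invf_div mulrCA mulfV ?gt_eqF// mulr1 ltxx//.
Qed.

(** The left-hand side is [n / r] and the right-hand side [n / t]. *)
Lemma small_cubes_decay :
  n%:R * (1 - (conj_exp r)^-1) < n%:R - harmonic_sum (conj_vec p) - s.
Proof.
have [a -> [_ ra]] := conj_exp_r.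
rewrite harmonic_sum_conj_vec// /s.
rewrite (_ : _ - _ - _ = n%:R * t^-1); last by ring.
by rewrite ltr_pM2l.
Qed.

End exponents.

Theorem theorem6p28 (R : realType) (n : nat) (p : n.-tuple R) (t : R)
    (r : \bar R) (n_gt0 : (0 < n)%N) (p_gt1 : forall i : 'I_n, 1 < tnth p i)
    (t_r_range :
       (1 < n%:R / harmonic_sum p /\ n%:R / harmonic_sum p < t /\
          (t%:E < r)%E /\ (r < +oo)%E) \/
       (1 < n%:R / harmonic_sum p /\ n%:R / harmonic_sum p <= t /\
          r = +oo%E))
    (T : (n.-tuple R -> R[i]) -> (n.-tuple R -> R[i]))
    (T_sio : singular_integral_operator T)
    (Tp : (n.-tuple R -> R[i]) -> (n.-tuple R -> R[i]))
    (Tp_ext : Lmixed_extension (conj_vec p) T Tp) :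
  exists2 S : (n.-tuple R -> R[i]) -> (n.-tuple R -> R[i]),
    continuous_extension p t r Tp S &
    exists2 C : R, 0 < C &
      forall g : n.-tuple R -> R[i], block_space p t r g ->
        (block_norm p t r (S g) <= C%:E * block_norm p t r g)%E.
Proof.
set q := conj_vec p; pose s := harmonic_sum p - n%:R / t.
have q_gt1 i : 1 < tnth q i by rewrite tnth_conj_vec conj_exp_gt1.
have q_ge1 : exponents_ge1 q by move=> i; exact: ltW.
have rho_ge1 : 1 <= conj_exp r by exact: conj_exp_ge1 t_r_range.
have s0 : 0 <= s by exact: excess_ge0 t_r_range.
have s0_rho1 : s = 0 -> conj_exp r = 1 by exact: s0_conj_exp1 t_r_range.
have small : n%:R * (1 - (conj_exp r)^-1) < n%:R - harmonic_sum q - s.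
  exact: small_cubes_decay t_r_range.
have [Cm Cm0 TpN] := decomp_norm_Tp_le q_gt1 rho_ge1 small T_sio Tp_ext.
have bnE g := @block_normE R n p t r n_gt0 q_ge1 rho_ge1 g.
have bsP g := @block_spaceP R n p t r n_gt0 q_ge1 rho_ge1 g.
have bcE (f : nat -> n.-tuple R -> R[i]) g : (forall k, cmeasurable (f k)) ->
    cmeasurable g -> block_cvg p t r f g <->
    (fun k => decomp_norm q s (conj_exp r) (cmod (fun x => f k x - g x))) @ \oo --> 0%E.
  move=> mf mg; rewrite /block_cvg.
  rewrite (_ : (fun k => block_norm p t r _) = fun k =>
    decomp_norm q s (conj_exp r) (cmod (fun x => f k x - g x)))//.
  by apply/funext => k; rewrite bnE//; exact: cmeasurableB.
have mT f : Lmixed q f -> cmeasurable (Tp f) by move=> /(Tp_Lmixed Tp_ext)[].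
(* Choice turns the limits into an operator; outside the block space its value is arbitrary. *)
have /choice[L HL] : forall g, exists h, block_space p t r g ->
    [/\ cmeasurable h,
      (decomp_norm q s (conj_exp r) (cmod h) <= Cm%:E * decomp_norm q s (conj_exp r) (cmod g))%E &
      forall f, (forall k, Lmixed q (f k)) -> block_cvg p t r f g ->
        block_cvg p t r (fun k => Tp (f k)) h].
  move=> g; have [bg|nbg] := pselect (block_space p t r g); last by exists g.
  have [mg gfin] := iffLR (bsP g) bg.
  have [h [mh hN hcvg]] :=
    Tp_limit_exists q_gt1 rho_ge1 s0 s0_rho1 small Tp_ext Cm0 TpN mg gfin.
  exists h => _; split => // f Lf fg.
  apply/bcE => //; first by move=> k; exact: mT.
  by apply: hcvg => //; apply/bcE => // k; have [] := Lf k.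
(* On functions of the mixed space [Tp f] itself has the properties asked of the limit, so it may
   replace the chosen one. *)
have Tp_limit f : Lmixed q f -> block_space p t r f ->
    [/\ cmeasurable (Tp f),
      (decomp_norm q s (conj_exp r) (cmod (Tp f)) <=
        Cm%:E * decomp_norm q s (conj_exp r) (cmod f))%E &
      forall f', (forall k, Lmixed q (f' k)) -> block_cvg p t r f' f ->
        block_cvg p t r (fun k => Tp (f' k)) (Tp f)].
  move=> Lf bf; have [mf _] := Lf; split; [exact: mT|exact: TpN|move=> f' Lf' ff'].
  apply/bcE; [by move=> k; exact: mT|exact: mT|].
  have mf' k : cmeasurable (f' k) by have [] := Lf' k.
  move/bcE : ff' => /(_ mf' mf) ff'.
  apply: (@cvg0_dominated _ Cm (fun k => decomp_norm q s (conj_exp r)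
      (cmod (fun x => (f' k x - f x)%R))) (fun=> 0%E)) => //.
  - by move=> k; exact: decomp_norm_ge0.
  - by move=> k; exact: decomp_norm_ge0.
  (* The intermediate function is [f] itself, so the second distance vanishes and only that of
     [f' k] to [f] remains. *)
  - move=> k; apply: le_trans (decomp_norm_Tp_sub q_gt1 rho_ge1 Tp_ext Cm0 TpN f (Lf' k) Lf) _.
    rewrite (_ : (fun x => f x - f x) = fun=> 0); last by apply/funext => x; rewrite subrr.
    rewrite (_ : cmod (fun=> 0) = fun=> 0%E); last by apply/funext => x; rewrite /cmod normc0.
    by rewrite decomp_norm_cst0.
  - exact: cvg_cst.
(* The chosen limit need not be the representative [Tp g]; taking [Tp g] on the dense subspace makes
   [S] agree with [Tp] there by definition. *)
pose S g := if pselect (dense_subspace p g) then Tp g else L g.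
have HS g : block_space p t r g -> [/\ cmeasurable (S g),
      (decomp_norm q s (conj_exp r) (cmod (S g)) <=
        Cm%:E * decomp_norm q s (conj_exp r) (cmod g))%E &
      forall f, (forall k, Lmixed q (f k)) -> block_cvg p t r f g ->
        block_cvg p t r (fun k => Tp (f k)) (S g)].
  move=> bg; rewrite /S; case: pselect => [dg|ndg] /=; last exact: HL.
  by apply: Tp_limit => //; case: dg.
exists S; last first.
  exists Cm => // g bg; have [mS NS _] := HS g bg.
  by have [mg _] := iffLR (bsP g) bg; rewrite !bnE.
split.
- move=> g bg; have [mS NS _] := HS g bg; apply/bsP; split => //.
  apply: le_lt_trans NS _; have [_ gfin] := iffLR (bsP g) bg.
  by rewrite lte_mul_pinfty ?lee_fin ?ltW// ge0_fin_numE// decomp_norm_ge0.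
- by move=> f df; rewrite /S; case: pselect => // dg; exact: aeW.
- move=> g bg; have [mS _ Scvg] := HS g bg; split.
    have [mg gfin] := iffLR (bsP g) bg.
    have [f df fg] := decomp_norm_approx q_gt1 rho_ge1 mg gfin.
    exists f => //; apply/bcE => // k; have [[]] := df k; done.
  by move=> f df; apply: Scvg => k; have [] := df k.
Qed.
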